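(* The space $S_6(\Gamma_0(3))$ is one-dimensional, and its unitary generator is $F_{6,3}^{(1)} = E_{6,3}^{(1)} - 27E_{6,3}^{(2)}$. For every integer $k$ with $4\le k\le 9$, $\dim S_{2k}(\Gamma_0(3)) - \dim M_{2(k-3)}(\Gamma_0(3)) = 0 = \dim S_6(\Gamma_0(3)) - 1$. Moreover, for every integer $k\ge 3$, a unitary upper triangular basis $\mathcal{C}_{2k}(\Gamma_0(3))$ of $S_{2k}(\Gamma_0(3))$ is given by $\mathcal{C}_{2k}(\Gamma_0(3)) = F_{6,3}^{(1)}\,\mathcal{B}_{2k-6}(\Gamma_0(3))$.
   Context: $\tau$ lies in the Poincaré upper half plane, $q=e^{2i\pi\tau}$, and $\eta$ is Dedekind's eta function. $M_{2k}(\Gamma_0(N))$ and $S_{2k}(\Gamma_0(N))$ are the spaces of modular forms and of cusp forms of weight $2k$ on $\Gamma_0(N)$. The valuation of a nonzero form is its order in $q$ at $\infty$; a form is unitary if its leading $q$-coefficient is $1$; a family is unitary upper triangular if all its members are unitary and their valuations are strictly increasing. $\mathcal{B}_{2k}(\Gamma_0(3))$ denotes a unitary upper triangular basis of $M_{2k}(\Gamma_0(3))$, with $M_0(\Gamma_0(3))=\mathbb{C}$ and $\mathcal{B}_0(\Gamma_0(3))=(1)$. For a form $F$ and a family $(b_i)$, $F\,(b_i)$ denotes the family $(Fb_i)$. $(E_{6,3}^{(0)},E_{6,3}^{(1)},E_{6,3}^{(2)})$ is a unitary upper triangular basis of the three-dimensional space $M_6(\Gamma_0(3))$, with valuations $0,1,2$.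 Its last element is $E_{6,3}^{(2)}(\tau)=\Delta_3(\tau)=\eta(3\tau)^{18}\eta(\tau)^{-6}=q^2+6q^3+27q^4+O(q^5)$. Its element $E_{6,3}^{(1)}$ is the unique form in $M_6(\Gamma_0(3))$ with expansion $q+21q^2+O(q^3)$. *)

(* Defs.v *)
(* Stdlib real numbers with Coquelicot's complex numbers.

   A function on the upper half plane is represented by a function C -> C of
   which only the values at points of positive imaginary part matter:
   equalities of forms, linear relations and expansions below are all
   restricted to such points. *)
From Stdlib Require Import Reals ZArith List.
From Coquelicot Require Import Coquelicot.

Definition upper (tau : C) : Prop := (0 < Im tau)%R.

Definition Cexp (z : C) : C :=
  (RtoC (exp (Re z)) * (cos (Im z), sin (Im z)))%C.

(* e^(2 i pi tau / h); the variable q is the case h = 1 *)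
Definition qh (h : nat) (tau : C) : C :=
  Cexp (2 * PI * Ci * tau / INR h)%C.

Record mat2 := Mat2 { ma : Z; mb : Z; mc : Z; md : Z }.

Definition SL2Z (g : mat2) : Prop := (ma g * md g - mb g * mc g = 1)%Z.

Definition Gamma0 (N : nat) (g : mat2) : Prop :=
  SL2Z g /\ (Z.of_nat N | mc g)%Z.

Definition autj (g : mat2) (tau : C) : C := (IZR (mc g) * tau + IZR (md g))%C.

Definition moebius (g : mat2) (tau : C) : C :=
  ((IZR (ma g) * tau + IZR (mb g)) / autj g tau)%C.

Definition slash (w : nat) (f : C -> C) (g : mat2) (tau : C) : C :=
  (f (moebius g tau) / autj g tau ^ w)%C.

(* f(tau) = sum_(n >= 0) a_n e^(2 i pi n tau / h) on the upper half plane *)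
Definition has_qexp (h : nat) (f : C -> C) (a : nat -> C) : Prop :=
  forall tau : C, upper tau ->
    is_pseries (K := C_AbsRing) (V := C_NormedModule) a (qh h tau) (f tau).

(* The conjugates f|g of a form f on Gamma0(N) are invariant under
   tau -> tau + N because Gamma(N) is normal in SL2(Z), so holomorphy and
   vanishing at all cusps are read off expansions in e^(2 i pi tau / N). *)
Record modular_form (N w : nat) (f : C -> C) : Prop := {
  mf_holomorphic : forall tau : C, upper tau ->
    ex_derive (K := C_AbsRing) (V := C_NormedModule) f tau;
  mf_invariant : forall g : mat2, Gamma0 N g ->
    forall tau : C, upper tau -> slash w f g tau = f tau;
  mf_cusps : forall g : mat2, SL2Z g ->
    exists a : nat -> C, has_qexp N (slash w f g) a }.

Definition cusp_form (N w : nat) (f : C -> C) : Prop :=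
  modular_form N w f /\
  forall g : mat2, SL2Z g ->
    exists a : nat -> C, has_qexp N (slash w f g) a /\ a 0%nat = 0%C.

Fixpoint lincomb (c : nat -> C) (B : list (C -> C)) (tau : C) : C :=
  match B with
  | nil => 0%C
  | b :: B' => (c 0%nat * b tau + lincomb (fun i => c (S i)) B' tau)%C
  end.

Definition is_basis (V : (C -> C) -> Prop) (B : list (C -> C)) : Prop :=
  (forall b : C -> C, In b B -> V b) /\
  (forall c : nat -> C,
     (forall tau : C, upper tau -> lincomb c B tau = 0%C) ->
     forall i : nat, (i < length B)%nat -> c i = 0%C) /\
  (forall f : C -> C, V f ->
     exists c : nat -> C,
       forall tau : C, upper tau -> f tau = lincomb c B tau).

Definition has_dim (V : (C -> C) -> Prop) (n : nat) : Prop :=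
  exists B : list (C -> C), is_basis V B /\ length B = n.

Definition valuation (f : C -> C) (n : nat) : Prop :=
  exists a : nat -> C, has_qexp 1 f a /\
    (forall m : nat, (m < n)%nat -> a m = 0%C) /\ a n <> 0%C.

Definition unitary (f : C -> C) : Prop :=
  exists (a : nat -> C) (n : nat), has_qexp 1 f a /\
    (forall m : nat, (m < n)%nat -> a m = 0%C) /\ a n = 1%C.

Definition unitary_upper_triangular (B : list (C -> C)) : Prop :=
  (forall b : C -> C, In b B -> unitary b) /\
  (forall i j m n : nat, (i < j < length B)%nat ->
     valuation (nth i B (fun _ => 0%C)) m ->
     valuation (nth j B (fun _ => 0%C)) n -> (m < n)%nat).

Definition uut_basis (V : (C -> C) -> Prop) (B : list (C -> C)) : Prop :=
  is_basis V B /\ unitary_upper_triangular B.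

Definition scale_family (F : C -> C) (B : list (C -> C)) : list (C -> C) :=
  map (fun (b : C -> C) (tau : C) => (F tau * b tau)%C) B.

Fixpoint eta_prod (q : C) (n : nat) : C :=
  match n with
  | O => 1%C
  | S m => (eta_prod q m * (1 - q ^ S m))%C
  end.

(* e^(2 i pi tau / 24) prod_(n >= 1) (1 - q^n); the limit of the partial
   products is taken on real and imaginary parts. *)
Definition eta (tau : C) : C :=
  (qh 24 tau *
   (real (Lim_seq (fun n => Re (eta_prod (qh 1 tau) n))),
    real (Lim_seq (fun n => Im (eta_prod (qh 1 tau) n)))))%C.

Definition Delta3 (tau : C) : C := (eta (3 * tau) ^ 18 / eta tau ^ 6)%C.

Definition E63_2 : C -> C := Delta3.

(* f = q + 21 q^2 + O(q^3); this determines f on the upper half plane, the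
   valuations occurring in weight 6 on Gamma0(3) being 0, 1 and 2. *)
Definition is_E63_1 (f : C -> C) : Prop :=
  modular_form 3 6 f /\
  exists a : nat -> C, has_qexp 1 f a /\
    a 0%nat = 0%C /\ a 1%nat = 1%C /\ a 2%nat = 21%C.

Definition F63_1 (E63_1 : C -> C) (tau : C) : C :=
  (E63_1 tau - 27 * E63_2 tau)%C.

(* Main.v *)
Require Import Defs.
From Stdlib Require Import Reals ZArith List.
From Coquelicot Require Import Coquelicot.
From Stdlib Require Import Lra Lia Psatz Classical.
Open Scope R_scope.

(* All the analysis rests on power series on the unit disc, since a form is given by such series in
   e^(2 i pi tau / 3) at every cusp.

   Eta. The partial fraction expansion of pi^2 / sin^2 (pi z) follows from the duplication formula, which
   halves any bound on the difference of the two sides. Exchanging the two summations in the Eisenstein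
   series of weight 2 and comparing the tails with the cotangent series gives its transformation
   under tau -> -1/tau; it is a multiple of the logarithmic derivative of eta, so
   eta(-1/tau)^2 = -i tau eta(tau)^2. Hence Delta_3 and H = eta(tau)^6 eta(3 tau)^6 have explicit expansions
   at both cusps, and they are modular because Gamma_0(3) is generated by T, [1,0;3,1]
   and -1.

   Valence. For f of weight 2k let g(tau) = f(tau) f(-1/(3 tau)) tau^(-2k) up to a constant. Then
   g^3 / H^(2k) is invariant under T and tau -> -1/(3 tau), so each of its values is taken at a point with
   Im tau >= 1/4, i.e. |q| <= 1/3; if it vanishes at infinity, the Cauchy estimates make it zero.
   So a nonzero form of weight 6 has at most 2 zeros at the cusps, which gives E^(1) - 27 E^(2) = H.

   As H has no zero on the upper half plane and simple zeros at both cusps, division by H maps S_(2k) to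
   M_(2k-6). *)

(** * Complex sequences and series *)

(** Cauchy estimates come from averages over roots of unity, and the valence bound from one function
    on the quotient where the Fricke involution identifies the two cusps, so no contour integral
    occurs. The cube is forced by weights: f times its conjugate has weight 4k, H has weight 6, and
    3 * 4k = 6 * 2k; the even exponent 2k also removes the sign that H acquires under the
    involution. The order left at infinity is 3(m + m') - 2k when f has orders m and m' at the
    cusps, hence the threshold m + m' > 2k/3. The radius 1/3 works because (1/3) / (1 - 1/3) < 1.
    The double series of weight 2 converges only conditionally, and exchanging its sums leaves the
    term pi i / tau. It comes from the tails |d| > N: they are telescoping up to terms that add up
    to O(1/N), and summed over c they give a cotangent at N / tau, which tends to pi i because Im (N
    / tau) tends to minus infinity. The equality of dimensions rests on no dimension formula: some
    finite basis of M_(2k-6) is carried to S_(2k) by multiplication by H. *)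

Definition Clim (u : nat -> C) (l : C) : Prop :=
  forall eps : R, 0 < eps ->
    exists N : nat, forall n : nat, (N <= n)%nat -> Cmod (u n - l) < eps.

Lemma Cmod_triangle3 (x y z : C) : Cmod (x - z) <= Cmod (x - y) + Cmod (y - z).
Proof.
  replace (x - z)%C with ((x - y) + (y - z))%C by ring. apply Cmod_triangle.
Qed.

Lemma Cmod_sub_sym (x y : C) : Cmod (x - y) = Cmod (y - x).
Proof. replace (y - x)%C with (- (x - y))%C by ring. symmetry. apply Cmod_opp. Qed.

Lemma Cmod_sub_ge (x y : C) : Cmod x - Cmod y <= Cmod (x - y).
Proof.
  pose proof (Cmod_triangle (x - y) y) as H.
  replace (x - y + y)%C with x in H by ring. lra.
Qed.

Lemma Cmod_small_0 (x : C) : (forall eps, 0 < eps -> Cmod x <= eps) -> x = 0%C.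
Proof.
  intros H. apply Cmod_eq_0. destruct (Cmod_ge_0 x) as [h|h]; [|lra].
  specialize (H (Cmod x / 2)). lra.
Qed.

Lemma Clim_unique u l1 l2 : Clim u l1 -> Clim u l2 -> l1 = l2.
Proof.
  intros H1 H2. cut (l1 - l2 = 0)%C.
  { intros E. replace l1 with (l1 - l2 + l2)%C by ring. rewrite E. ring. }
  apply Cmod_small_0. intros eps He.
  destruct (H1 (eps / 2) ltac:(lra)) as [N1 h1].
  destruct (H2 (eps / 2) ltac:(lra)) as [N2 h2].
  specialize (h1 (max N1 N2) ltac:(lia)). specialize (h2 (max N1 N2) ltac:(lia)).
  pose proof (Cmod_triangle3 l1 (u (max N1 N2)) l2).
  rewrite (Cmod_sub_sym l1 (u _)) in H. lra.
Qed.

Lemma Clim_ext_from u v l (N : nat) :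
  (forall n, (N <= n)%nat -> u n = v n) -> Clim u l -> Clim v l.
Proof.
  intros H Hu eps He. destruct (Hu eps He) as [M h]. exists (max N M).
  intros n Hn. rewrite <- H by lia. apply h. lia.
Qed.

Lemma Clim_ext u v l : (forall n, u n = v n) -> Clim u l -> Clim v l.
Proof. intros H. apply Clim_ext_from with 0%nat. auto. Qed.

Lemma Clim_const (c : C) : Clim (fun _ => c) c.
Proof.
  intros eps He. exists 0%nat. intros. replace (c - c)%C with (RtoC 0) by ring.
  rewrite Cmod_0. lra.
Qed.

Lemma Clim_plus u v l m : Clim u l -> Clim v m -> Clim (fun n => u n + v n)%C (l + m)%C.
Proof.
  intros H1 H2 eps He.
  destruct (H1 (eps / 2) ltac:(lra)) as [N1 h1].
  destruct (H2 (eps / 2) ltac:(lra)) as [N2 h2].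
  exists (max N1 N2). intros n Hn.
  specialize (h1 n ltac:(lia)). specialize (h2 n ltac:(lia)).
  replace (u n + v n - (l + m))%C with ((u n - l) + (v n - m))%C by ring.
  pose proof (Cmod_triangle (u n - l) (v n - m)). lra.
Qed.

Lemma Clim_le_0 (u : nat -> C) (x : nat -> R) (l : C) :
  (forall n, Cmod (u n - l) <= x n) ->
  (forall eps, 0 < eps -> exists N, forall n, (N <= n)%nat -> x n < eps) ->
  Clim u l.
Proof.
  intros H Hx eps He. destruct (Hx eps He) as [N h]. exists N. intros n Hn.
  eapply Rle_lt_trans; [apply H|]. auto.
Qed.

Lemma Clim_scal (c : C) u l : Clim u l -> Clim (fun n => c * u n)%C (c * l)%C.
Proof.
  intros H eps He. pose proof (Cmod_ge_0 c) as Hc.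
  destruct (H (eps / (Cmod c + 1))) as [N h]. { apply Rdiv_lt_0_compat; lra. }
  exists N. intros n Hn. specialize (h n Hn).
  replace (c * u n - c * l)%C with (c * (u n - l))%C by ring. rewrite Cmod_mult.
  apply Rle_lt_trans with ((Cmod c + 1) * Cmod (u n - l)).
  { pose proof (Cmod_ge_0 (u n - l)). nra. }
  apply Rlt_le_trans with ((Cmod c + 1) * (eps / (Cmod c + 1))).
  { apply Rmult_lt_compat_l; lra. }
  right. field. lra.
Qed.

Lemma Clim_opp u l : Clim u l -> Clim (fun n => - u n)%C (- l)%C.
Proof.
  intros H. replace (- l)%C with ((-1) * l)%C by ring.
  eapply Clim_ext; [|apply Clim_scal, H]. intros; simpl; ring.
Qed.

Lemma Clim_minus u v l m : Clim u l -> Clim v m -> Clim (fun n => u n - v n)%C (l - m)%C.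
Proof. intros. apply Clim_plus; [|apply Clim_opp]; auto. Qed.

Lemma Clim_Cmod_le u l B : Clim u l -> (forall n, Cmod (u n) <= B) -> Cmod l <= B.
Proof.
  intros H HB. apply Rnot_lt_le. intros h.
  destruct (H (Cmod l - B) ltac:(lra)) as [N hN]. specialize (hN N ltac:(lia)).
  specialize (HB N). pose proof (Cmod_sub_ge l (u N)). rewrite Cmod_sub_sym in H0. lra.
Qed.

Lemma Clim_subseq u l (phi : nat -> nat) :
  (forall n, (n <= phi n)%nat) -> Clim u l -> Clim (fun n => u (phi n)) l.
Proof.
  intros Hp H eps He. destruct (H eps He) as [N h]. exists N. intros n Hn.
  apply h. specialize (Hp n). lia.
Qed.

Lemma Clim_shift u l : Clim (fun n => u (S n)) l -> Clim u l.
Proof.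
  intros H eps He. destruct (H eps He) as [N h]. exists (S N). intros n Hn.
  destruct n; [lia|]. apply h. lia.
Qed.

Lemma Clim_Re u l : Clim u l -> is_lim_seq (fun n => Re (u n)) (Re l).
Proof.
  intros H. apply is_lim_seq_spec. intros eps. destruct (H eps (cond_pos eps)) as [N h].
  exists N. intros n Hn. specialize (h n Hn).
  eapply Rle_lt_trans; [|apply h]. eapply Rle_trans; [|apply Rmax_Cmod].
  apply Rmax_l.
Qed.

Lemma Clim_Im u l : Clim u l -> is_lim_seq (fun n => Im (u n)) (Im l).
Proof.
  intros H. apply is_lim_seq_spec. intros eps. destruct (H eps (cond_pos eps)) as [N h].
  exists N. intros n Hn. specialize (h n Hn).
  eapply Rle_lt_trans; [|apply h]. eapply Rle_trans; [|apply Rmax_Cmod].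
  apply Rmax_r.
Qed.

(** Limits are taken coordinatewise as in the definition of [eta], so that the product there is
    convertible to a [Clim_val]. *)
Definition Clim_val (u : nat -> C) : C :=
  (real (Lim_seq (fun n => Re (u n))), real (Lim_seq (fun n => Im (u n)))).

Lemma Clim_val_eq u l : Clim u l -> Clim_val u = l.
Proof.
  intros H. unfold Clim_val.
  rewrite (is_lim_seq_unique _ _ (Clim_Re _ _ H)), (is_lim_seq_unique _ _ (Clim_Im _ _ H)).
  destruct l; reflexivity.
Qed.

Lemma Cmod_le_Re_Im (z : C) : Cmod z <= Rabs (Re z) + Rabs (Im z).
Proof.
  destruct z as [x y]. simpl.
  replace (x, y) with ((RtoC x) + Ci * (RtoC y))%C
    by (unfold RtoC, Ci, Cmult, Cplus; simpl; f_equal; ring).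
  eapply Rle_trans; [apply Cmod_triangle|].
  rewrite Cmod_mult, !Cmod_R. replace (Cmod Ci) with 1; [lra|].
  unfold Cmod, Ci. simpl. rewrite <- sqrt_1 at 1. f_equal. ring.
Qed.

Lemma Cmod_Re_le (z : C) : Rabs (Re z) <= Cmod z.
Proof. eapply Rle_trans; [|apply Rmax_Cmod]. apply Rmax_l. Qed.

Lemma Cmod_Im_le (z : C) : Rabs (Im z) <= Cmod z.
Proof. eapply Rle_trans; [|apply Rmax_Cmod]. apply Rmax_r. Qed.

Lemma Clim_Cauchy (u : nat -> C) :
  (forall eps, 0 < eps -> exists N, forall n m, (N <= n)%nat -> (N <= m)%nat ->
     Cmod (u n - u m) < eps) -> exists l, Clim u l.
Proof.
  intros H.
  destruct (Rcomplete.R_complete (fun n => Re (u n))) as [x hx].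
  { intros eps He. destruct (H eps He) as [N h]. exists N. intros n m Hn Hm.
    unfold R_dist. eapply Rle_lt_trans; [|apply (h n m); lia].
    exact (Cmod_Re_le (u n - u m)). }
  destruct (Rcomplete.R_complete (fun n => Im (u n))) as [y hy].
  { intros eps He. destruct (H eps He) as [N h]. exists N. intros n m Hn Hm.
    unfold R_dist. eapply Rle_lt_trans; [|apply (h n m); lia].
    exact (Cmod_Im_le (u n - u m)). }
  exists (x, y). intros eps He.
  destruct (hx (eps / 2) ltac:(lra)) as [N1 h1].
  destruct (hy (eps / 2) ltac:(lra)) as [N2 h2].
  exists (max N1 N2). intros n Hn.
  eapply Rle_lt_trans; [apply Cmod_le_Re_Im|].
  specialize (h1 n ltac:(lia)). specialize (h2 n ltac:(lia)).
  unfold R_dist in *. simpl. unfold Re, Im, Rminus in *. lra.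
Qed.

(** * Partial sums, absolute convergence and exchange of limits *)

Fixpoint psum (u : nat -> C) (n : nat) : C :=
  match n with O => 0%C | S m => (psum u m + u m)%C end.

Fixpoint rsum (x : nat -> R) (n : nat) : R :=
  match n with O => 0 | S m => rsum x m + x m end.

Definition Cser (u : nat -> C) (l : C) : Prop := Clim (psum u) l.

Lemma psum_ext u v n : (forall i, (i < n)%nat -> u i = v i) -> psum u n = psum v n.
Proof. induction n; intros H; simpl; [auto|]. rewrite IHn, H; auto. Qed.

Lemma rsum_ext u v n : (forall i, (i < n)%nat -> u i = v i) -> rsum u n = rsum v n.
Proof. induction n; intros H; simpl; [auto|]. rewrite IHn, H; auto. Qed.

Lemma psum_plus u v n : psum (fun i => u i + v i)%C n = (psum u n + psum v n)%C.
Proof. induction n; simpl; [ring|]. rewrite IHn. ring. Qed.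

Lemma psum_scal c u n : psum (fun i => c * u i)%C n = (c * psum u n)%C.
Proof. induction n; simpl; [ring|]. rewrite IHn. ring. Qed.

Lemma psum_0 n : psum (fun _ => 0%C) n = 0%C.
Proof. induction n; simpl; [auto|]. rewrite IHn. ring. Qed.

Lemma psum_first u n : psum u (S n) = (u O + psum (fun i => u (S i)) n)%C.
Proof. induction n; [simpl; ring|]. simpl in *. rewrite IHn. ring. Qed.

Lemma psum_add u n m : psum u (n + m) = (psum u n + psum (fun i => u (n + i)%nat) m)%C.
Proof.
  induction m; [rewrite Nat.add_0_r; simpl; ring|].
  rewrite Nat.add_succ_r. simpl. rewrite IHm. ring.
Qed.

Lemma rsum_scal c u n : rsum (fun i => c * u i) n = c * rsum u n.
Proof. induction n; simpl; [ring|]. rewrite IHn. ring. Qed.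

Lemma rsum_plus u v n : rsum (fun i => u i + v i) n = rsum u n + rsum v n.
Proof. induction n; simpl; [ring|]. rewrite IHn. ring. Qed.

Lemma rsum_add u n m : rsum u (n + m) = rsum u n + rsum (fun i => u (n + i)%nat) m.
Proof.
  induction m; [rewrite Nat.add_0_r; simpl; ring|].
  rewrite Nat.add_succ_r. simpl. rewrite IHm. ring.
Qed.

Lemma rsum_le u v n : (forall i, (i < n)%nat -> u i <= v i) -> rsum u n <= rsum v n.
Proof.
  induction n; intros H; simpl; [lra|].
  apply Rplus_le_compat; [apply IHn|apply H]; auto.
Qed.

Lemma rsum_pos u n : (forall i, (i < n)%nat -> 0 <= u i) -> 0 <= rsum u n.
Proof.
  induction n; intros H; simpl; [lra|].
  apply Rplus_le_le_0_compat; [apply IHn|apply H]; auto.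
Qed.

Lemma rsum_mono u n m : (forall i, 0 <= u i) -> (n <= m)%nat -> rsum u n <= rsum u m.
Proof.
  intros H Hnm. replace m with (n + (m - n))%nat by lia. rewrite rsum_add.
  pose proof (rsum_pos (fun i => u (n + i)%nat) (m - n) (fun i _ => H _)). lra.
Qed.

Lemma rsum_term_le u n i : (forall i, 0 <= u i) -> (i < n)%nat -> u i <= rsum u n.
Proof.
  intros H Hi. pose proof (rsum_mono u (S i) n H ltac:(lia)). simpl in H0.
  pose proof (rsum_pos u i ltac:(auto)). lra.
Qed.

Lemma psum_Cmod u n : Cmod (psum u n) <= rsum (fun i => Cmod (u i)) n.
Proof.
  induction n; simpl; [rewrite Cmod_0; lra|].
  eapply Rle_trans; [apply Cmod_triangle|]. lra.
Qed.

Lemma psum_switch (u : nat -> nat -> C) n m :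
  psum (fun i => psum (u i) m) n = psum (fun j => psum (fun i => u i j) n) m.
Proof.
  induction n; simpl; [rewrite psum_0; auto|]. rewrite IHn, <- psum_plus. reflexivity.
Qed.

(** For nonnegative terms this is convergence, without a name for the sum. *)
Definition summable (x : nat -> R) : Prop := exists B, forall n, rsum x n <= B.

Lemma summable_le x y : (forall n, x n <= y n) -> summable y -> summable x.
Proof.
  intros H [B h]. exists B. intros n. eapply Rle_trans; [apply rsum_le|apply (h n)]. auto.
Qed.

Lemma summable_scal c x : 0 <= c -> summable x -> summable (fun n => c * x n).
Proof.
  intros Hc [B h]. exists (c * B). intros n. rewrite rsum_scal.
  apply Rmult_le_compat_l; auto.
Qed.

Lemma summable_plus x y : summable x -> summable y -> summable (fun n => x n + y n).
Proof.
  intros [B h] [B' h']. exists (B + B'). intros n. rewrite rsum_plus.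
  specialize (h n). specialize (h' n). lra.
Qed.

(** Some partial sum comes within [eps] of their supremum, and all later ones lie in between. *)
Lemma summable_tail x : (forall n, 0 <= x n) -> summable x ->
  forall eps, 0 < eps -> exists N, forall n m, (N <= n)%nat -> (n <= m)%nat ->
    rsum x m - rsum x n < eps.
Proof.
  intros Hx [B hB] eps He.
  destruct (completeness (fun y => exists n, y = rsum x n)) as [l [hl1 hl2]].
  { exists B. intros y [n ->]. auto. }
  { exists 0, O. auto. }
  destruct (classic (exists N, l - eps < rsum x N)) as [[N hN]|hN].
  - exists N. intros n m Hn Hm.
    pose proof (rsum_mono x N n Hx Hn).
    assert (rsum x m <= l) by (apply hl1; eexists; eauto). lra.
  - exfalso. assert (l <= l - eps); [|lra]. apply hl2. intros y [n ->].
    apply Rnot_lt_le. intros h. apply hN. eauto.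
Qed.

Lemma summable_bounded x : (forall n, 0 <= x n) -> summable x -> exists B, forall n, x n <= B.
Proof.
  intros Hx [B hB]. exists B. intros n.
  eapply Rle_trans; [apply (rsum_term_le x (S n)); auto|auto].
Qed.

Lemma psum_diff_le u n m : (n <= m)%nat ->
  Cmod (psum u m - psum u n) <= rsum (fun i => Cmod (u i)) m - rsum (fun i => Cmod (u i)) n.
Proof.
  intros H. replace m with (n + (m - n))%nat by lia. rewrite psum_add, rsum_add.
  replace (psum u n + psum (fun i => u (n + i)%nat) (m - n) - psum u n)%C
    with (psum (fun i => u (n + i)%nat) (m - n)) by ring.
  eapply Rle_trans; [apply psum_Cmod|]. lra.
Qed.

Lemma summable_ex_Cser u : summable (fun n => Cmod (u n)) -> exists l, Cser u l.
Proof.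
  intros H. apply Clim_Cauchy. intros eps He.
  destruct (summable_tail _ (fun n => Cmod_ge_0 (u n)) H eps He) as [N h].
  exists N. intros n m Hn Hm.
  destruct (Nat.le_ge_cases n m) as [hnm|hnm].
  - rewrite Cmod_sub_sym. eapply Rle_lt_trans; [apply psum_diff_le|]; auto.
  - eapply Rle_lt_trans; [apply psum_diff_le|]; auto.
Qed.

Definition Csum (u : nat -> C) : C := Clim_val (psum u).

Lemma Csum_eq u l : Cser u l -> Csum u = l.
Proof. apply Clim_val_eq. Qed.

Lemma Csum_ser u : summable (fun n => Cmod (u n)) -> Cser u (Csum u).
Proof.
  intros H. destruct (summable_ex_Cser u H) as [l h]. rewrite (Csum_eq _ _ h). exact h.
Qed.

Lemma Cser_ext u v l : (forall n, u n = v n) -> Cser u l -> Cser v l.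
Proof. intros H. apply Clim_ext. intros n. apply psum_ext. auto. Qed.

Lemma Csum_ext u v : (forall n, u n = v n) -> Csum u = Csum v.
Proof.
  intros H. unfold Csum, Clim_val. f_equal; f_equal; apply Lim_seq_ext; intros n;
    rewrite (psum_ext u v); auto.
Qed.

Lemma Cser_plus u v l m : Cser u l -> Cser v m -> Cser (fun n => u n + v n)%C (l + m)%C.
Proof.
  intros H1 H2. eapply Clim_ext; [|apply (Clim_plus _ _ _ _ H1 H2)].
  intros n; simpl. now rewrite psum_plus.
Qed.

Lemma Cser_scal c u l : Cser u l -> Cser (fun n => c * u n)%C (c * l)%C.
Proof.
  intros H1. eapply Clim_ext; [|apply (Clim_scal c _ _ H1)].
  intros n; simpl. now rewrite psum_scal.
Qed.

Lemma Cser_minus u v l m : Cser u l -> Cser v m -> Cser (fun n => u n - v n)%C (l - m)%C.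
Proof.
  intros H1 H2. replace (l - m)%C with (l + (-1) * m)%C by ring.
  eapply Cser_ext; [|apply Cser_plus; [apply H1|apply Cser_scal, H2]].
  intros n; simpl. ring.
Qed.

Lemma Cser_finite (u : nat -> C) n : (forall i, (n <= i)%nat -> u i = 0%C) -> Cser u (psum u n).
Proof.
  intros H. apply Clim_ext_from with (fun _ => psum u n) n; [|apply Clim_const].
  intros m Hm. replace m with (n + (m - n))%nat by lia. rewrite psum_add.
  rewrite (psum_ext (fun i => u (n + i)%nat) (fun _ => 0%C)).
  - rewrite psum_0. ring.
  - intros. apply H. lia.
Qed.

Lemma Cser_shift u l : Cser (fun n => u (S n)) l -> Cser u (u O + l)%C.
Proof.
  intros H. apply Clim_shift. eapply Clim_ext; [|apply Clim_plus; [apply (Clim_const (u O))|apply H]].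
  intros n. cbv beta. now rewrite psum_first.
Qed.

Lemma Cser_unshift u l : Cser u l -> Cser (fun n => u (S n)) (l - u O)%C.
Proof.
  intros H. apply (Clim_subseq _ _ S) in H; [|auto].
  eapply Clim_ext; [|apply Clim_minus; [apply H|apply (Clim_const (u O))]].
  intros n. cbv beta. rewrite psum_first. ring.
Qed.

Lemma Cser_bound u l B : Cser u l -> (forall n, rsum (fun i => Cmod (u i)) n <= B) -> Cmod l <= B.
Proof.
  intros H HB. apply (Clim_Cmod_le _ _ _ H). intros n.
  eapply Rle_trans; [apply psum_Cmod|auto].
Qed.

Lemma Cser_tail_bound u l B n : Cser u l ->
  (forall m, rsum (fun i => Cmod (u (n + i)%nat)) m <= B) -> Cmod (l - psum u n) <= B.
Proof.
  intros H HB.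
  apply (Clim_Cmod_le (fun m => psum u (n + m) - psum u n)%C).
  - apply Clim_minus; [|apply Clim_const]. apply (Clim_subseq _ _ (fun m => (n + m)%nat)) in H; auto.
    intros; lia.
  - intros m. rewrite psum_add.
    replace (psum u n + psum (fun i => u (n + i)%nat) m - psum u n)%C
      with (psum (fun i => u (n + i)%nat) m) by ring.
    eapply Rle_trans; [apply psum_Cmod|auto].
Qed.

(** Dominated convergence for series: the majorant [A] makes all tails beyond a common index small,
    and the finite heads converge term by term. *)
Lemma Tannery (t : nat -> nat -> C) (A : nat -> R) (w : nat -> C) :
  (forall i J, Cmod (t i J) <= A i) -> summable A ->
  (forall i, Clim (t i) (w i)) ->
  Clim (fun J => Csum (fun i => t i J)) (Csum w).
Proof.
  intros HA HS Ht.
  assert (A0 : forall i, 0 <= A i)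
    by (intros i; eapply Rle_trans; [apply Cmod_ge_0|apply (HA i O)]).
  assert (Hw : forall i, Cmod (w i) <= A i)
    by (intros i; apply (Clim_Cmod_le _ _ _ (Ht i)); auto).
  intros eps He.
  destruct (summable_tail A A0 HS (eps / 4) ltac:(lra)) as [N hN].
  assert (tl : forall u, (forall i, Cmod (u i) <= A i) -> Cmod (Csum u - psum u N) <= eps / 4).
  { intros u Hu. apply Cser_tail_bound with (u := u).
    - apply Csum_ser. eapply summable_le; [|apply HS]. auto.
    - intros m. apply Rle_trans with (rsum (fun i => A (N + i)%nat) m).
      + apply rsum_le. auto.
      + specialize (hN N (N + m)%nat ltac:(lia) ltac:(lia)). rewrite rsum_add in hN. lra. }
  assert (Hf : Clim (fun J => psum (fun i => t i J) N) (psum w N)).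
  { clear - Ht. induction N; simpl; [apply Clim_const|apply Clim_plus; auto]. }
  destruct (Hf (eps / 4) ltac:(lra)) as [M hM]. exists M. intros J HJ.
  specialize (hM J HJ).
  pose proof (tl (fun i => t i J) (fun i => HA i J)) as t1. pose proof (tl w Hw) as t2.
  rewrite Cmod_sub_sym in t2.
  pose proof (Cmod_triangle3 (Csum (fun i => t i J)) (psum (fun i => t i J) N) (Csum w)).
  pose proof (Cmod_triangle3 (psum (fun i => t i J) N) (psum w N) (Csum w)). lra.
Qed.

Lemma Csum_psum_switch (u : nat -> nat -> C) J :
  (forall j, summable (fun i => Cmod (u i j))) ->
  Csum (fun i => psum (u i) J) = psum (fun j => Csum (fun i => u i j)) J.
Proof.
  intros H. apply Csum_eq. induction J; simpl.
  - eapply Cser_ext; [|apply (Cser_finite (fun _ => 0%C) 0); auto]. auto.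
  - apply Cser_plus; [apply IHJ|]. apply Csum_ser. auto.
Qed.

(** The partial sums over [j] are sums over [i] of truncated rows, so [Tannery] applies with the
    absolute row bounds as majorant. *)
Lemma Fubini (u : nat -> nat -> C) (A : nat -> R) :
  (forall i n, rsum (fun j => Cmod (u i j)) n <= A i) -> summable A ->
  Cser (fun j => Csum (fun i => u i j)) (Csum (fun i => Csum (u i))).
Proof.
  intros HA HS. unfold Cser.
  eapply Clim_ext; [|apply (Tannery (fun i J => psum (u i) J) A (fun i => Csum (u i)))].
  - intros J. apply Csum_psum_switch. intros j.
    eapply summable_le; [|apply HS]. intros i. cbv beta.
    eapply Rle_trans; [|apply (HA i (S j))].
    apply (rsum_term_le (fun j => Cmod (u i j)) (S j)); auto. intros; apply Cmod_ge_0.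
  - intros i J. eapply Rle_trans; [apply psum_Cmod|apply HA].
  - auto.
  - intros i. apply Csum_ser. exists (A i). auto.
Qed.

(** A form of Fatou's lemma for finite sums; it lets [Fubini_summable] bound the column sums through
    their partial sums. *)
Lemma rsum_Clim_le (v : nat -> nat -> C) (l : nat -> C) (n : nat) (B : R) :
  (forall j, Clim (v j) (l j)) ->
  (forall k, rsum (fun j => Cmod (v j k)) n <= B) -> rsum (fun j => Cmod (l j)) n <= B.
Proof.
  intros Hv HB.
  assert (H : forall eps, 0 < eps -> exists N, forall k, (N <= k)%nat ->
    rsum (fun j => Cmod (l j)) n <= rsum (fun j => Cmod (v j k)) n + eps).
  { clear HB. induction n; intros eps He; simpl.
    - exists O. intros; lra.
    - destruct (IHn (eps / 2) ltac:(lra)) as [N1 h1].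
      destruct (Hv n (eps / 2) ltac:(lra)) as [N2 h2].
      exists (max N1 N2). intros k Hk. specialize (h1 k ltac:(lia)). specialize (h2 k ltac:(lia)).
      pose proof (Cmod_sub_ge (l n) (v n k)). rewrite Cmod_sub_sym in H. lra. }
  apply Rnot_lt_le. intros h.
  destruct (H ((rsum (fun j => Cmod (l j)) n - B) / 2) ltac:(lra)) as [N hN].
  specialize (hN N (le_n N)). specialize (HB N). lra.
Qed.

Lemma rsum_switch (u : nat -> nat -> R) n m :
  rsum (fun i => rsum (u i) m) n = rsum (fun j => rsum (fun i => u i j) n) m.
Proof.
  induction n; simpl.
  - induction m; simpl; lra.
  - rewrite IHn, <- rsum_plus. reflexivity.
Qed.

Lemma Fubini_summable (u : nat -> nat -> C) (A : nat -> R) :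
  (forall i n, rsum (fun j => Cmod (u i j)) n <= A i) -> summable A ->
  summable (fun j => Cmod (Csum (fun i => u i j))).
Proof.
  intros HA [B HB]. exists B. intros n.
  apply (rsum_Clim_le (fun j k => psum (fun i => u i j) k)).
  - intros j. apply Csum_ser. apply summable_le with A; [|exists B; auto]. intros i.
    eapply Rle_trans; [|apply (HA i (S j))].
    apply (rsum_term_le (fun j => Cmod (u i j)) (S j)); auto. intros; apply Cmod_ge_0.
  - intros k. eapply Rle_trans; [apply rsum_le; intros; apply psum_Cmod|].
    rewrite (rsum_switch (fun j i => Cmod (u i j))).
    eapply Rle_trans; [|apply (HB k)]. apply rsum_le. intros i _. apply HA.
Qed.

(** * Complex derivatives *)

(** An explicit epsilon-delta form, convenient for estimates with [Cmod]; [Cder_is_derive] links it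
    to the filters of Coquelicot. *)
Definition Cder (f : C -> C) (z l : C) : Prop :=
  forall eps : R, 0 < eps -> exists delta : R, 0 < delta /\
    forall w : C, Cmod (w - z) < delta ->
      Cmod (f w - f z - (w - z) * l) <= eps * Cmod (w - z).

Lemma Cder_is_derive f z l : Cder f z l ->
  is_derive (K := C_AbsRing) (V := C_NormedModule) f z l.
Proof.
  intros H. split; [apply is_linear_scal_l|].
  intros x Hx. apply (is_filter_lim_locally_unique (V := AbsRing_NormedModule C_AbsRing)) in Hx.
  subst x. intros eps. destruct (H eps (cond_pos eps)) as [d [Hd h]].
  exists (mkposreal d Hd). intros y Hy. apply h. exact Hy.
Qed.

(** Power series, inverses and the cotangent series all come with a quadratic remainder. *)
Lemma Cder_quad f z l K delta : 0 < delta ->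
  (forall w, Cmod (w - z) < delta -> Cmod (f w - f z - (w - z) * l) <= K * (Cmod (w - z) * Cmod (w - z))) ->
  Cder f z l.
Proof.
  intros Hd H eps He. exists (Rmin delta (eps / (Rabs K + 1))).
  pose proof (Rabs_pos K) as HK.
  assert (0 < eps / (Rabs K + 1)) by (apply Rdiv_lt_0_compat; lra).
  split; [apply Rmin_glb_lt; auto|]. intros w Hw.
  pose proof (Rmin_l delta (eps / (Rabs K + 1))).
  pose proof (Rmin_r delta (eps / (Rabs K + 1))).
  eapply Rle_trans; [apply H; lra|].
  pose proof (Cmod_ge_0 (w - z)) as Hp. rewrite <- Rmult_assoc.
  apply Rmult_le_compat_r; auto.
  apply Rle_trans with ((Rabs K + 1) * Cmod (w - z)).
  { pose proof (Rle_abs K). nra. }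
  apply Rle_trans with ((Rabs K + 1) * (eps / (Rabs K + 1))).
  { apply Rmult_le_compat_l; lra. }
  right. field. lra.
Qed.

Lemma Cder_ext_loc f g z l delta : 0 < delta ->
  (forall w, Cmod (w - z) < delta -> f w = g w) -> Cder f z l -> Cder g z l.
Proof.
  intros Hd E H eps He. destruct (H eps He) as [d [Hd' h]].
  exists (Rmin d delta). split; [apply Rmin_glb_lt; auto|]. intros w Hw.
  pose proof (Rmin_l d delta). pose proof (Rmin_r d delta).
  rewrite <- (E w), <- (E z); [apply h; lra| |lra].
  replace (z - z)%C with (RtoC 0) by ring. rewrite Cmod_0. auto.
Qed.

Lemma Cder_ext f g z l : (forall w, f w = g w) -> Cder f z l -> Cder g z l.
Proof. intros E. apply Cder_ext_loc with 1; auto. lra. Qed.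

Lemma Cder_eq f z l m : l = m -> Cder f z l -> Cder f z m.
Proof. intros ->; auto. Qed.

Lemma Cder_const c z : Cder (fun _ => c) z 0%C.
Proof.
  apply Cder_quad with 0 1; [lra|]. intros w _.
  replace (c - c - (w - z) * 0)%C with (RtoC 0) by ring. rewrite Cmod_0. lra.
Qed.

Lemma Cder_id z : Cder (fun w => w) z 1%C.
Proof.
  apply Cder_quad with 0 1; [lra|]. intros w _.
  replace (w - z - (w - z) * 1)%C with (RtoC 0) by ring. rewrite Cmod_0. lra.
Qed.

Lemma Cder_plus f g z l m : Cder f z l -> Cder g z m -> Cder (fun w => f w + g w)%C z (l + m)%C.
Proof.
  intros H1 H2 eps He.
  destruct (H1 (eps / 2) ltac:(lra)) as [d1 [Hd1 h1]].
  destruct (H2 (eps / 2) ltac:(lra)) as [d2 [Hd2 h2]].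
  exists (Rmin d1 d2). split; [apply Rmin_glb_lt; auto|]. intros w Hw.
  pose proof (Rmin_l d1 d2). pose proof (Rmin_r d1 d2).
  specialize (h1 w ltac:(lra)). specialize (h2 w ltac:(lra)).
  replace (f w + g w - (f z + g z) - (w - z) * (l + m))%C
    with ((f w - f z - (w - z) * l) + (g w - g z - (w - z) * m))%C by ring.
  pose proof (Cmod_triangle (f w - f z - (w - z) * l) (g w - g z - (w - z) * m)). lra.
Qed.

Lemma Cder_lipschitz f z l : Cder f z l -> exists delta, 0 < delta /\
  forall w, Cmod (w - z) < delta -> Cmod (f w - f z) <= (Cmod l + 1) * Cmod (w - z).
Proof.
  intros H. destruct (H 1 ltac:(lra)) as [d [Hd h]]. exists d. split; auto.
  intros w Hw. specialize (h w Hw).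
  replace (f w - f z)%C with ((f w - f z - (w - z) * l) + (w - z) * l)%C by ring.
  eapply Rle_trans; [apply Cmod_triangle|]. rewrite Cmod_mult. lra.
Qed.

Lemma Cder_comp f g z l m : Cder g z m -> Cder f (g z) l -> Cder (fun w => f (g w)) z (m * l)%C.
Proof.
  intros Hg Hf eps He.
  destruct (Cder_lipschitz _ _ _ Hg) as [d0 [Hd0 h0]].
  pose proof (Cmod_ge_0 m) as Hm. pose proof (Cmod_ge_0 l) as Hl.
  destruct (Hf (eps / 2 / (Cmod m + 1))) as [d1 [Hd1 h1]].
  { apply Rdiv_lt_0_compat; lra. }
  destruct (Hg (eps / 2 / (Cmod l + 1))) as [d2 [Hd2 h2]].
  { apply Rdiv_lt_0_compat; lra. }
  set (d3 := d1 / (Cmod m + 1)).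
  assert (Hd3 : 0 < d3) by (apply Rdiv_lt_0_compat; lra).
  exists (Rmin d0 (Rmin d2 d3)). split; [repeat apply Rmin_glb_lt; auto|]. intros w Hw.
  pose proof (Rmin_l d0 (Rmin d2 d3)). pose proof (Rmin_r d0 (Rmin d2 d3)).
  pose proof (Rmin_l d2 d3). pose proof (Rmin_r d2 d3).
  specialize (h0 w ltac:(lra)). specialize (h2 w ltac:(lra)).
  pose proof (Cmod_ge_0 (w - z)) as Hp.
  assert (Hgw : Cmod (g w - g z) < d1).
  { eapply Rle_lt_trans; [apply h0|].
    apply Rlt_le_trans with ((Cmod m + 1) * d3); [apply Rmult_lt_compat_l; lra|].
    right. unfold d3. field. lra. }
  specialize (h1 (g w) Hgw).
  replace (f (g w) - f (g z) - (w - z) * (m * l))%C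
    with ((f (g w) - f (g z) - (g w - g z) * l) + (g w - g z - (w - z) * m) * l)%C by ring.
  eapply Rle_trans; [apply Cmod_triangle|]. rewrite Cmod_mult.
  apply Rle_trans with (eps / 2 * Cmod (w - z) + eps / 2 * Cmod (w - z)); [|right; field].
  apply Rplus_le_compat.
  - eapply Rle_trans; [apply h1|].
    apply Rle_trans with (eps / 2 / (Cmod m + 1) * ((Cmod m + 1) * Cmod (w - z))).
    + apply Rmult_le_compat_l; auto. apply Rlt_le, Rdiv_lt_0_compat; lra.
    + right. field. lra.
  - apply Rle_trans with ((eps / 2 / (Cmod l + 1) * Cmod (w - z)) * (Cmod l + 1)).
    + apply Rmult_le_compat; auto; try lra. apply Cmod_ge_0.
    + right. field. lra.
Qed.

Lemma Cder_sqr z : Cder (fun w => w * w)%C z (2 * z)%C.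
Proof.
  apply Cder_quad with 1 1; [lra|]. intros w _.
  replace (w * w - z * z - (w - z) * (2 * z))%C with ((w - z) * (w - z))%C by ring.
  rewrite Cmod_mult. lra.
Qed.

Lemma Cder_scal c f z l : Cder f z l -> Cder (fun w => c * f w)%C z (c * l)%C.
Proof.
  intros H. apply Cder_eq with (l * c)%C; [ring|].
  apply (Cder_comp (fun u => c * u)%C f); auto.
  apply Cder_quad with 0 1; [lra|]. intros w _.
  replace (c * w - c * f z - (w - f z) * c)%C with (RtoC 0) by ring. rewrite Cmod_0. lra.
Qed.

(* polarization of the square *)
Lemma Cder_mult f g z l m : Cder f z l -> Cder g z m ->
  Cder (fun w => f w * g w)%C z (l * g z + f z * m)%C.
Proof.
  intros Hf Hg.
  assert (H1 : Cder (fun w => (f w + g w) * (f w + g w))%C z ((l + m) * (2 * (f z + g z)))%C)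
    by (apply (Cder_comp (fun u => u * u)%C); [apply Cder_plus; auto|apply Cder_sqr]).
  assert (H2 : Cder (fun w => (f w + (-1) * g w) * (f w + (-1) * g w))%C z
      ((l + (-1) * m) * (2 * (f z + (-1) * g z)))%C)
    by (apply (Cder_comp (fun u => u * u)%C (fun w => f w + (-1) * g w)%C);
        [apply Cder_plus; [|apply Cder_scal]; auto|apply Cder_sqr]).
  pose proof (Cder_plus _ _ _ _ _ (Cder_scal (/4)%C _ _ _ H1) (Cder_scal (-/4)%C _ _ _ H2)) as H3.
  eapply Cder_ext; [|eapply Cder_eq; [|apply H3]].
  - intros w. cbv beta. field.
  - field.
Qed.

Lemma Cder_inv (z : C) : z <> 0%C -> Cder (fun w => / w)%C z (- / (z * z))%C.
Proof.
  intros Hz. assert (Hz' : 0 < Cmod z) by (apply Cmod_gt_0; exact Hz).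
  apply Cder_quad with (2 / (Cmod z * Cmod z * Cmod z)) (Cmod z / 2); [lra|].
  intros w Hw.
  assert (Hw2 : Cmod z / 2 <= Cmod w).
  { pose proof (Cmod_sub_ge z w). rewrite Cmod_sub_sym in H. lra. }
  assert (w <> 0%C) by (intros ->; rewrite Cmod_0 in Hw2; lra).
  replace (/ w - / z - (w - z) * - / (z * z))%C
    with ((w - z) * (w - z) * (/ w * (/ z * / z)))%C by (field; auto).
  rewrite !Cmod_mult, !Cmod_inv by auto. rewrite (Rmult_comm (2 / _)).
  apply Rmult_le_compat_l.
  { pose proof (Cmod_ge_0 (w - z)). nra. }
  apply Rle_trans with (/ (Cmod z / 2) * (/ Cmod z * / Cmod z)).
  { apply Rmult_le_compat_r.
    - apply Rlt_le, Rmult_lt_0_compat; apply Rinv_0_lt_compat; auto.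
    - apply Rinv_le_contravar; lra. }
  right. field. lra.
Qed.

(** Along the segment the real and imaginary parts, both covered by [P], have derivative zero. The
    identities for exp, log, cot and eta are all obtained this way, from equal derivatives and one
    common value. *)
Lemma Cder_zero_const (f : C -> C) (a b : C) :
  (forall t : R, 0 <= t <= 1 -> Cder f (a + t * (b - a))%C 0%C) -> f a = f b.
Proof.
  intros H.
  assert (K : forall P : C -> R, (forall x y, P (x - y)%C = P x - P y) ->
     (forall x, Rabs (P x) <= Cmod x) -> P (f a) = P (f b)).
  { intros P Pm Pb.
    assert (D : forall t, 0 <= t <= 1 -> is_derive (fun t : R => P (f (a + t * (b - a))%C)) t 0).
    { intros t Ht. apply is_derive_Reals. intros eps He.
      (* The added 1 keeps [B] positive when [a = b]. *)
      set (B := Cmod (b - a) + 1). pose proof (Cmod_ge_0 (b - a)) as HB.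
      assert (HB' : Cmod (b - a) + 1 = B) by reflexivity. clearbody B.
      destruct (H t Ht (eps / 2 / B)) as [d [Hd h]].
      { apply Rdiv_lt_0_compat; lra. }
      assert (HdB : 0 < d / B) by (apply Rdiv_lt_0_compat; lra).
      exists (mkposreal _ HdB). intros u Hu0 Hu. simpl in Hu.
      rewrite Rminus_0_r. unfold Rdiv. rewrite Rabs_mult, <- Pm.
      assert (E : Cmod (a + (t + u)%R * (b - a) - (a + t * (b - a))) = Rabs u * Cmod (b - a)).
      { rewrite <- Cmod_R, <- Cmod_mult. f_equal. rewrite RtoC_plus. ring. }
      assert (Hu' : Rabs u * B < d).
      { apply Rlt_le_trans with (d / B * B); [apply Rmult_lt_compat_r; lra|].
        right. field. lra. }
      pose proof (Rabs_pos_lt u Hu0) as Hup.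
      specialize (h (a + (t + u)%R * (b - a))%C). rewrite E in h.
      assert (hh : Rabs u * Cmod (b - a) < d) by (nra).
      specialize (h hh).
      rewrite Rabs_inv.
      apply Rle_lt_trans with ((eps / 2 / B * (Rabs u * B)) * / Rabs u).
      - apply Rmult_le_compat_r; [apply Rlt_le, Rinv_0_lt_compat; auto|].
        eapply Rle_trans; [apply Pb|].
        assert (Z : forall x y : C, (x - y * 0)%C = x) by (intros; ring).
        rewrite Z in h.
        eapply Rle_trans; [apply h|].
        apply Rmult_le_compat_l; [apply Rlt_le, Rdiv_lt_0_compat; lra|].
        apply Rmult_le_compat_l; lra.
      - replace (eps / 2 / B * (Rabs u * B) * / Rabs u) with (eps / 2); [lra|].
        field. lra. }
    pose proof (eq_is_derive (V := R_NormedModule) _ 0 1 D Rlt_0_1) as E. cbv beta in E.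
    replace (a + 0 * (b - a))%C with a in E by ring.
    replace (a + 1 * (b - a))%C with b in E by ring. exact E. }
  pose proof (K Re (fun x y => eq_refl) re_le_Cmod) as K1.
  pose proof (K Im (fun x y => eq_refl) Cmod_Im_le) as K2.
  destruct (f a), (f b). simpl in *. congruence.
Qed.

(** * Power series on the unit disc *)

(** Absolute convergence on each smaller disc, with a real radius so that one bound serves all [q]
    with [Cmod q <= r]. *)
Definition disc (a : nat -> C) : Prop :=
  forall r, 0 <= r < 1 -> summable (fun n => Cmod (a n) * r ^ n).

Definition PS (a : nat -> C) (q : C) : C := Csum (fun n => a n * q ^ n)%C.

Lemma disc_abs (a : nat -> C) q : disc a -> Cmod q < 1 -> summable (fun n => Cmod (a n * q ^ n)%C).
Proof.
  intros Ha Hq. eapply summable_le; [|apply (Ha (Cmod q))].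
  - intros n. rewrite Cmod_mult, Cmod_pow. lra.
  - split; auto. apply Cmod_ge_0.
Qed.

Lemma PS_ser (a : nat -> C) q : disc a -> Cmod q < 1 -> Cser (fun n => a n * q ^ n)%C (PS a q).
Proof. intros. apply Csum_ser, disc_abs; auto. Qed.

Lemma PS_eq (a : nat -> C) q l : Cser (fun n => a n * q ^ n)%C l -> PS a q = l.
Proof. apply Csum_eq. Qed.

Lemma PS_ext a b q : (forall n, a n = b n) -> PS a q = PS b q.
Proof. intros H. apply Csum_ext. intros n. now rewrite H. Qed.

Lemma disc_ext a b : (forall n, a n = b n) -> disc a -> disc b.
Proof.
  intros H Ha r Hr. eapply summable_le; [|apply (Ha r Hr)]. intros n. cbv beta. rewrite H. lra.
Qed.

Lemma rsum_geom r n : 0 <= r < 1 -> rsum (fun i => r ^ i) n <= / (1 - r).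
Proof.
  intros Hr. assert (E : rsum (fun i => r ^ i) n = (1 - r ^ n) / (1 - r)).
  { induction n; simpl; [field; lra|]. rewrite IHn. field. lra. }
  rewrite E. unfold Rdiv. rewrite <- (Rmult_1_l (/ (1 - r))) at 2.
  apply Rmult_le_compat_r; [apply Rlt_le, Rinv_0_lt_compat; lra|].
  pose proof (pow_le r n ltac:(lra)). lra.
Qed.

(** Abel's lemma: boundedness at the intermediate radius [s] gives a geometric majorant of ratio
    [r / s]. *)
Lemma disc_of_bounded (a : nat -> C) :
  (forall r, 0 < r < 1 -> exists B, forall n, Cmod (a n) * r ^ n <= B) -> disc a.
Proof.
  intros H r Hr. set (s := (1 + r) / 2).
  destruct (H s) as [B HB]; [unfold s; lra|].
  assert (Hs : 0 <= r / s < 1).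
  { assert (0 < s) by (unfold s; lra). split.
    - apply Rmult_le_pos; [lra|]. apply Rlt_le, Rinv_0_lt_compat; auto.
    - apply Rmult_lt_reg_r with s; auto. replace (r / s * s) with r by (field; lra).
      unfold s; lra. }
  assert (Hs0 : s <> 0) by (unfold s; lra).
  exists (B * / (1 - r / s)). intros n.
  eapply Rle_trans; [|apply Rmult_le_compat_l; [|apply (rsum_geom _ n Hs)]].
  - rewrite <- rsum_scal. apply rsum_le. intros i _.
    replace (r ^ i) with (s ^ i * (r / s) ^ i).
    + rewrite <- Rmult_assoc. apply Rmult_le_compat_r; [apply pow_le; lra|apply HB].
    + rewrite <- Rpow_mult_distr. f_equal. field. auto.
  - eapply Rle_trans; [|apply (HB O)]. simpl. pose proof (Cmod_ge_0 (a O)). lra.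
Qed.

Lemma disc_bounded (a : nat -> C) r : disc a -> 0 <= r < 1 ->
  exists B, 0 <= B /\ forall n, Cmod (a n) * r ^ n <= B.
Proof.
  intros Ha Hr. destruct (summable_bounded (fun n => Cmod (a n) * r ^ n)) as [B HB].
  - intros n. apply Rmult_le_pos; [apply Cmod_ge_0|apply pow_le; lra].
  - apply Ha; auto.
  - exists B. split; auto. eapply Rle_trans; [|apply (HB O)]. simpl.
    pose proof (Cmod_ge_0 (a O)). lra.
Qed.

Lemma Cser_terms_bounded (u : nat -> C) l : Cser u l -> exists B, forall n, Cmod (u n) <= B.
Proof.
  intros H. destruct (H 1 ltac:(lra)) as [N h].
  exists (2 + rsum (fun i => Cmod (u i)) N). intros n.
  assert (0 <= rsum (fun i => Cmod (u i)) N) by (apply rsum_pos; intros; apply Cmod_ge_0).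
  destruct (Nat.lt_ge_cases n N) as [hn|hn].
  - pose proof (rsum_term_le (fun i => Cmod (u i)) N n (fun i => Cmod_ge_0 _) hn).
    simpl in H1. lra.
  - pose proof (h n hn) as h1. pose proof (h (S n) ltac:(lia)) as h2. simpl in h2.
    replace (u n) with ((psum u n + u n - l) + (l - psum u n))%C by ring.
    eapply Rle_trans; [apply Cmod_triangle|]. rewrite (Cmod_sub_sym l). lra.
Qed.

(** Upgrades the plain convergence in [has_qexp] to absolute convergence, since the terms of a
    convergent series are bounded. *)
Lemma disc_of_Cser (a : nat -> C) :
  (forall r, 0 < r < 1 -> exists l, Cser (fun n => a n * RtoC r ^ n)%C l) -> disc a.
Proof.
  intros H. apply disc_of_bounded. intros r Hr. destruct (H r Hr) as [l Hl].
  destruct (Cser_terms_bounded _ _ Hl) as [B HB]. exists B. intros n.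
  specialize (HB n). simpl in HB. rewrite Cmod_mult, Cmod_pow, Cmod_R, Rabs_pos_eq in HB; lra.
Qed.

Lemma disc_plus a b : disc a -> disc b -> disc (fun n => a n + b n)%C.
Proof.
  intros Ha Hb r Hr. eapply summable_le; [|apply summable_plus; [apply (Ha r Hr)|apply (Hb r Hr)]].
  intros n. simpl. rewrite <- Rmult_plus_distr_r. apply Rmult_le_compat_r.
  - apply pow_le; lra.
  - apply Cmod_triangle.
Qed.

Lemma disc_scal c a : disc a -> disc (fun n => c * a n)%C.
Proof.
  intros Ha r Hr. eapply summable_le; [|apply (summable_scal (Cmod c)); [apply Cmod_ge_0|apply (Ha r Hr)]].
  intros n. simpl. rewrite Cmod_mult. lra.
Qed.

Lemma PS_plus a b q : disc a -> disc b -> Cmod q < 1 ->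
  PS (fun n => a n + b n)%C q = (PS a q + PS b q)%C.
Proof.
  intros Ha Hb Hq. apply PS_eq. eapply Cser_ext; [|apply Cser_plus; apply PS_ser; auto].
  intros n; simpl. ring.
Qed.

Lemma PS_scal c a q : disc a -> Cmod q < 1 -> PS (fun n => c * a n)%C q = (c * PS a q)%C.
Proof.
  intros Ha Hq. apply PS_eq. eapply Cser_ext; [|apply Cser_scal; apply PS_ser; auto].
  intros n; simpl. ring.
Qed.

Lemma PS_bound a q r B : Cmod q <= r -> 0 <= r < 1 -> disc a ->
  (forall n, rsum (fun i => Cmod (a i) * r ^ i) n <= B) -> Cmod (PS a q) <= B.
Proof.
  intros Hq Hr Ha HB. apply Cser_bound with (u := fun n => (a n * q ^ n)%C).
  - apply PS_ser; auto. lra.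
  - intros n. eapply Rle_trans; [|apply (HB n)]. apply rsum_le. intros i _.
    rewrite Cmod_mult, Cmod_pow. apply Rmult_le_compat_l; [apply Cmod_ge_0|].
    apply pow_incr. split; auto. apply Cmod_ge_0.
Qed.

Lemma PS_bounded a r : 0 <= r < 1 -> disc a -> exists B, forall q, Cmod q <= r -> Cmod (PS a q) <= B.
Proof.
  intros Hr Ha. destruct (Ha r Hr) as [B HB]. exists B. intros q Hq.
  apply PS_bound with r; auto.
Qed.

Lemma disc_shift (a : nat -> C) : disc a -> disc (fun n => a (S n)).
Proof.
  intros Ha. apply disc_of_bounded. intros r Hr.
  destruct (disc_bounded a r Ha ltac:(lra)) as [B [HB0 HB]].
  exists (B / r). intros n. specialize (HB (S n)). simpl in HB.
  apply Rmult_le_reg_r with r; [lra|]. replace (B / r * r) with B by (field; lra). lra.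
Qed.

Lemma PS_shift a q : disc a -> Cmod q < 1 -> PS a q = (a O + q * PS (fun n => a (S n)) q)%C.
Proof.
  intros Ha Hq. apply PS_eq.
  replace (a O) with (a O * q ^ 0)%C by (simpl; ring).
  apply (Cser_shift (fun n => a n * q ^ n)%C).
  eapply Cser_ext; [|apply Cser_scal, PS_ser; [apply disc_shift, Ha|auto]].
  intros n. simpl. ring.
Qed.

Lemma PS_at_0 a : disc a -> PS a 0 = a O.
Proof. intros Ha. rewrite PS_shift; [ring|auto|]. rewrite Cmod_0. lra. Qed.

(** With [c = 0] this is multiplication by [q], the shape of a series with a zero at the cusp. *)
Definition unshift (c : C) (a : nat -> C) (n : nat) : C :=
  match n with O => c | S m => a m end.

Lemma disc_unshift c a : disc a -> disc (unshift c a).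
Proof.
  intros Ha. apply disc_of_bounded. intros r Hr.
  destruct (disc_bounded a r Ha ltac:(lra)) as [B [HB0 HB]].
  exists (Cmod c + B). pose proof (Cmod_ge_0 c). intros [|n]; simpl; [lra|].
  specialize (HB n). pose proof (Cmod_ge_0 (a n)). pose proof (pow_le r n ltac:(lra)).
  assert (0 <= Cmod (a n) * r ^ n) by (apply Rmult_le_pos; auto). nra.
Qed.

Lemma PS_unshift c a q : disc a -> Cmod q < 1 -> PS (unshift c a) q = (c + q * PS a q)%C.
Proof. intros Ha Hq. rewrite PS_shift; auto. apply disc_unshift; auto. Qed.

Definition PS0 (n : nat) : C := 0%C.

Lemma disc_0 : disc PS0.
Proof.
  intros r Hr. exists 0. intros n. induction n; simpl; [lra|].
  unfold PS0 at 2. rewrite Cmod_0. lra.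
Qed.

Lemma PS_PS0 q : PS PS0 q = 0%C.
Proof.
  apply PS_eq. eapply Cser_ext; [|apply (Cser_finite (fun _ => 0%C) 0); auto].
  intros n. unfold PS0. simpl. ring.
Qed.

Definition PS1 : nat -> C := unshift 1%C PS0.

Lemma disc_1 : disc PS1.
Proof. apply disc_unshift, disc_0. Qed.

Lemma PS_PS1 q : Cmod q < 1 -> PS PS1 q = 1%C.
Proof. intros Hq. unfold PS1. rewrite PS_unshift; auto using disc_0. rewrite PS_PS0. ring. Qed.

(* The constant coefficient is the limit at 0, and dividing by q moves every other one there. *)
Lemma PS_unique (a : nat -> C) : disc a ->
  (forall q : C, q <> 0%C -> Cmod q < 1 -> PS a q = 0%C) -> forall n, a n = 0%C.
Proof.
  intros Ha H n. revert a Ha H.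
  assert (A0 : forall a : nat -> C, disc a ->
    (forall q : C, q <> 0%C -> Cmod q < 1 -> PS a q = 0%C) -> a O = 0%C).
  { intros a Ha H. apply Cmod_small_0. intros eps He.
    destruct (PS_bounded (fun n => a (S n)) (1/2) ltac:(lra) (disc_shift a Ha)) as [B HB].
    assert (HB0 : 0 <= B).
    { eapply Rle_trans; [|apply (HB 0%C)]; [apply Cmod_ge_0|rewrite Cmod_0; lra]. }
    set (x := Rmin (1/2) (eps / (B + 1))).
    assert (Hx : 0 < x) by (apply Rmin_glb_lt; [lra|apply Rdiv_lt_0_compat; lra]).
    assert (Hx1 : x <= 1/2) by apply Rmin_l.
    assert (Hx2 : x <= eps / (B + 1)) by apply Rmin_r.
    assert (Hc : Cmod (RtoC x) = x) by (rewrite Cmod_R, Rabs_pos_eq; lra).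
    specialize (H (RtoC x)). rewrite Hc in H.
    rewrite PS_shift in H by (auto; rewrite Hc; lra).
    assert (E : a O = (- (x * PS (fun n => a (S n)) x))%C).
    { match goal with |- ?l = Copp ?r => replace l with ((l + r) - r)%C by ring end.
      rewrite H; [ring| |lra]. intros E. apply RtoC_inj in E. lra. }
    rewrite E, Cmod_opp, Cmod_mult, Hc.
    apply Rle_trans with (eps / (B + 1) * B).
    + apply Rmult_le_compat; try lra; [apply Cmod_ge_0|]. apply HB. lra.
    + apply Rmult_le_reg_r with (B + 1); [lra|].
      replace (eps / (B + 1) * B * (B + 1)) with (eps * B) by (field; lra). nra. }
  induction n; intros a Ha H; [auto|].
  pose proof (A0 a Ha H) as a0.
    apply (IHn (fun n => a (S n))); [apply disc_shift; auto|].
    intros q Hq0 Hq. specialize (H q Hq0 Hq). rewrite PS_shift in H by auto.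
    rewrite a0 in H.
    replace (PS (fun n => a (S n)) q) with (/ q * (0 + q * PS (fun n => a (S n)) q))%C
      by (field; auto).
    rewrite H. ring.
Qed.

(** * Products of power series *)

Definition conv (a b : nat -> C) (n : nat) : C := psum (fun i => a i * b (n - i)%nat)%C (S n).

(** Summed by rows this array gives the product of the two series, summed by columns their Cauchy
    product, so that [Fubini] equates them. *)
Definition conv_table (a b : nat -> C) (q : C) (i j : nat) : C :=
  if Nat.leb i j then (a i * b (j - i)%nat * q ^ j)%C else 0%C.

Lemma conv_table_row_bound a b q B :
  (forall n, rsum (fun j => Cmod (b j * q ^ j)%C) n <= B) ->
  forall i n, rsum (fun j => Cmod (conv_table a b q i j)) n <= Cmod (a i * q ^ i) * B.
Proof.
  intros HB i n.
  apply Rle_trans with (rsum (fun j => Cmod (conv_table a b q i j)) (i + n)).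
  { apply rsum_mono; [intros; apply Cmod_ge_0|lia]. }
  rewrite rsum_add.
  assert (E0 : rsum (fun j => Cmod (conv_table a b q i j)) i = 0).
  { rewrite (rsum_ext _ (fun _ => 0 * 0)); [rewrite rsum_scal; ring|].
    intros j Hj. unfold conv_table. destruct (Nat.leb_spec i j); [lia|]. rewrite Cmod_0. ring. }
  rewrite E0, Rplus_0_l.
  rewrite (rsum_ext _ (fun j => Cmod (a i * q ^ i) * Cmod (b j * q ^ j))).
  - rewrite rsum_scal. apply Rmult_le_compat_l; [apply Cmod_ge_0|apply HB].
  - intros j _. unfold conv_table. destruct (Nat.leb_spec i (i + j)); [|lia].
    rewrite <- Cmod_mult. f_equal. replace (i + j - i)%nat with j by lia.
    rewrite Cpow_add_r. ring.
Qed.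

Lemma conv_table_column a b q j : Csum (fun i => conv_table a b q i j) = (conv a b j * q ^ j)%C.
Proof.
  apply Csum_eq.
  replace (conv a b j * q ^ j)%C with (psum (fun i => conv_table a b q i j) (S j)).
  - apply Cser_finite. intros i Hi. unfold conv_table. destruct (Nat.leb_spec i j); [lia|auto].
  - unfold conv. rewrite Cmult_comm, <- psum_scal. apply psum_ext. intros i Hi.
    unfold conv_table. destruct (Nat.leb_spec i j); [ring|lia].
Qed.

Lemma Cser_prefix (u : nat -> C) i l : (forall j, (j < i)%nat -> u j = 0%C) ->
  Cser (fun n => u (i + n)%nat) l -> Cser u l.
Proof.
  revert u. induction i; intros u H Hu; [exact Hu|].
  replace l with (u O + l)%C by (rewrite (H O) by lia; ring).
  apply Cser_shift. apply IHi; [intros; apply H; lia|].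
  exact Hu.
Qed.

Lemma conv_table_row a b q i : disc b -> Cmod q < 1 ->
  Csum (conv_table a b q i) = (a i * q ^ i * PS b q)%C.
Proof.
  intros Hb Hq. apply Csum_eq. apply Cser_prefix with i.
  - intros j Hj. unfold conv_table. destruct (Nat.leb_spec i j); [lia|auto].
  - eapply Cser_ext; [|apply Cser_scal, PS_ser; auto].
    intros j. simpl. unfold conv_table. destruct (Nat.leb_spec i (i + j)); [|lia].
    replace (i + j - i)%nat with j by lia. rewrite Cpow_add_r. ring.
Qed.

Lemma PS_conv a b q : disc a -> disc b -> Cmod q < 1 -> PS (conv a b) q = (PS a q * PS b q)%C.
Proof.
  intros Ha Hb Hq. destruct (disc_abs b q Hb Hq) as [B HB].
  assert (HB0 : 0 <= B) by apply (HB O).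
  apply PS_eq.
  eapply Cser_ext; [intros j; apply conv_table_column|].
  replace (PS a q * PS b q)%C with (Csum (fun i => Csum (conv_table a b q i))).
  - apply Fubini with (A := fun i => Cmod (a i * q ^ i) * B).
    + apply conv_table_row_bound; auto.
    + eapply summable_le; [|apply (summable_scal B _ HB0 (disc_abs a q Ha Hq))].
      intros n; simpl. lra.
  - apply Csum_eq. rewrite Cmult_comm. eapply Cser_ext; [|apply Cser_scal, PS_ser; auto].
    intros i. simpl. rewrite conv_table_row; auto. ring.
Qed.

Lemma disc_conv a b : disc a -> disc b -> disc (conv a b).
Proof.
  intros Ha Hb r Hr.
  assert (Hc : Cmod (RtoC r) < 1) by (rewrite Cmod_R, Rabs_pos_eq; lra).
  destruct (disc_abs b r Hb Hc) as [B HB]. assert (HB0 : 0 <= B) by apply (HB O).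
  eapply summable_le; [|apply (Fubini_summable (conv_table a b r) (fun i => Cmod (a i * r ^ i) * B))].
  - intros n. cbv beta. rewrite conv_table_column, Cmod_mult, Cmod_pow, Cmod_R, Rabs_pos_eq; lra.
  - apply conv_table_row_bound; auto.
  - eapply summable_le; [|apply (summable_scal B _ HB0 (disc_abs a r Ha Hc))].
    intros n; simpl. lra.
Qed.

(** * Termwise differentiation *)

Definition PSD (a : nat -> C) (n : nat) : C := (INR (S n) * a (S n))%C.

(** Each of the n + 1 terms of 1 + x + ... + x^n is at least x^n. *)
Lemma succ_pow_le x n : 0 <= x < 1 -> INR (S n) * x ^ n <= / (1 - x).
Proof.
  intros Hx. apply Rle_trans with (rsum (fun k => x ^ k) (S n)); [|apply rsum_geom; auto].
  assert (H : forall m, (m <= S n)%nat -> INR m * x ^ n <= rsum (fun k => x ^ k) m).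
  { induction m; intros Hm; [simpl; lra|]. specialize (IHm ltac:(lia)).
    rewrite S_INR. simpl rsum. assert (x ^ n <= x ^ m); [|lra].
    replace n with (m + (n - m))%nat by lia. rewrite pow_add.
    pose proof (pow_le x m ltac:(lra)). pose proof (pow_le x (n - m) ltac:(lra)).
    assert (x ^ (n - m) <= 1) by (rewrite <- (pow1 (n - m)); apply pow_incr; lra). nra. }
  apply H. lia.
Qed.

Lemma disc_PSD a : disc a -> disc (PSD a).
Proof.
  intros Ha. apply disc_of_bounded. intros r Hr. set (s := (1 + r) / 2).
  assert (Hs : 0 < s < 1) by (unfold s; lra).
  assert (Hrs : r < s) by (unfold s; lra). clearbody s.
  destruct (disc_bounded a s Ha ltac:(lra)) as [B [HB0 HB]].
  assert (Hx : 0 <= r / s < 1).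
  { split; [apply Rlt_le, Rdiv_lt_0_compat; lra|].
    apply Rmult_lt_reg_r with s; [lra|]. replace (r / s * s) with r by (field; lra). lra. }
  exists (/ (1 - r / s) * (B / s)). intros n.
  unfold PSD. rewrite Cmod_mult, Cmod_R, Rabs_pos_eq by apply pos_INR.
  replace (r ^ n) with ((r / s) ^ n * s ^ n)
    by (rewrite <- Rpow_mult_distr; f_equal; field; lra).
  replace (INR (S n) * Cmod (a (S n)) * ((r / s) ^ n * s ^ n))
    with ((INR (S n) * (r / s) ^ n) * (Cmod (a (S n)) * s ^ n)) by ring.
  apply Rmult_le_compat.
  - apply Rmult_le_pos; [apply pos_INR|apply pow_le; lra].
  - apply Rmult_le_pos; [apply Cmod_ge_0|apply pow_le; lra].
  - apply succ_pow_le; auto.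
  - specialize (HB (S n)). simpl in HB. apply Rmult_le_reg_r with s; [lra|].
    replace (B / s * s) with B by (field; lra). lra.
Qed.

Definition dpow (x : C) (n : nat) : C := match n with O => 0%C | S m => (INR (S m) * x ^ m)%C end.

(** The factor [r * r] clears the power r^(n-2). The induction rests on the fact that the remainder
    for n + 1 is y times the remainder for n plus (y - x)^2 n x^(n-1). *)
Lemma pow_taylor_bound x y r n : 0 < r -> Cmod x <= r -> Cmod y <= r ->
  r * r * Cmod (y ^ n - x ^ n - (y - x) * dpow x n)
    <= (INR n * INR n * r ^ n) * (Cmod (y - x) * Cmod (y - x)).
Proof.
  intros Hr Hx Hy.
  assert (Hd : forall m, r * Cmod (dpow x m) <= INR m * r ^ m).
  { intros [|m]; [simpl; rewrite Cmod_0; lra|]. unfold dpow.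
    rewrite Cmod_mult, Cmod_R, Rabs_pos_eq, Cmod_pow by apply pos_INR. simpl pow.
    pose proof (pow_incr (Cmod x) r m (conj (Cmod_ge_0 x) Hx)).
    apply Rle_trans with (INR (S m) * (r * Cmod x ^ m)); [right; ring|].
    apply Rmult_le_compat_l; [apply pos_INR|]. apply Rmult_le_compat_l; lra. }
  set (d := Cmod (y - x)). assert (Hd0 : 0 <= d) by apply Cmod_ge_0.
  induction n.
  - simpl. replace (1 - 1 - (y - x) * 0)%C with (RtoC 0) by ring. rewrite Cmod_0. nra.
  - replace (y ^ S n - x ^ S n - (y - x) * dpow x (S n))%C
      with (y * (y ^ n - x ^ n - (y - x) * dpow x n) + (y - x) * (y - x) * dpow x n)%C.
    2:{ destruct n; [simpl; ring|]. unfold dpow.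
        rewrite !S_INR, !RtoC_plus. rewrite !Cpow_S. ring. }
    apply Rle_trans with (r * (r * r * Cmod (y ^ n - x ^ n - (y - x) * dpow x n))
       + r * (r * Cmod (dpow x n)) * (d * d)).
    + eapply Rle_trans; [apply Rmult_le_compat_l; [nra|apply Cmod_triangle]|].
      rewrite !Cmod_mult. fold d.
      set (A := Cmod (y ^ n - x ^ n - (y - x) * dpow x n)) in *.
      assert (0 <= A) by apply Cmod_ge_0. assert (0 <= r * r) by nra.
      assert (Cmod y * A <= r * A) by (apply Rmult_le_compat_r; auto).
      nra.
    + specialize (Hd n). rewrite S_INR. simpl pow.
      pose proof (pos_INR n) as Hn. pose proof (pow_le r n ltac:(lra)) as Hp.
      assert (D2 : 0 <= d * d) by nra.
      apply Rle_trans with (r * (INR n * INR n * r ^ n * (d * d)) + r * (INR n * r ^ n) * (d * d)).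
      * apply Rplus_le_compat; [apply Rmult_le_compat_l; lra|].
        apply Rmult_le_compat_r; auto. apply Rmult_le_compat_l; lra.
      * assert (0 <= r * r ^ n * (d * d)) by (apply Rmult_le_pos; [nra|auto]). nra.
Qed.

(** Summing [pow_taylor_bound] against [a] gives a quadratic remainder, with a constant that is
    finite because n^2 a_n still has radius 1. *)
Lemma PS_der a x : disc a -> Cmod x < 1 -> Cder (PS a) x (PS (PSD a) x).
Proof.
  intros Ha Hx. set (r := (1 + Cmod x) / 2). pose proof (Cmod_ge_0 x) as Hx0.
  assert (Hr : 0 < r < 1) by (unfold r; lra).
  assert (Hrx : Cmod x < r) by (unfold r; lra).
  assert (Hrx2 : Cmod x + (1 - Cmod x) / 2 = r) by (unfold r; lra). clearbody r.
  (* [unshift 0] after [PSD] is q d/dq, so these are the coefficients n^2 a_n. *)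
  assert (H2 : disc (unshift 0 (PSD (unshift 0 (PSD a))))).
  { apply disc_unshift, disc_PSD, disc_unshift, disc_PSD, Ha. }
  destruct (H2 r ltac:(lra)) as [B HB].
  apply Cder_quad with (B / (r * r)) ((1 - Cmod x) / 2); [lra|]. intros y Hy.
  assert (Hyr : Cmod y < r).
  { pose proof (Cmod_sub_ge y x). lra. }
  set (d := Cmod (y - x)).
  apply Cser_bound with (u := fun n => (a n * (y ^ n - x ^ n - (y - x) * dpow x n))%C).
  - eapply Cser_ext; [|apply Cser_minus; [apply Cser_minus; apply PS_ser; auto; lra|apply Cser_scal]].
    2:{ replace (PS (PSD a) x) with (a O * dpow x O + PS (PSD a) x)%C by (simpl; ring).
        apply (Cser_shift (fun n => a n * dpow x n)%C).
        eapply Cser_ext; [|apply PS_ser; [apply disc_PSD; auto|auto]].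
        intros n. unfold PSD, dpow. simpl. ring. }
    intros n. simpl. ring.
  - intros n. apply Rle_trans with (rsum (fun i => d * d / (r * r) *
        (Cmod (unshift 0 (PSD (unshift 0 (PSD a))) i) * r ^ i)) n).
    2:{ rewrite rsum_scal. specialize (HB n).
        replace (B / (r * r) * (d * d)) with (d * d / (r * r) * B) by (field; lra).
        apply Rmult_le_compat_l; auto. apply Rmult_le_pos; [unfold d; pose proof (Cmod_ge_0 (y - x)); nra|].
        apply Rlt_le, Rinv_0_lt_compat. nra. }
    apply rsum_le. intros i _. rewrite Cmod_mult.
    pose proof (pow_taylor_bound x y r i ltac:(lra) ltac:(lra) ltac:(lra)) as HT. fold d in HT.
    assert (E : Cmod (unshift 0 (PSD (unshift 0 (PSD a))) i) = INR i * INR i * Cmod (a i)).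
    { destruct i; [simpl; rewrite Cmod_0; ring|]. cbn [unshift]. unfold PSD at 1. cbn [unshift]. unfold PSD.
      rewrite !Cmod_mult, !Cmod_R, !Rabs_pos_eq by apply pos_INR. ring. }
    rewrite E. apply Rmult_le_reg_l with (r * r); [nra|].
    replace (r * r * (d * d / (r * r) * (INR i * INR i * Cmod (a i) * r ^ i)))
      with (Cmod (a i) * (INR i * INR i * r ^ i * (d * d))) by (field; lra).
    pose proof (Cmod_ge_0 (a i)). nra.
Qed.

(** * Substitution of q^d for q *)

Definition dilate (d : nat) (a : nat -> C) (n : nat) : C :=
  if Nat.eqb (n mod d) 0 then a (n / d)%nat else 0%C.

(** The upper bound is the ceiling of N / d, the number of multiples of d below N. *)
Lemma psum_dilate d u N : (0 < d)%nat ->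
  psum (dilate d u) N = psum u ((N + d - 1) / d).
Proof.
  intros Hd. induction N.
  - simpl. rewrite Nat.div_small by lia. reflexivity.
  - change (psum (dilate d u) (S N)) with (psum (dilate d u) N + dilate d u N)%C.
    rewrite IHN. unfold dilate.
    pose proof (Nat.div_mod_eq N d) as E. set (k := (N / d)%nat) in *.
    set (m := (N mod d)%nat) in *. assert (m < d)%nat by (apply Nat.mod_upper_bound; lia).
    assert (E2 : ((S N + d - 1) / d = S k)%nat).
    { symmetry. apply Nat.div_unique with m; lia. }
    rewrite E2. destruct (Nat.eqb_spec m 0).
    + assert (E1 : ((N + d - 1) / d = k)%nat) by (symmetry; apply Nat.div_unique with (d - 1)%nat; lia).
      rewrite E1. reflexivity.
    + assert (E1 : ((N + d - 1) / d = S k)%nat) by (symmetry; apply Nat.div_unique with (m - 1)%nat; lia).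
      rewrite E1. ring.
Qed.

Lemma Cser_dilate d u l : (0 < d)%nat -> Cser u l -> Cser (dilate d u) l.
Proof.
  intros Hd H eps He. destruct (H eps He) as [M h]. exists (d * M)%nat. intros N HN.
  rewrite psum_dilate by auto. apply h.
  apply Nat.div_le_lower_bound; lia.
Qed.

Lemma disc_dilate d a : (0 < d)%nat -> disc a -> disc (dilate d a).
Proof.
  intros Hd Ha. apply disc_of_bounded. intros r Hr.
  assert (Hrd : 0 <= r ^ d < 1).
  { split; [apply pow_le; lra|]. destruct d; [lia|]. apply pow_lt_1_compat; [lra|lia]. }
  destruct (disc_bounded a (r ^ d) Ha Hrd) as [B [HB0 HB]]. exists B. intros n.
  unfold dilate. destruct (Nat.eqb_spec (n mod d) 0) as [E|E].
  - pose proof (Nat.div_mod_eq n d) as E2. rewrite E, Nat.add_0_r in E2.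
    rewrite E2 at 2. rewrite pow_mult. apply HB.
  - rewrite Cmod_0. lra.
Qed.

Lemma PS_dilate d a q : (0 < d)%nat -> disc a -> Cmod q < 1 -> PS (dilate d a) q = PS a (q ^ d)%C.
Proof.
  intros Hd Ha Hq. apply PS_eq.
  eapply Cser_ext; [|apply Cser_dilate with (d := d); [auto|apply PS_ser; [apply Ha|]]].
  - intros n. unfold dilate. destruct (Nat.eqb_spec (n mod d) 0) as [E|E]; [|ring].
    pose proof (Nat.div_mod_eq n d) as E2. rewrite E, Nat.add_0_r in E2.
    rewrite <- Cpow_mult_r, <- E2. reflexivity.
  - rewrite Cmod_pow. destruct d; [lia|]. apply pow_lt_1_compat; [|lia].
    split; auto. apply Cmod_ge_0.
Qed.

(** * The exponential of a power series *)

Lemma Cexp_add z w : Cexp (z + w) = (Cexp z * Cexp w)%C.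
Proof.
  destruct z as [x y], w as [u v]. unfold Cexp. simpl Re. simpl Im.
  rewrite exp_plus, cos_plus, sin_plus. unfold Cmult, RtoC. simpl. f_equal; ring.
Qed.

Lemma Cexp_0 : Cexp 0 = 1%C.
Proof.
  unfold Cexp. simpl. rewrite exp_0, cos_0, sin_0. unfold Cmult, RtoC. simpl. f_equal; ring.
Qed.

Lemma Cmod_Cexp z : Cmod (Cexp z) = exp (Re z).
Proof.
  unfold Cexp. rewrite Cmod_mult, Cmod_R, Rabs_pos_eq by (apply Rlt_le, exp_pos).
  replace (Cmod (cos (Im z), sin (Im z))) with 1; [ring|].
  unfold Cmod. simpl. rewrite <- sqrt_1 at 1. f_equal.
  pose proof (sin2_cos2 (Im z)) as H. unfold Rsqr in H. lra.
Qed.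

Lemma Cexp_neq0 z : Cexp z <> 0%C.
Proof.
  apply Cmod_gt_0. rewrite Cmod_Cexp. apply exp_pos.
Qed.

Lemma Cexp_opp z : Cexp (- z) = (/ Cexp z)%C.
Proof.
  pose proof (Cexp_neq0 z) as H.
  replace (Cexp (- z)) with (Cexp (- z) * Cexp z * / Cexp z)%C by (field; auto).
  rewrite <- Cexp_add. replace (- z + z)%C with (RtoC 0) by ring. rewrite Cexp_0. ring.
Qed.

Lemma Cexp_pow z n : (Cexp z ^ n)%C = Cexp (INR n * z).
Proof.
  induction n.
  - simpl. replace (0 * z)%C with (RtoC 0) by ring. rewrite Cexp_0. reflexivity.
  - rewrite Cpow_S, IHn, <- Cexp_add. f_equal. rewrite S_INR, RtoC_plus. ring.
Qed.

Lemma Cexp_2PI : Cexp (2 * PI * Ci) = 1%C.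
Proof.
  unfold Cexp. replace (2 * PI * Ci)%C with (0, 2 * PI)
    by (unfold Cmult, RtoC, Ci; simpl; f_equal; ring).
  simpl. rewrite exp_0, cos_2PI, sin_2PI. unfold Cmult, RtoC. simpl. f_equal; ring.
Qed.

Lemma derivable_pt_lim_bound (f : R -> R) l eps : derivable_pt_lim f 0 l -> 0 < eps ->
  exists d, 0 < d /\ forall h, Rabs h < d -> Rabs (f h - f 0 - l * h) <= eps * Rabs h.
Proof.
  intros H He. destruct (H eps He) as [d hd]. exists d. split; [apply cond_pos|].
  intros h Hh. destruct (Req_dec h 0) as [->|h0].
  - rewrite Rmult_0_r, Rabs_R0. unfold Rminus. rewrite Rplus_opp_r, Ropp_0, Rplus_0_r, Rabs_R0. lra.
  - specialize (hd h h0 Hh). rewrite Rplus_0_l in hd.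
    replace (f h - f 0 - l * h) with (((f h - f 0) / h - l) * h) by (field; auto).
    rewrite Rabs_mult. apply Rmult_le_compat_r; [apply Rabs_pos|lra].
Qed.

Lemma Cder_Cexp_0 : Cder Cexp 0%C 1%C.
Proof.
  intros eps He.
  (* The error is at most [4 * e * m] in the real part and [5 * e * m] in the imaginary part,
     together below [20 * e * m]. *)
  set (e := Rmin (eps / 20) 1).
  assert (He0 : 0 < e) by (apply Rmin_glb_lt; lra).
  assert (He1 : e <= eps / 20) by apply Rmin_l.
  assert (He2 : e <= 1) by apply Rmin_r. clearbody e.
  destruct (derivable_pt_lim_bound exp 1 e) as [d1 [Hd1 h1]]; auto.
  { rewrite <- exp_0 at 1. apply derivable_pt_lim_exp. }
  destruct (derivable_pt_lim_bound sin 1 e) as [d2 [Hd2 h2]]; auto.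
  { rewrite <- cos_0 at 1. apply derivable_pt_lim_sin. }
  destruct (derivable_pt_lim_bound cos 0 e) as [d3 [Hd3 h3]]; auto.
  { pose proof (derivable_pt_lim_cos 0) as X. rewrite sin_0, Ropp_0 in X. exact X. }
  exists (Rmin (Rmin d1 d2) (Rmin d3 e)). split; [repeat apply Rmin_glb_lt; auto|].
  intros w Hw.
  pose proof (Rmin_l (Rmin d1 d2) (Rmin d3 e)). pose proof (Rmin_r (Rmin d1 d2) (Rmin d3 e)).
  pose proof (Rmin_l d1 d2). pose proof (Rmin_r d1 d2).
  pose proof (Rmin_l d3 e). pose proof (Rmin_r d3 e).
  replace (w - 0)%C with w in * by ring. rewrite Cexp_0.
  destruct w as [x y]. set (m := Cmod (x, y)) in *.
  assert (Hx : Rabs x <= m) by exact (re_le_Cmod (x, y)).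
  assert (Hy : Rabs y <= m) by exact (Cmod_Im_le (x, y)).
  specialize (h1 x ltac:(lra)). specialize (h2 y ltac:(lra)). specialize (h3 y ltac:(lra)).
  rewrite exp_0 in h1. rewrite sin_0 in h2. rewrite cos_0 in h3.
  assert (Em : 0 <= m) by apply Cmod_ge_0.
  set (A := exp x - 1 - 1 * x) in *. set (S := sin y - 0 - 1 * y) in *.
  set (K := cos y - 1 - 0 * y) in *.
  assert (Ex : Rabs (exp x) <= 3).
  { replace (exp x) with (A + (1 + x)) by (unfold A; ring).
    eapply Rle_trans; [apply Rabs_triang|].
    pose proof (Rabs_triang 1 x). rewrite Rabs_R1 in H5. nra. }
  eapply Rle_trans; [apply Cmod_le_Re_Im|].
  assert (E1 : Re (Cexp (x, y) - 1 - (x, y) * 1)%C = exp x * K + A).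
  { unfold Cexp, K, A, Cmult, Cminus, Cplus, Copp, RtoC. simpl. ring. }
  assert (E2 : Im (Cexp (x, y) - 1 - (x, y) * 1)%C = exp x * S + (A + x) * y).
  { unfold Cexp, S, A, Cmult, Cminus, Cplus, Copp, RtoC. simpl. ring. }
  rewrite E1, E2.
  assert (B1 : Rabs (exp x * K + A) <= 4 * e * m).
  { eapply Rle_trans; [apply Rabs_triang|]. rewrite Rabs_mult.
    pose proof (Rabs_pos (exp x)). pose proof (Rabs_pos K).
    assert (Rabs (exp x) * Rabs K <= 3 * (e * m)) by (apply Rmult_le_compat; auto; nra). nra. }
  assert (B2 : Rabs (exp x * S + (A + x) * y) <= 3 * e * m + 2 * e * m).
  { eapply Rle_trans; [apply Rabs_triang|]. rewrite !Rabs_mult.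
    apply Rplus_le_compat.
    - rewrite Rmult_assoc. apply Rmult_le_compat; try apply Rabs_pos; auto. nra.
    - assert (Rabs (A + x) <= 2 * e).
      { eapply Rle_trans; [apply Rabs_triang|]. nra. }
      apply Rmult_le_compat; try apply Rabs_pos; auto. }
  nra.
Qed.

Lemma Cder_Cexp z : Cder Cexp z (Cexp z).
Proof.
  apply Cder_ext with (fun w => Cexp z * Cexp (w - z))%C.
  { intros w. rewrite <- Cexp_add. f_equal. ring. }
  eapply Cder_eq; [|apply Cder_scal, (Cder_comp Cexp (fun w => w - z)%C z 1 1)].
  - ring.
  - eapply Cder_eq; [|apply Cder_plus; [apply Cder_id|apply Cder_const]]. ring.
  - replace (z - z)%C with (RtoC 0) by ring. apply Cder_Cexp_0.
Qed.

(** Each coefficient depends on all earlier ones, so the structural recursion carries the whole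
    table computed so far. *)
Fixpoint exps_tab (l : nat -> C) (n : nat) : nat -> C :=
  match n with
  | O => fun _ => Cexp (l O)
  | S m => fun k => if Nat.leb k m then exps_tab l m k
      else (conv (PSD l) (exps_tab l m) m / INR (S m))%C
  end.

(* The coefficients of exp (sum l_n q^n), from (exp L)' = L' exp L. *)
Definition exps (l : nat -> C) (n : nat) : C := exps_tab l n n.

Lemma exps_tab_le l n k : (k <= n)%nat -> exps_tab l n k = exps l k.
Proof.
  induction n; intros H.
  - replace k with O by lia. reflexivity.
  - destruct (Nat.eq_dec k (S n)) as [->|]; [reflexivity|].
    cbn [exps_tab]. destruct (Nat.leb_spec k n); [apply IHn; auto|lia].
Qed.

Lemma exps_0 l : exps l O = Cexp (l O).
Proof. reflexivity. Qed.

Lemma exps_S l n : PSD (exps l) n = conv (PSD l) (exps l) n.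
Proof.
  unfold PSD at 1. unfold exps at 1. cbn [exps_tab].
  destruct (Nat.leb_spec (S n) n); [lia|].
  replace (conv (PSD l) (exps_tab l n) n) with (conv (PSD l) (exps l) n).
  - field. intros E. apply RtoC_inj in E. revert E. apply not_0_INR. lia.
  - apply psum_ext. intros i Hi. rewrite exps_tab_le by lia. reflexivity.
Qed.

(** The recurrence divides a convolution with [PSD l] by the index. Once the index exceeds the sum
    [L] of |PSD l| at radius r, a new weighted coefficient cannot exceed a bound for the earlier
    ones, so the bound [M] for the first N + 1 persists. *)
Lemma disc_exps l : disc l -> disc (exps l).
Proof.
  intros Hl. apply disc_of_bounded. intros r Hr.
  destruct (disc_PSD l Hl r ltac:(lra)) as [L HL].
  assert (HL0 : 0 <= L) by apply (HL O).
  destruct (INR_unbounded L) as [N HN].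
  set (M := rsum (fun k => Cmod (exps l k) * r ^ k) (S N)).
  assert (T0 : forall k, 0 <= Cmod (exps l k) * r ^ k).
  { intros k. apply Rmult_le_pos; [apply Cmod_ge_0|apply pow_le; lra]. }
  assert (HM0 : 0 <= M) by (apply rsum_pos; auto).
  exists M. intros n. induction n as [n IH] using lt_wf_ind.
  destruct (Nat.le_gt_cases n N) as [h|h].
  - apply (rsum_term_le (fun k => Cmod (exps l k) * r ^ k) (S N) n); auto. lia.
  - destruct n as [|m]; [lia|].
    assert (Hm : 0 < INR (S m)) by (apply lt_0_INR; lia).
    apply Rmult_le_reg_l with (INR (S m)); auto.
    apply Rle_trans with (L * M).
    2:{ apply Rmult_le_compat_r; auto. apply Rlt_le, (Rlt_trans _ (INR N)); auto.
        apply lt_INR; lia. }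
    pose proof (exps_S l m) as E. unfold PSD at 1 in E.
    assert (E2 : INR (S m) * Cmod (exps l (S m)) = Cmod (conv (PSD l) (exps l) m)).
    { rewrite <- E, Cmod_mult, Cmod_R, Rabs_pos_eq. { reflexivity. } apply Rlt_le, Hm. }
    rewrite <- Rmult_assoc, E2.
    apply Rle_trans with (rsum (fun i => Cmod (PSD l i) * r ^ i) (S m) * M).
    2:{ apply Rmult_le_compat_r; auto. }
    apply Rle_trans with (rsum (fun i => Cmod (PSD l i * exps l (m - i)%nat)) (S m) * r ^ S m).
    { apply Rmult_le_compat_r; [apply pow_le; lra|]. apply psum_Cmod. }
    rewrite Rmult_comm, (Rmult_comm _ M), <- !rsum_scal. apply rsum_le. intros i Hi.
    rewrite Cmod_mult. specialize (IH (m - i)%nat ltac:(lia)).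
    assert (Ep : r ^ S m = r * (r ^ i * r ^ (m - i))).
    { rewrite <- pow_add. replace (i + (m - i))%nat with m by lia. reflexivity. }
    rewrite Ep.
    set (x := Cmod (PSD l i) * r ^ i).
    assert (0 <= x) by (apply Rmult_le_pos; [apply Cmod_ge_0|apply pow_le; lra]).
    set (t := Cmod (exps l (m - i)) * r ^ (m - i)) in *.
    replace (r * (r ^ i * r ^ (m - i)) * (Cmod (PSD l i) * Cmod (exps l (m - i))))
      with (r * (x * t)) by (unfold x, t; ring).
    pose proof (T0 (m - i)%nat) as T. fold t in T.
    apply Rle_trans with (x * M); [|right; unfold x; ring].
    assert (x * t <= x * M) by (apply Rmult_le_compat_l; auto).
    assert (0 <= x * t) by (apply Rmult_le_pos; auto).
    assert (0 <= (1 - r) * (x * t)) by (apply Rmult_le_pos; lra). lra.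
Qed.

(** The product of the series with [Cexp (- PS l w)] has derivative zero and is 1 at the origin. *)
Lemma PS_exps l q : disc l -> Cmod q < 1 -> PS (exps l) q = Cexp (PS l q).
Proof.
  intros Hl Hq. pose proof (disc_exps l Hl) as He.
  set (G := fun w => (PS (exps l) w * Cexp (- PS l w))%C).
  assert (E : G 0%C = G q).
  { apply Cder_zero_const. intros t Ht.
    set (w := (0 + t * (q - 0))%C).
    assert (Hw : Cmod w < 1).
    { unfold w. replace (0 + t * (q - 0))%C with (t * q)%C by ring.
      rewrite Cmod_mult, Cmod_R, Rabs_pos_eq by lra. pose proof (Cmod_ge_0 q). nra. }
    eapply Cder_eq; [|apply Cder_mult; [apply PS_der; auto|
      apply (Cder_comp Cexp (fun w => - PS l w)%C); [|apply Cder_Cexp]]].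
    2:{ apply Cder_ext with (fun w => (-1) * PS l w)%C; [intros; ring|].
        apply Cder_scal, PS_der; auto. }
    rewrite (PS_ext _ _ w (exps_S l)), PS_conv; auto using disc_PSD. ring. }
  unfold G in E. rewrite !PS_at_0, exps_0 in E by auto.
  rewrite <- Cexp_add in E. replace (l O + - l O)%C with (RtoC 0) in E by ring.
  rewrite Cexp_0, Cexp_opp in E. pose proof (Cexp_neq0 (PS l q)) as Hn.
  replace (PS (exps l) q) with (PS (exps l) q * / Cexp (PS l q) * Cexp (PS l q))%C by (field; auto).
  rewrite <- E. ring.
Qed.

(** * Cauchy estimates *)

Lemma psum_geom_root (x : C) N : (x ^ N)%C = 1%C -> x <> 1%C -> psum (fun j => x ^ j)%C N = 0%C.
Proof.
  intros H1 Hx.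
  assert (E : forall n, ((x - 1) * psum (fun j => x ^ j)%C n)%C = (x ^ n - 1)%C).
  { induction n; simpl; [ring|]. rewrite Cmult_plus_distr_l, IHn. ring. }
  specialize (E N). rewrite H1 in E.
  assert (Hn : (x - 1 <> 0)%C).
  { intros Z. apply Hx. replace x with ((x - 1) + 1)%C by ring. rewrite Z. ring. }
  replace (psum (fun j => x ^ j)%C N) with (/ (x - 1) * ((x - 1) * psum (fun j => x ^ j)%C N))%C
    by (field; auto).
  rewrite E. ring.
Qed.

Lemma Cexp_2PI_neq1 x : 0 < x < 1 -> Cexp (2 * PI * Ci * x) <> 1%C.
Proof.
  intros Hx E. unfold Cexp in E.
  replace (2 * PI * Ci * x)%C with (0, 2 * (PI * x)) in E
    by (unfold Cmult, RtoC, Ci; simpl; f_equal; ring).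
  simpl in E. rewrite exp_0 in E. unfold Cmult, RtoC in E. simpl in E. injection E as E1 E2.
  replace (1 * cos (2 * (PI * x)) - 0 * sin (2 * (PI * x))) with (cos (2 * (PI * x))) in E1 by ring.
  rewrite cos_2a_sin in E1.
  pose proof PI_RGT_0.
  assert (0 < sin (PI * x)) by (apply sin_gt_0; nra). nra.
Qed.

(** Exponents above N occur as [m + (N - n)] in [Cauchy_estimate]; in this range only N is a
    multiple of N. *)
Lemma root_pow_neq1 N k : (0 < k < 2 * N)%nat -> k <> N ->
  (Cexp (2 * PI * Ci * (/ INR N)) ^ k)%C <> 1%C.
Proof.
  intros Hk Hn. assert (HN : 0 < INR N) by (apply lt_0_INR; lia).
  assert (key : forall m, (0 < m < N)%nat -> (Cexp (2 * PI * Ci * (/ INR N)) ^ m)%C <> 1%C).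
  { intros m Hm. rewrite Cexp_pow.
    replace (INR m * (2 * PI * Ci * / INR N))%C with (2 * PI * Ci * RtoC (INR m / INR N))%C.
    - apply Cexp_2PI_neq1. split.
      + apply Rdiv_lt_0_compat; auto. apply lt_0_INR; lia.
      + apply Rmult_lt_reg_r with (INR N); auto.
        replace (INR m / INR N * INR N) with (INR m) by (field; lra).
        rewrite Rmult_1_l. apply lt_INR; lia.
    - rewrite RtoC_div by lra. unfold Cdiv. ring. }
  destruct (Nat.lt_ge_cases k N) as [h|h]; [apply key; lia|].
  replace k with (N + (k - N))%nat by lia. rewrite Cpow_add_r, Cexp_pow.
  replace (INR N * (2 * PI * Ci * / INR N))%C with (2 * PI * Ci)%C.
  - rewrite Cexp_2PI, Cmult_1_l. apply key. lia.
  - field. intros E. apply RtoC_inj in E. lra.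
Qed.

(** On the circle of radius r the average over N-th roots of unity isolates one coefficient of the
    series truncated at N, and truncation costs at most [e / 2]. Letting r tend to 1 removes the
    factor r^n. *)
Lemma Cauchy_estimate (a : nat -> C) M : disc a ->
  (forall q : C, q <> 0%C -> Cmod q < 1 -> Cmod (PS a q) <= M) -> forall n, Cmod (a n) <= M.
Proof.
  intros Ha HM n.
  assert (HM0 : 0 <= M).
  { eapply Rle_trans; [apply Cmod_ge_0|apply (HM (RtoC (1/2)))].
    - intros E. apply RtoC_inj in E. lra.
    - rewrite Cmod_R, Rabs_pos_eq; lra. }
  assert (Hr : forall r, 0 < r < 1 -> Cmod (a n) * r ^ n <= M).
  { intros r Hr. apply Rnot_lt_le. intros Hlt. set (e := Cmod (a n) * r ^ n - M).
    assert (T0 : forall i, 0 <= Cmod (a i) * r ^ i)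
      by (intros; apply Rmult_le_pos; [apply Cmod_ge_0|apply pow_le; lra]).
    destruct (summable_tail (fun i => Cmod (a i) * r ^ i) T0 (Ha r ltac:(lra)) (e / 2)) as [K HK].
    { unfold e; lra. }
    (* Beyond K for the tail estimate, and beyond n so that [a n] survives the truncation. *)
    set (N := S (max K n)).
    assert (HN : 0 < INR N) by (apply lt_0_INR; unfold N; lia).
    set (z := Cexp (2 * PI * Ci * (/ INR N))).
    assert (Hz : Cmod z = 1).
    { unfold z. rewrite Cmod_Cexp. rewrite <- exp_0. f_equal.
      rewrite <- RtoC_inv by lra. unfold Cmult, RtoC, Ci. simpl. ring. }
    assert (HzN : (z ^ N)%C = 1%C).
    { unfold z. rewrite Cexp_pow.
      replace (INR N * (2 * PI * Ci * / INR N))%C with (2 * PI * Ci)%C; [apply Cexp_2PI|].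
      field. intros E. apply RtoC_inj in E. lra. }
    assert (Hq : forall j, Cmod (r * z ^ j) = r).
    { intros j. rewrite Cmod_mult, Cmod_pow, Hz, pow1, Cmod_R, Rabs_pos_eq; lra. }
    assert (Hp : forall j, Cmod (psum (fun m => a m * (r * z ^ j) ^ m)%C N) <= M + e / 2).
    { intros j.
      assert (Hq1 : Cmod (r * z ^ j) < 1) by (rewrite Hq; lra).
      assert (B1 : Cmod (PS a (r * z ^ j)) <= M).
      { apply HM; auto. intros E. pose proof (Hq j) as E2. rewrite E, Cmod_0 in E2. lra. }
      assert (B2 : Cmod (PS a (r * z ^ j) - psum (fun m => a m * (r * z ^ j) ^ m)%C N) <= e / 2).
      { apply (Cser_tail_bound (fun m => a m * (r * z ^ j) ^ m)%C); [apply PS_ser; auto|].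
        intros m. rewrite (rsum_ext _ (fun i => Cmod (a (N + i)%nat) * r ^ (N + i))).
        - specialize (HK N (N + m)%nat ltac:(unfold N; lia) ltac:(lia)).
          rewrite rsum_add in HK. lra.
        - intros i _. rewrite Cmod_mult, Cmod_pow, Hq. reflexivity. }
      rewrite Cmod_sub_sym in B2.
      pose proof (Cmod_sub_ge (psum (fun m => a m * (r * z ^ j) ^ m)%C N) (PS a (r * z ^ j))). lra. }
    (* The weight z^(j(N-n)) plays the role of the conjugate of z^(jn): summing over j kills every
       coefficient except the n-th. *)
    assert (E : psum (fun j => (z ^ j) ^ (N - n) * psum (fun m => a m * (r * z ^ j) ^ m)%C N)%C N
      = (INR N * (a n * r ^ n))%C).
    { rewrite (psum_ext _ (fun j => psum (fun m => a m * r ^ m * (z ^ (m + (N - n))) ^ j)%C N)).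
      2:{ intros j _. rewrite <- psum_scal. apply psum_ext. intros m _.
          rewrite Cpow_mult_l, <- !Cpow_mult_r.
          replace ((m + (N - n)) * j)%nat with (j * m + j * (N - n))%nat by lia.
          rewrite Cpow_add_r. ring. }
      rewrite (psum_switch (fun j m => a m * r ^ m * (z ^ (m + (N - n))) ^ j)%C).
      assert (Hn : (n < N)%nat) by (unfold N; lia).
      rewrite (psum_ext _ (fun m => if Nat.eqb m n then INR N * (a n * r ^ n) else 0)%C).
      2:{ intros m Hm. rewrite (psum_scal (a m * r ^ m)%C).
          destruct (Nat.eqb_spec m n) as [->|hmn].
          - replace (n + (N - n))%nat with N by lia. rewrite HzN.
            rewrite (psum_ext _ (fun _ => 1%C)) by (intros; apply Cpow_1_l).
            rewrite Cmult_comm. f_equal. clear. generalize N. intros k.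
            induction k; simpl psum; [reflexivity|]. rewrite IHk, S_INR, RtoC_plus. reflexivity.
          - rewrite psum_geom_root; [ring| |].
            + rewrite <- Cpow_mult_r, Nat.mul_comm, Cpow_mult_r, HzN, Cpow_1_l. reflexivity.
            + apply root_pow_neq1; lia. }
      generalize (INR N * (a n * r ^ n))%C. intros c. revert Hn. clear. generalize N. intros k.
      induction k; [lia|]. intros Hk. simpl psum.
      destruct (Nat.eqb_spec k n) as [->|h]; [|rewrite IHk by lia; ring].
      rewrite (psum_ext _ (fun _ => 0%C)); [rewrite psum_0; ring|].
      intros i Hi. destruct (Nat.eqb_spec i n); [lia|auto]. }
    assert (B : INR N * (Cmod (a n) * r ^ n) <= INR N * (M + e / 2)).
    { replace (INR N * (Cmod (a n) * r ^ n)) with (Cmod (INR N * (a n * r ^ n))%C).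
      2:{ rewrite !Cmod_mult, Cmod_pow, !Cmod_R, !Rabs_pos_eq; lra. }
      rewrite <- E. eapply Rle_trans; [apply psum_Cmod|].
      apply Rle_trans with (rsum (fun _ => (M + e / 2) * 1) N).
      - apply rsum_le. intros j _. rewrite Cmod_mult, !Cmod_pow, Hz, !pow1, Rmult_1_r, Rmult_1_l. auto.
      - rewrite rsum_scal. right. rewrite Rmult_comm. f_equal. clear.
        generalize N. intros k. induction k; simpl rsum; [auto|]. rewrite IHk, S_INR. auto. }
    apply Rmult_le_reg_l in B; auto. unfold e in B. lra. }
  apply Rnot_lt_le. intros Hlt.
  destruct (Req_dec M 0) as [HM00|HM00].
  - specialize (Hr (1/2) ltac:(lra)). pose proof (pow_lt (1/2) n ltac:(lra)). nra.
  - (* r^n is close to 1 for r close to 1, by Bernoulli's inequality *)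
    set (x := 1 - M / Cmod (a n)).
    assert (Hx : 0 < x < 1).
    { assert (0 < M / Cmod (a n)) by (apply Rdiv_lt_0_compat; lra).
      assert (M / Cmod (a n) < 1).
      { apply Rmult_lt_reg_r with (Cmod (a n)); [lra|].
        replace (M / Cmod (a n) * Cmod (a n)) with M by (field; lra). lra. }
      unfold x. lra. }
    assert (Hn : 0 <= INR n) by apply pos_INR.
    (* Then n y < x, so 1 - n y exceeds 1 - x = M / |a_n|. *)
    set (y := x / (INR n + 2)).
    assert (Hy : y * (INR n + 2) = x) by (unfold y; field; lra).
    assert (Hy0 : 0 < y) by (unfold y; apply Rdiv_lt_0_compat; lra).
    assert (Hy1 : y < 1) by nra. clearbody y.
    specialize (Hr (1 - y) ltac:(lra)).
    assert (Bern : 1 - INR n * y <= (1 - y) ^ n).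
    { clear - Hy0 Hy1. induction n; [simpl; lra|]. rewrite S_INR. simpl pow.
      pose proof (pos_INR n). assert (0 <= INR n * y * y) by (repeat apply Rmult_le_pos; lra).
      assert ((1 - y) * (1 - INR n * y) <= (1 - y) * (1 - y) ^ n) by (apply Rmult_le_compat_l; lra). lra. }
    assert (M / Cmod (a n) < (1 - y) ^ n).
    { replace (M / Cmod (a n)) with (1 - x) by (unfold x; ring). nra. }
    assert (M < Cmod (a n) * (1 - y) ^ n); [|lra].
    replace M with (Cmod (a n) * (M / Cmod (a n))) by (field; lra).
    apply Rmult_lt_compat_l; lra.
Qed.

(** * The eta product *)

Lemma Cpow_lt_1 (q : C) n : Cmod q < 1 -> (0 < n)%nat -> Cmod (q ^ n) < 1.
Proof.
  intros Hq Hn. rewrite Cmod_pow. destruct n; [lia|]. apply pow_lt_1_compat; [|lia].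
  split; auto. apply Cmod_ge_0.
Qed.

Lemma one_minus_neq0 (x : C) : Cmod x < 1 -> (1 - x)%C <> 0%C.
Proof.
  intros H E. replace x with (1 - (1 - x))%C in H by ring. rewrite E in H.
  replace (1 - 0)%C with (RtoC 1) in H by ring. rewrite Cmod_1 in H. lra.
Qed.

Definition log1m (n : nat) : C := match n with O => 0%C | S m => (- / INR (S m))%C end.

Lemma Cmod_log1m n : Cmod (log1m n) <= 1.
Proof.
  destruct n; unfold log1m; [rewrite Cmod_0; lra|].
  assert (H : 1 <= INR (S n)) by (rewrite S_INR; pose proof (pos_INR n); lra).
  rewrite <- RtoC_inv, Cmod_opp, Cmod_R, Rabs_pos_eq.
  - rewrite <- Rinv_1. apply Rinv_le_contravar; lra.
  - apply Rlt_le, Rinv_0_lt_compat; lra.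
  - lra.
Qed.

Lemma disc_log1m : disc log1m.
Proof.
  apply disc_of_bounded. intros r Hr. exists 1. intros n.
  pose proof (Cmod_log1m n). pose proof (Cmod_ge_0 (log1m n)).
  pose proof (pow_le r n ltac:(lra)).
  assert (r ^ n <= 1) by (rewrite <- (pow1 n); apply pow_incr; lra). nra.
Qed.

Lemma PS_geom (c : C) x : Cmod x < 1 -> disc (fun _ => c) -> PS (fun _ => c) x = (c / (1 - x))%C.
Proof.
  intros Hx Hd. pose proof (PS_shift (fun _ => c) x Hd Hx) as E. cbv beta in E.
  pose proof (one_minus_neq0 x Hx) as Hn.
  replace (PS (fun _ => c) x) with ((PS (fun _ => c) x - x * PS (fun _ => c) x) / (1 - x))%C
    by (field; auto).
  f_equal. rewrite E at 1. ring.
Qed.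

Lemma disc_const c : disc (fun _ => c).
Proof.
  apply disc_of_bounded. intros r Hr. exists (Cmod c). intros n.
  pose proof (Cmod_ge_0 c). pose proof (pow_le r n ltac:(lra)).
  assert (r ^ n <= 1) by (rewrite <- (pow1 n); apply pow_incr; lra). nra.
Qed.

Lemma PSD_log1m n : PSD log1m n = (-1)%C.
Proof.
  unfold PSD, log1m. field. intros E. apply RtoC_inj in E. revert E. apply not_0_INR. lia.
Qed.

(** The logarithm series has derivative -1/(1 - w), so (1 - w) times the inverse of its exponential
    is constant. *)
Lemma Cexp_log1m x : Cmod x < 1 -> Cexp (PS log1m x) = (1 - x)%C.
Proof.
  intros Hx. set (G := fun w => ((1 - w) * Cexp (- PS log1m w))%C).
  assert (E : G 0%C = G x).
  { apply Cder_zero_const. intros t Ht. set (w := (0 + t * (x - 0))%C).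
    assert (Hw : Cmod w < 1).
    { unfold w. replace (0 + t * (x - 0))%C with (t * x)%C by ring.
      rewrite Cmod_mult, Cmod_R, Rabs_pos_eq by lra. pose proof (Cmod_ge_0 x). nra. }
    eapply Cder_eq; [|apply Cder_mult; [|
      apply (Cder_comp Cexp (fun w => - PS log1m w)%C); [|apply Cder_Cexp]]].
    2:{ apply Cder_ext with (fun w => 1 + (-1) * w)%C; [intros; ring|].
        apply Cder_plus; [apply Cder_const|apply Cder_scal, Cder_id]. }
    2:{ apply Cder_ext with (fun w => (-1) * PS log1m w)%C; [intros; ring|].
        apply Cder_scal, PS_der; auto using disc_log1m. }
    rewrite (PS_ext _ _ w PSD_log1m), PS_geom by (auto using disc_const).
    field. apply one_minus_neq0; auto. }
  unfold G in E. rewrite PS_at_0 in E by apply disc_log1m. simpl log1m in E.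
  replace (- 0)%C with (RtoC 0) in E by ring. rewrite Cexp_0, Cexp_opp in E.
  pose proof (Cexp_neq0 (PS log1m x)) as Hn.
  replace (1 - x)%C with ((1 - x) * / Cexp (PS log1m x) * Cexp (PS log1m x))%C by (field; auto).
  rewrite <- E. ring.
Qed.

Lemma rsum_dilate d u N : (0 < d)%nat ->
  rsum (fun m => Cmod (dilate d u m)) N = rsum (fun j => Cmod (u j)) ((N + d - 1) / d).
Proof.
  (* Passing to C makes [psum_dilate] applicable to the moduli. *)
  intros Hd. apply RtoC_inj.
  assert (E : forall x n, RtoC (rsum x n) = psum (fun i => RtoC (x i)) n).
  { intros x n. induction n; simpl; [auto|]. rewrite RtoC_plus, IHn. auto. }
  rewrite !E, <- psum_dilate by auto. apply psum_ext. intros i _. unfold dilate.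
  destruct (Nat.eqb (i mod d) 0); [auto|]. rewrite Cmod_0. auto.
Qed.

(** Coefficients of the sum over c of the series [a c] in q^(c+1). When no [a c] has a constant
    term, only c < m contribute to q^m. *)
Definition lambert (a : nat -> nat -> C) (m : nat) : C :=
  psum (fun c => dilate (S c) (a c) m) m.

Lemma dilate_pow d a q m :
  (dilate d a m * q ^ m)%C = dilate d (fun j => a j * (q ^ d) ^ j)%C m.
Proof.
  unfold dilate. destruct (Nat.eqb_spec (m mod d) 0) as [E|E]; [|ring].
  pose proof (Nat.div_mod_eq m d) as E2. rewrite E, Nat.add_0_r in E2.
  rewrite <- Cpow_mult_r, <- E2. reflexivity.
Qed.

Lemma lambert_PS (a : nat -> nat -> C) (A : nat -> R) q : Cmod q < 1 ->
  (forall c, a c O = 0%C) -> (forall c, disc (a c)) ->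
  (forall c n, rsum (fun j => Cmod (a c j * (q ^ S c) ^ j)%C) n <= A c) -> summable A ->
  Cser (fun c => PS (a c) (q ^ S c)%C) (PS (lambert a) q).
Proof.
  intros Hq H0 Hd HA HS.
  set (u := fun c m => (dilate (S c) (a c) m * q ^ m)%C).
  assert (Hu : forall c n, rsum (fun m => Cmod (u c m)) n <= A c).
  { intros c n. rewrite (rsum_ext _ (fun m => Cmod (dilate (S c) (fun j => a c j * (q ^ S c) ^ j)%C m))).
    - rewrite rsum_dilate by lia. apply HA.
    - intros i _. unfold u. rewrite dilate_pow. reflexivity. }
  assert (Hrow : forall c, Csum (u c) = PS (a c) (q ^ S c)%C).
  { intros c. apply Csum_eq. eapply Cser_ext; [intros m; symmetry; apply dilate_pow|].
    apply Cser_dilate; [lia|]. apply PS_ser; auto. apply Cpow_lt_1; auto. lia. }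
  assert (Hcol : forall m, Csum (fun c => u c m) = (lambert a m * q ^ m)%C).
  { intros m. apply Csum_eq.
    replace (lambert a m * q ^ m)%C with (psum (fun c => u c m) m).
    - apply Cser_finite. intros c Hc. unfold u, dilate.
      destruct m as [|m].
      + rewrite Nat.Div0.mod_0_l, Nat.Div0.div_0_l. simpl. rewrite H0. ring.
      + rewrite Nat.mod_small by lia. simpl. ring.
    - unfold lambert. rewrite Cmult_comm, <- psum_scal. apply psum_ext. intros; unfold u; ring. }
  pose proof (Fubini u A Hu HS) as HF.
  assert (E : PS (lambert a) q = Csum (fun c => PS (a c) (q ^ S c)%C)).
  { apply PS_eq. eapply Cser_ext; [intros m; apply Hcol|].
    rewrite <- (Csum_ext _ _ Hrow). exact HF. }
  rewrite E. apply Csum_ser. eapply summable_le; [|apply HS]. intros c. cbv beta.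
  rewrite <- Hrow. apply Cser_bound with (u := u c); [|apply Hu].
  apply Csum_ser. exists (A c). apply Hu.
Qed.

(* coefficients of log prod (1 - q^n) *)
Definition etalog : nat -> C := lambert (fun _ => log1m).

Lemma disc_etalog : disc etalog.
Proof.
  apply disc_of_bounded. intros r Hr. exists (/ (1 - r)). intros n.
  eapply Rle_trans; [|apply (succ_pow_le r n); lra].
  apply Rmult_le_compat_r; [apply pow_le; lra|].
  unfold etalog, lambert. eapply Rle_trans; [apply psum_Cmod|].
  apply Rle_trans with (INR n); [|rewrite S_INR; lra].
  assert (H : forall k, rsum (fun i => Cmod (dilate (S i) log1m n)) k <= INR k).
  { induction k; [simpl; lra|]. rewrite S_INR. simpl rsum. apply Rplus_le_compat; auto.
    unfold dilate. destruct (Nat.eqb (n mod S k) 0); [apply Cmod_log1m|rewrite Cmod_0; lra]. }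
  apply H.
Qed.

(** A majorant for one row of a Lambert series that is itself summable over c, by
    [summable_geom]. *)
Lemma pow_pow_le r c n : 0 <= r < 1 -> rsum (fun j => (r ^ S c) ^ j * r ^ S c) n <= / (1 - r) * r ^ S c.
Proof.
  intros Hr. assert (Hc : 0 <= r ^ S c <= r).
  { split; [apply pow_le; lra|]. simpl. pose proof (pow_le r c ltac:(lra)).
    assert (r ^ c <= 1) by (rewrite <- (pow1 c); apply pow_incr; lra). nra. }
  rewrite (rsum_ext _ (fun j => r ^ S c * (r ^ S c) ^ j)) by (intros; ring).
  rewrite rsum_scal, Rmult_comm. apply Rmult_le_compat_r; [lra|].
  eapply Rle_trans; [apply rsum_geom; lra|]. apply Rinv_le_contravar; lra.
Qed.

Lemma summable_geom r : 0 <= r < 1 -> summable (fun c => / (1 - r) * r ^ S c).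
Proof.
  intros Hr. apply summable_scal; [apply Rlt_le, Rinv_0_lt_compat; lra|].
  apply summable_le with (fun n => r * r ^ n); [intros; simpl; lra|].
  apply summable_scal; [lra|]. exists (/ (1 - r)). intros n. apply rsum_geom; auto.
Qed.

Lemma rsum_shift_le (x : nat -> R) n B : x O = 0 -> (forall i, 0 <= x i) ->
  (forall m, rsum (fun i => x (S i)) m <= B) -> rsum x n <= B.
Proof.
  intros H0 Hp H. apply Rle_trans with (rsum x (1 + n)); [apply rsum_mono; auto; lia|].
  rewrite rsum_add. simpl rsum at 1. rewrite H0. specialize (H n). simpl. simpl in H. lra.
Qed.

Lemma etalog_ser q : Cmod q < 1 -> Cser (fun c => PS log1m (q ^ S c)%C) (PS etalog q).
Proof.
  intros Hq. set (r := Cmod q). assert (Hr : 0 <= r < 1) by (split; [apply Cmod_ge_0|auto]).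
  apply (lambert_PS (fun _ => log1m) (fun c => / (1 - r) * r ^ S c)); auto using disc_log1m, summable_geom.
  intros c n. apply rsum_shift_le.
  - simpl. rewrite Cmult_0_l. apply Cmod_0.
  - intros; apply Cmod_ge_0.
  - intros m. eapply Rle_trans; [|apply (pow_pow_le r c m Hr)]. apply rsum_le. intros i _.
    rewrite Cmod_mult, Cmod_pow, Cmod_pow. fold r.
    apply Rle_trans with (1 * (r ^ S c) ^ S i); [|right; simpl; ring].
    apply Rmult_le_compat_r; [apply pow_le, pow_le; lra|apply Cmod_log1m].
Qed.

Lemma eta_prod_exp q n : Cmod q < 1 ->
  eta_prod q n = Cexp (psum (fun c => PS log1m (q ^ S c)%C) n).
Proof.
  intros Hq. induction n; [simpl; rewrite Cexp_0; auto|].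
  cbn [eta_prod psum]. rewrite Cexp_add, <- IHn, Cexp_log1m; auto. apply Cpow_lt_1; auto. lia.
Qed.

Lemma Clim_Cder f u l m : Cder f l m -> Clim u l -> Clim (fun n => f (u n)) (f l).
Proof.
  intros Hf Hu eps He. destruct (Cder_lipschitz _ _ _ Hf) as [d [Hd h]].
  pose proof (Cmod_ge_0 m) as Hm.
  destruct (Hu (Rmin d (eps / (Cmod m + 1)))) as [N HN].
  { apply Rmin_glb_lt; auto. apply Rdiv_lt_0_compat; lra. }
  exists N. intros n Hn. specialize (HN n Hn).
  pose proof (Rmin_l d (eps / (Cmod m + 1))). pose proof (Rmin_r d (eps / (Cmod m + 1))).
  eapply Rle_lt_trans; [apply h; lra|].
  apply Rlt_le_trans with ((Cmod m + 1) * (eps / (Cmod m + 1))).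
  - apply Rmult_lt_compat_l; lra.
  - right. field. lra.
Qed.

Lemma Cmod_qh h tau : (0 < h)%nat -> upper tau -> Cmod (qh h tau) < 1.
Proof.
  intros Hh Ht. unfold qh. rewrite Cmod_Cexp, <- exp_0. apply exp_increasing.
  assert (0 < INR h) by (apply lt_0_INR; auto). unfold upper in Ht. pose proof PI_RGT_0.
  replace (Re (2 * PI * Ci * tau / INR h)%C) with (- (2 * PI * Im tau / INR h)).
  - assert (0 < 2 * PI * Im tau / INR h); [|lra]. apply Rdiv_lt_0_compat; auto. nra.
  - destruct tau as [x y]. unfold Cdiv. rewrite <- RtoC_inv by lra.
    unfold Cmult, RtoC, Ci. simpl. field. lra.
Qed.

Lemma qh_neq0 h tau : qh h tau <> 0%C.
Proof. apply Cexp_neq0. Qed.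

(** In exponential form eta visibly has no zero, and its powers and quotients become linear
    operations on [etalog]. *)
Lemma eta_exp tau : upper tau -> eta tau = (qh 24 tau * Cexp (PS etalog (qh 1 tau)))%C.
Proof.
  intros Ht. pose proof (Cmod_qh 1 tau ltac:(lia) Ht) as Hq. unfold eta. f_equal.
  change (Clim_val (eta_prod (qh 1 tau)) = Cexp (PS etalog (qh 1 tau))).
  apply Clim_val_eq. eapply Clim_ext; [intros n; symmetry; apply eta_prod_exp; auto|].
  eapply Clim_Cder; [apply Cder_Cexp|]. apply etalog_ser; auto.
Qed.

Definition id_coef (n : nat) : C := RtoC (INR n).

Lemma PS_id_coef x : Cmod x < 1 -> disc id_coef /\ PS id_coef x = (x / ((1 - x) * (1 - x)))%C.
Proof.
  intros Hx.
  assert (E : forall n, unshift 0 (PSD (fun _ => 1%C)) n = id_coef n).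
  { intros [|n]; [reflexivity|]. unfold unshift, PSD, id_coef. ring. }
  assert (D1 : disc (PSD (fun _ => 1%C))) by apply disc_PSD, disc_const.
  split; [eapply disc_ext; [apply E|]; apply disc_unshift, D1|].
  rewrite <- (PS_ext _ _ x E), PS_unshift by auto.
  (* the derivative P of the geometric series satisfies P = 1/(1-x) + x P *)
  pose proof (one_minus_neq0 x Hx) as Hn.
  assert (E2 : forall n, (unshift 0 (PSD (fun _ => 1%C)) n + 1)%C = PSD (fun _ => 1%C) n).
  { intros [|n]; unfold unshift, PSD; rewrite ?S_INR, ?RtoC_plus; simpl; ring. }
  pose proof (PS_plus (unshift 0 (PSD (fun _ => 1%C))) (fun _ => 1%C) x
    (disc_unshift _ _ D1) (disc_const _) Hx) as E3.
  pose proof (PS_ext _ _ x E2) as E5. cbv beta in E3, E5. rewrite E5, PS_unshift, PS_geom in E3 by (auto using disc_const).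
  set (P := PS (PSD (fun _ => 1%C)) x) in *.
  assert (E4 : (P * (1 - x))%C = (1 / (1 - x))%C).
  { replace (P * (1 - x))%C with (P - x * P)%C by ring. rewrite E3 at 1. ring. }
  replace P with (P * (1 - x) / (1 - x))%C by (field; auto). rewrite E4. field. auto.
Qed.

(** The right side is -q d/dq of log prod (1 - q^n). The terms x/(1-x)^2 on the left are values of
    [csc2] up to a constant, which connects eta with lattice sums. *)
Lemma etalog_der q : Cmod q < 1 ->
  Cser (fun j => let x := (q ^ S j)%C in (x / ((1 - x) * (1 - x)))%C) (- (q * PS (PSD etalog) q))%C.
Proof.
  intros Hq. set (r := Cmod q). assert (Hr : 0 <= r < 1) by (split; [apply Cmod_ge_0|auto]).
  set (a := fun c j : nat => match j return C with O => 0%C | S _ => RtoC (INR (S c)) end).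
  set (B := fun c => INR (S c) * (/ (1 - r) * r ^ S c)).
  assert (da : forall c, disc (a c)).
  { intros c. apply (disc_unshift 0 (fun _ => RtoC (INR (S c)))), disc_const. }
  assert (HB : summable B).
  { destruct (PS_id_coef 0) as [D _]; [rewrite Cmod_0; lra|].
    apply summable_le with (fun c => / (1 - r) * (Cmod (id_coef (S c)) * r ^ S c)).
    - intros c. unfold B, id_coef. rewrite Cmod_R, Rabs_pos_eq by apply pos_INR. lra.
    - apply summable_scal; [apply Rlt_le, Rinv_0_lt_compat; lra|].
      apply summable_le with (fun c => r * (Cmod (id_coef (S c)) * r ^ c)); [intros; simpl; lra|].
      apply summable_scal; [lra|]. apply (disc_shift _ D). auto. }
  assert (Hb : forall c n, rsum (fun j => INR (S c) * (r ^ S c) ^ S j) n <= B c).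
  { intros c n. rewrite rsum_scal. apply Rmult_le_compat_l; [apply pos_INR|].
    eapply Rle_trans; [|apply (pow_pow_le r c n Hr)]. apply rsum_le. intros; simpl; lra. }
  assert (E1 : forall m, lambert a m = (- (unshift 0 (PSD etalog) m))%C).
  { intros [|m]; [unfold lambert; simpl; ring|]. simpl unshift. unfold PSD, etalog, lambert.
    replace (- (INR (S m) * psum (fun c => dilate (S c) log1m (S m)) (S m)))%C
      with ((- INR (S m)) * psum (fun c => dilate (S c) log1m (S m)) (S m))%C by ring.
    rewrite <- psum_scal. apply psum_ext. intros c Hc. unfold dilate.
    destruct (Nat.eqb_spec (S m mod S c) 0) as [E|E]; [|ring].
    pose proof (Nat.div_mod_eq (S m) (S c)) as E2. rewrite E, Nat.add_0_r in E2.
    destruct (S m / S c)%nat as [|k]; [lia|]. unfold a, log1m.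
    rewrite E2, mult_INR, RtoC_mult. field.
    intros Z. apply RtoC_inj in Z. revert Z. apply not_0_INR. lia. }
  (* sum over (c, j) of c q^(cj), once by rows and once by columns *)
  set (u := fun c j => (INR (S c) * (q ^ S c) ^ S j)%C).
  assert (Hu : forall c n, rsum (fun j => Cmod (u c j)) n <= B c).
  { intros c n. eapply Rle_trans; [|apply (Hb c n)]. apply rsum_le. intros j _. unfold u.
    rewrite Cmod_mult, !Cmod_pow, Cmod_R, Rabs_pos_eq by apply pos_INR. fold r. lra. }
  pose proof (Fubini u B Hu HB) as HF.
  assert (Erow : Csum (fun c => Csum (u c)) = (- (q * PS (PSD etalog) q))%C).
  { replace (- (q * PS (PSD etalog) q))%C with (PS (lambert a) q).
    2:{ rewrite (PS_ext _ (fun m => (-1) * unshift 0 (PSD etalog) m)%C)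
          by (intros; rewrite E1; ring).
        rewrite PS_scal, PS_unshift; auto using disc_unshift, disc_PSD, disc_etalog. ring. }
    apply Csum_eq.
    eapply Cser_ext; [|apply (lambert_PS a B q Hq)]; auto.
    - intros c. symmetry. apply Csum_eq. unfold PS.
      replace (Csum (fun n => a c n * (q ^ S c) ^ n)%C) with
        (Csum (fun n => a c n * (q ^ S c) ^ n)%C - (a c O * (q ^ S c) ^ 0))%C by (simpl; ring).
      apply (Cser_unshift (fun n => a c n * (q ^ S c) ^ n)%C), PS_ser; [apply da|apply Cpow_lt_1; auto; lia].
    - intros c n. apply rsum_shift_le.
      + simpl. rewrite Cmult_0_l. apply Cmod_0.
      + intros; apply Cmod_ge_0.
      + intros m. apply (Hu c m). }
  rewrite <- Erow. eapply Cser_ext; [|exact HF].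
  intros j. simpl. assert (Hx : Cmod (q ^ S j) < 1) by (apply Cpow_lt_1; auto; lia).
  destruct (PS_id_coef _ Hx) as [D E]. simpl in E. rewrite <- E. apply Csum_eq.
  replace (PS id_coef (q * q ^ j)) with (PS id_coef (q * q ^ j) - id_coef 0 * (q * q ^ j) ^ 0)%C
    by (unfold id_coef; simpl; ring).
  eapply Cser_ext; [|apply (Cser_unshift (fun n => id_coef n * (q * q ^ j) ^ n)%C), PS_ser; [apply D|exact Hx]].
  intros c. unfold u, id_coef. f_equal.
  rewrite <- Cpow_S, <- !Cpow_mult_r. f_equal. lia.
Qed.

(** * Partial fractions of the cosecant and the cotangent *)

(** Summation is symmetric because the cotangent series converges only conditionally. *)
Fixpoint zsum (f : Z -> C) (n : nat) : C :=
  match n with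
  | O => f 0%Z
  | S m => (zsum f m + (f (Z.of_nat n) + f (- Z.of_nat n)%Z))%C
  end.

Lemma zsum_ext f g n : (forall d, f d = g d) -> zsum f n = zsum g n.
Proof. intros H. induction n; simpl; rewrite ?IHn, ?H; auto. Qed.

Lemma zsum_scal c f n : zsum (fun d => c * f d)%C n = (c * zsum f n)%C.
Proof. induction n; simpl; [auto|]. rewrite IHn. ring. Qed.

Lemma zsum_plus f g n : zsum (fun d => f d + g d)%C n = (zsum f n + zsum g n)%C.
Proof. induction n; simpl; [auto|]. rewrite IHn. ring. Qed.

Lemma zsum_shift f n : zsum (fun d => f (d + 1)%Z) n
  = (zsum f n + f (Z.of_nat n + 1)%Z - f (- Z.of_nat n)%Z)%C.
Proof.
  induction n; [simpl; ring|]. cbn [zsum]. rewrite IHn.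
  replace (- Z.of_nat (S n) + 1)%Z with (- Z.of_nat n)%Z by lia.
  replace (Z.of_nat n + 1)%Z with (Z.of_nat (S n)) by lia. ring.
Qed.

(** The odd numbers 2d + 1 with |d| <= n reach 2n + 1, one beyond the range. *)
Lemma zsum_even_odd f n : zsum f (2 * n) =
  (zsum (fun d => f (2 * d)%Z) n + zsum (fun d => f (2 * d + 1)%Z) n - f (2 * Z.of_nat n + 1)%Z)%C.
Proof.
  induction n; [simpl; ring|].
  replace (2 * S n)%nat with (S (S (2 * n))) by lia. cbn [zsum]. rewrite IHn.
  replace (Z.of_nat (S (2 * n))) with (2 * Z.of_nat n + 1)%Z by lia.
  replace (Z.of_nat (S (S (2 * n)))) with (2 * Z.of_nat (S n))%Z by lia.
  replace (2 * (- Z.of_nat (S n)))%Z with (- (2 * Z.of_nat (S n)))%Z by lia.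
  replace (- (2 * Z.of_nat n + 1))%Z with (- (2 * Z.of_nat (S n)) + 1)%Z by lia. ring.
Qed.

Lemma zsum_Cmod f n : Cmod (zsum f n)
  <= Cmod (f 0%Z) + rsum (fun i => Cmod (f (Z.of_nat (S i))) + Cmod (f (- Z.of_nat (S i))%Z)) n.
Proof.
  induction n; [simpl; lra|]. cbn [zsum rsum].
  eapply Rle_trans; [apply Cmod_triangle|].
  pose proof (Cmod_triangle (f (Z.of_nat (S n))) (f (- Z.of_nat (S n))%Z)). lra.
Qed.

Lemma zsum_psum f n : zsum f n
  = (f 0%Z + psum (fun i => f (Z.of_nat (S i)) + f (- Z.of_nat (S i))%Z) n)%C.
Proof. induction n; [simpl; ring|]. cbn [zsum psum]. rewrite IHn. ring. Qed.

Definition zval (f : Z -> C) : C := Clim_val (zsum f).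

Lemma zsum_lim f : summable (fun i => Cmod (f (Z.of_nat (S i)) + f (- Z.of_nat (S i))%Z)) ->
  Clim (zsum f) (zval f).
Proof.
  intros H. destruct (summable_ex_Cser _ H) as [l Hl].
  assert (L : Clim (zsum f) (f 0%Z + l)%C).
  { eapply Clim_ext; [intros n; symmetry; apply zsum_psum|].
    apply Clim_plus; [apply Clim_const|exact Hl]. }
  unfold zval. rewrite (Clim_val_eq _ _ L). exact L.
Qed.

Lemma summable_eventually (x y : nat -> R) N : (forall n, 0 <= y n) ->
  (forall n, (N <= n)%nat -> x n <= y n) -> summable y -> summable x.
Proof.
  intros Hy H [B HB]. exists (rsum (fun i => Rabs (x i)) N + B). intros n.
  assert (E : forall m, 0 <= rsum (fun i => Rabs (x i)) m)
    by (intros; apply rsum_pos; intros; apply Rabs_pos).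
  apply Rle_trans with (rsum (fun i => Rabs (x i)) N + rsum y n); [|specialize (HB n); lra].
  induction n; simpl; [specialize (E N); lra|].
  destruct (Nat.le_gt_cases N n) as [h|h]; [specialize (H n h); lra|].
  assert (rsum x (S n) <= rsum (fun i => Rabs (x i)) N).
  { apply Rle_trans with (rsum (fun i => Rabs (x i)) (S n)).
    - apply rsum_le. intros; apply Rle_abs.
    - apply rsum_mono; [intros; apply Rabs_pos|lia]. }
  pose proof (rsum_pos y (S n) (fun i _ => Hy i)). simpl in H0, H1. lra.
Qed.

Lemma rsum_inv_sq n : rsum (fun i => / (INR (S i) * INR (S i))) n <= 2.
Proof.
  assert (H : rsum (fun i => / (INR (S i) * INR (S i))) (S n) <= 2 - / INR (S n)).
  { induction n; [simpl; lra|].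
    change (rsum (fun i => / (INR (S i) * INR (S i))) (S n) + / (INR (S (S n)) * INR (S (S n)))
      <= 2 - / INR (S (S n))).
    rewrite (S_INR (S n)). assert (0 < INR (S n)) by (apply lt_0_INR; lia).
    set (a := INR (S n)) in *.
    assert (/ ((a + 1) * (a + 1)) <= / a - / (a + 1)).
    { replace (/ a - / (a + 1)) with (/ (a * (a + 1))) by (field; lra).
      apply Rinv_le_contravar; nra. }
    lra. }
  eapply Rle_trans; [apply (rsum_mono _ n (S n))|].
  - intros i. apply Rlt_le, Rinv_0_lt_compat. assert (0 < INR (S i)) by (apply lt_0_INR; lia). nra.
  - lia.
  - assert (0 < / INR (S n)) by (apply Rinv_0_lt_compat, lt_0_INR; lia). lra.
Qed.

Lemma summable_inv_sq c : 0 <= c -> summable (fun i => c * / (INR (S i) * INR (S i))).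
Proof. intros Hc. apply summable_scal; auto. exists 2. apply rsum_inv_sq. Qed.

(** A positive distance from the integers, which gives bounds uniform in d and is stable under
    integer shifts and under halving. *)
Definition sep (z : C) : Prop :=
  exists delta : R, 0 < delta /\ forall d : Z, delta <= Cmod (z + IZR d).

Lemma sep_neq0 z (d : Z) : sep z -> (z + IZR d)%C <> 0%C.
Proof. intros [e [He H]] E. specialize (H d). rewrite E, Cmod_0 in H. lra. Qed.

Lemma sep_shift z (k : Z) : sep z -> sep (z + IZR k)%C.
Proof.
  intros [e [He H]]. exists e. split; auto. intros d.
  replace (z + IZR k + IZR d)%C with (z + IZR (k + d)%Z)%C; auto.
  rewrite plus_IZR, RtoC_plus. ring.
Qed.

Lemma sep_half z : sep z -> sep (z / 2)%C.
Proof.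
  intros [e [He H]]. exists (e / 2). split; [lra|]. intros d.
  replace (z / 2 + IZR d)%C with (/ 2 * (z + IZR (2 * d)%Z))%C.
  - rewrite Cmod_mult, <- RtoC_inv, Cmod_R, Rabs_pos_eq by lra. specialize (H (2 * d)%Z). lra.
  - rewrite mult_IZR, RtoC_mult. field.
Qed.

Lemma sep_Im z : Im z <> 0 -> sep z.
Proof.
  intros H. exists (Rabs (Im z)). split; [apply Rabs_pos_lt; auto|]. intros d.
  replace (Im z) with (Im (z + IZR d)%C); [apply Cmod_Im_le|].
  destruct z; unfold Cplus, RtoC; simpl; ring.
Qed.

Lemma sep_Re_half z : Re z = / 2 -> sep z.
Proof.
  intros H. exists (/ 2). split; [lra|]. intros d.
  eapply Rle_trans; [|apply re_le_Cmod].
  replace (Re (z + IZR d)%C) with (/ 2 + IZR d) by (destruct z; unfold Cplus, RtoC; simpl in *; lra).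
  destruct (Z_lt_le_dec d 0) as [h|h].
  - assert (IZR d <= -1) by (apply IZR_le; lia). rewrite Rabs_left; lra.
  - assert (0 <= IZR d) by (apply IZR_le; lia). rewrite Rabs_pos_eq; lra.
Qed.

Lemma INR_large (x : R) : exists N : nat, forall n, (N <= n)%nat -> x <= INR n.
Proof.
  destruct (INR_unbounded x) as [N h]. exists N. intros n Hn. apply le_INR in Hn. lra.
Qed.

Lemma IZR_of_nat (n : nat) : IZR (Z.of_nat n) = INR n.
Proof. symmetry. apply INR_IZR_INZ. Qed.

Lemma Cmod_add_nat_ge (z : C) n : INR n - Cmod z <= Cmod (z + IZR (Z.of_nat n)).
Proof.
  rewrite IZR_of_nat.
  pose proof (Cmod_sub_ge (RtoC (INR n)) (- z)%C) as H.
  rewrite Cmod_opp, Cmod_R, (Rabs_pos_eq (INR n)) in H by apply pos_INR.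
  replace (RtoC (INR n) - - z)%C with (z + INR n)%C in H by ring. lra.
Qed.

Lemma Cmod_add_neg_nat_ge (z : C) n : INR n - Cmod z <= Cmod (z + IZR (- Z.of_nat n)).
Proof.
  rewrite opp_IZR, IZR_of_nat, RtoC_opp.
  pose proof (Cmod_sub_ge (RtoC (INR n)) z) as H.
  rewrite Cmod_R, (Rabs_pos_eq (INR n)) in H by apply pos_INR.
  rewrite Cmod_sub_sym in H. exact H.
Qed.

Lemma sq_summable (z : C) : sep z ->
  summable (fun i => Cmod (/ ((z + IZR (Z.of_nat (S i))) * (z + IZR (Z.of_nat (S i)))))
     + Cmod (/ ((z + IZR (- Z.of_nat (S i))) * (z + IZR (- Z.of_nat (S i)))))).
Proof.
  (* From here on |z + n| and |z - n| are at least n/2, so each of the two terms is at most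
     4/n^2. *)
  intros Hz. destruct (INR_large (2 * Cmod z)) as [N HN].
  apply summable_eventually with (fun i => 8 * / (INR (S i) * INR (S i))) N.
  - intros n. assert (0 < INR (S n)) by (apply lt_0_INR; lia).
    apply Rmult_le_pos; [lra|]. apply Rlt_le, Rinv_0_lt_compat. nra.
  - intros n Hn. specialize (HN (S n) ltac:(lia)).
    assert (H0 : 0 < INR (S n)) by (apply lt_0_INR; lia).
    assert (Q : forall w : C, w <> 0%C -> INR (S n) / 2 <= Cmod w ->
       Cmod (/ (w * w)) <= 4 * / (INR (S n) * INR (S n))).
    { intros w Hw0 Hw. rewrite Cmod_inv by (apply Cmult_neq_0; auto).
      rewrite Cmod_mult.
      replace (4 * / (INR (S n) * INR (S n))) with (/ (INR (S n) / 2 * (INR (S n) / 2))) by (field; lra).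
      apply Rinv_le_contravar; [nra|]. apply Rmult_le_compat; lra. }
    pose proof (Q _ (sep_neq0 z (Z.of_nat (S n)) Hz)) as Q1.
    pose proof (Q _ (sep_neq0 z (- Z.of_nat (S n)) Hz)) as Q2.
    pose proof (Cmod_add_nat_ge z (S n)). pose proof (Cmod_add_neg_nat_ge z (S n)).
    specialize (Q1 ltac:(lra)). specialize (Q2 ltac:(lra)). lra.
  - apply summable_inv_sq. lra.
Qed.

Definition sqterm (z : C) (d : Z) : C := (/ ((z + IZR d) * (z + IZR d)))%C.
Definition sqsum (z : C) : C := zval (sqterm z).

Lemma sqsum_lim z : sep z -> Clim (zsum (sqterm z)) (sqsum z).
Proof.
  intros Hz. apply zsum_lim. eapply summable_le; [|apply (sq_summable z Hz)].
  intros n. apply Cmod_triangle.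
Qed.

Lemma Cinv_far_lim (z : C) (k : nat -> Z) : sep z ->
  (forall n, INR n - Cmod z <= Cmod (z + IZR (k n))) ->
  Clim (fun n => / (z + IZR (k n)))%C 0%C.
Proof.
  intros Hz Hk eps He. destruct (INR_large (Cmod z + 1 + / eps)) as [N HN]. exists N.
  intros n Hn. specialize (HN n Hn). specialize (Hk n).
  replace (/ (z + IZR (k n)) - 0)%C with (/ (z + IZR (k n)))%C by ring.
  rewrite Cmod_inv by (apply sep_neq0; auto).
  rewrite <- (Rinv_inv eps). assert (0 < / eps) by (apply Rinv_0_lt_compat; auto).
  apply Rinv_lt_contravar; [apply Rmult_lt_0_compat; lra|lra].
Qed.

Lemma Clim_mult0 u v : Clim u 0%C -> Clim v 0%C -> Clim (fun n => u n * v n)%C 0%C.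
Proof.
  intros Hu Hv eps He. destruct (Hu (Rmin eps 1)) as [N1 h1]; [apply Rmin_glb_lt; lra|].
  destruct (Hv 1 ltac:(lra)) as [N2 h2]. exists (max N1 N2). intros n Hn.
  specialize (h1 n ltac:(lia)). specialize (h2 n ltac:(lia)).
  replace (u n - 0)%C with (u n) in h1 by ring. replace (v n - 0)%C with (v n) in h2 by ring.
  replace (u n * v n - 0)%C with (u n * v n)%C by ring. rewrite Cmod_mult.
  pose proof (Rmin_l eps 1). pose proof (Cmod_ge_0 (u n)). pose proof (Cmod_ge_0 (v n)). nra.
Qed.

Lemma sqterm_far_lim (z : C) (k : nat -> Z) : sep z ->
  (forall n, INR n - Cmod z <= Cmod (z + IZR (k n))) -> Clim (fun n => sqterm z (k n)) 0%C.
Proof.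
  intros Hz Hk. pose proof (Cinv_far_lim z k Hz Hk) as H.
  eapply Clim_ext; [|apply (Clim_mult0 _ _ H H)]. intros n. cbv beta. unfold sqterm.
  field. apply sep_neq0; auto.
Qed.

Lemma sqsum_periodic z : sep z -> sqsum (z + 1)%C = sqsum z.
Proof.
  intros Hz.
  assert (H1 : Clim (zsum (sqterm (z + 1)%C)) (sqsum z + 0 - 0)%C).
  { eapply Clim_ext; [|apply Clim_minus; [apply Clim_plus; [apply sqsum_lim, Hz|]|]].
    - intros n. cbv beta. rewrite <- (zsum_shift (sqterm z)). apply zsum_ext. intros d.
      unfold sqterm. rewrite plus_IZR, RtoC_plus. f_equal. ring.
    - apply (sqterm_far_lim z (fun n => (Z.of_nat n + 1)%Z)); auto. intros n.
      pose proof (Cmod_add_nat_ge z (S n)). rewrite S_INR in H.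
      replace (Z.of_nat n + 1)%Z with (Z.of_nat (S n)) by lia. lra.
    - apply (sqterm_far_lim z (fun n => (- Z.of_nat n)%Z)); auto. intros n.
      apply Cmod_add_neg_nat_ge. }
  unfold sqsum at 1. unfold zval. rewrite (Clim_val_eq _ _ H1). ring.
Qed.

(** Clearing the factor 1/2 in z/2 + d and (z+1)/2 + d yields the even and the odd integers. *)
Lemma sqsum_duplication z : sep z -> (sqsum (z / 2) + sqsum ((z + 1) / 2))%C = (4 * sqsum z)%C.
Proof.
  intros Hz.
  assert (H2 : sep ((z + 1) / 2)%C) by (apply sep_half; apply (sep_shift z 1); auto).
  apply Clim_unique with (fun n => zsum (sqterm (z / 2)) n + zsum (sqterm ((z + 1) / 2)) n)%C.
  { apply Clim_plus; apply sqsum_lim; auto. apply sep_half; auto. }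
  replace (4 * sqsum z)%C with (4 * sqsum z + 4 * 0)%C by ring.
  eapply Clim_ext; [|apply Clim_plus; apply Clim_scal;
    [apply (Clim_subseq (zsum (sqterm z)) (sqsum z) (fun n => (2 * n)%nat)); [|apply sqsum_lim, Hz]; intros; lia|
     apply (sqterm_far_lim z (fun n => (2 * Z.of_nat n + 1)%Z)); auto]].
  - intros n. cbv beta. rewrite zsum_even_odd.
    rewrite (zsum_ext (sqterm (z / 2)) (fun d => 4 * sqterm z (2 * d))%C).
    2:{ intros d. unfold sqterm. rewrite mult_IZR, RtoC_mult.
        assert (N1 := sep_neq0 z (2 * d) Hz). rewrite mult_IZR, RtoC_mult in N1.
        replace (z / 2 + IZR d)%C with ((z + 2 * IZR d) / 2)%C by field.
        field. auto. }
    rewrite (zsum_ext (sqterm ((z + 1) / 2)) (fun d => 4 * sqterm z (2 * d + 1))%C).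
    2:{ intros d. unfold sqterm. rewrite plus_IZR, mult_IZR, RtoC_plus, RtoC_mult.
        assert (N1 := sep_neq0 z (2 * d + 1) Hz). rewrite plus_IZR, mult_IZR, RtoC_plus, RtoC_mult in N1.
        replace ((z + 1) / 2 + IZR d)%C with ((z + (2 * IZR d + 1)) / 2)%C by field.
        field. auto. }
    rewrite !zsum_scal. ring.
  - intros n. pose proof (Cmod_add_nat_ge z (2 * n + 1)).
    replace (2 * Z.of_nat n + 1)%Z with (Z.of_nat (2 * n + 1)) by lia.
    rewrite plus_INR, mult_INR in H. simpl INR in H. pose proof (pos_INR n). lra.
Qed.

(** * The squared cosecant *)

Definition e1 (z : C) : C := Cexp (2 * PI * Ci * z).

Lemma e1_add z w : e1 (z + w) = (e1 z * e1 w)%C.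
Proof. unfold e1. rewrite <- Cexp_add. f_equal. ring. Qed.

Lemma e1_neq0 z : e1 z <> 0%C.
Proof. apply Cexp_neq0. Qed.

Lemma e1_nat (n : nat) : e1 (INR n) = 1%C.
Proof.
  unfold e1. rewrite Cmult_comm, <- Cexp_pow, Cexp_2PI. apply Cpow_1_l.
Qed.

Lemma e1_IZR (k : Z) : e1 (IZR k) = 1%C.
Proof.
  destruct (Z_le_gt_dec 0 k) as [h|h].
  - rewrite <- (Z2Nat.id k h), IZR_of_nat. apply e1_nat.
  - pose proof (e1_add (IZR k) (IZR (- k))) as E.
    rewrite opp_IZR, RtoC_opp in E. replace (IZR k + - IZR k)%C with (RtoC (INR 0)) in E by (simpl; ring).
    rewrite e1_nat, <- RtoC_opp, <- opp_IZR in E.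
    rewrite <- (Z2Nat.id (- k)) in E by lia. rewrite IZR_of_nat, e1_nat in E.
    rewrite E. ring.
Qed.

Lemma Cmod_e1 z : Cmod (e1 z) = exp (- (2 * PI * Im z)).
Proof.
  unfold e1. rewrite Cmod_Cexp. f_equal. destruct z. unfold Cmult, RtoC, Ci. simpl. ring.
Qed.

Lemma e1_neq1 z : sep z -> e1 z <> 1%C.
Proof.
  intros Hz E. pose proof PI_RGT_0.
  assert (HI : Im z = 0).
  { assert (E2 : exp (- (2 * PI * Im z)) = exp 0).
    { rewrite <- Cmod_e1, E, Cmod_1, exp_0. auto. }
    apply exp_inv in E2. nra. }
  set (k := Int_part (Re z)). pose proof (base_Int_part (Re z)) as [B1 B2]. fold k in B1, B2.
  assert (Ez : (z = (Re z - IZR k)%R + IZR k)%C).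
  { destruct z as [x y]. simpl in *. subst y. unfold Cplus, RtoC. simpl. f_equal; ring. }
  rewrite Ez, e1_add, e1_IZR, Cmult_1_r in E.
  destruct (Req_dec (Re z - IZR k) 0) as [h|h].
  - rewrite h in Ez. apply (sep_neq0 z (- k)); auto. rewrite Ez, opp_IZR, RtoC_opp. ring.
  - apply (Cexp_2PI_neq1 (Re z - IZR k)); [lra|exact E].
Qed.

Lemma e1_half : e1 (/ 2) = (-1)%C.
Proof.
  unfold e1. replace (2 * PI * Ci * / 2)%C with (0, PI).
  - unfold Cexp. simpl. rewrite exp_0, cos_PI, sin_PI. unfold Cmult, RtoC. simpl. f_equal; ring.
  - rewrite <- RtoC_inv by lra. unfold Cmult, RtoC, Ci. simpl. f_equal; field.
Qed.

(* pi^2 / sin^2 (pi z) *)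
Definition csc2 (z : C) : C := (- (4 * PI * PI) * e1 z / ((1 - e1 z) * (1 - e1 z)))%C.

Lemma one_minus_e1 z : sep z -> (1 - e1 z)%C <> 0%C.
Proof.
  intros Hz E. apply (e1_neq1 z Hz). replace (e1 z) with (1 - (1 - e1 z))%C by ring.
  rewrite E. ring.
Qed.

Lemma csc2_duplication z : sep z -> (csc2 (z / 2) + csc2 ((z + 1) / 2))%C = (4 * csc2 z)%C.
Proof.
  intros Hz. unfold csc2.
  pose proof (one_minus_e1 _ (sep_half z Hz)) as N1.
  pose proof (one_minus_e1 _ (sep_half _ (sep_shift z 1 Hz))) as N2.
  pose proof (one_minus_e1 z Hz) as N3.
  replace ((z + IZR 1) / 2)%C with ((z + 1) / 2)%C in N2 by reflexivity.
  replace ((z + 1) / 2)%C with (z / 2 + / 2)%C in * by field.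
  replace (e1 z) with (e1 (z / 2) * e1 (z / 2))%C in *.
  2:{ rewrite <- e1_add. f_equal. field. }
  rewrite e1_add, e1_half in *. set (y := e1 (z / 2)) in *.
  replace (1 - y * -1)%C with (1 + y)%C in * by ring.
  replace (1 - y * y)%C with ((1 - y) * (1 + y))%C in * by ring.
  field. auto.
Qed.

Lemma csc2_periodic z : csc2 (z + 1) = csc2 z.
Proof.
  unfold csc2. rewrite e1_add. rewrite (e1_IZR 1), Cmult_1_r. reflexivity.
Qed.

(** Twice the hyperbolic sine; at pi i z it is 2i sin (pi z). *)
Definition exp_odd2 (v : C) : C := (Cexp v - Cexp (- v))%C.

Lemma csc2_exp_odd2 z : sep z ->
  exp_odd2 (PI * Ci * z) <> 0%C /\
  csc2 z = (- (4 * PI * PI) / (exp_odd2 (PI * Ci * z) * exp_odd2 (PI * Ci * z)))%C.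
Proof.
  intros Hz. pose proof (one_minus_e1 z Hz) as N. unfold csc2, exp_odd2. rewrite Cexp_opp.
  set (y := Cexp (PI * Ci * z)).
  assert (Hy : y <> 0%C) by apply Cexp_neq0.
  assert (E : e1 z = (y * y)%C).
  { unfold y, e1. rewrite <- Cexp_add. f_equal. ring. }
  rewrite E in *.
  assert (N2 : (y - / y)%C <> 0%C).
  { intros Z. apply N. replace (1 - y * y)%C with (- y * (y - / y))%C by (field; auto).
    rewrite Z. ring. }
  split; auto. replace (y - / y)%C with (- (1 - y * y) / y)%C by (field; auto).
  field. auto.
Qed.

(** [unshift 0 PS1] is the series q, so these are the coefficients 1/n! of the exponential function,
    used only through this recurrence. *)
Lemma exp_coef_rec n : (INR (S n) * exps (unshift 0 PS1) (S n))%C = exps (unshift 0 PS1) n.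
Proof.
  pose proof (exps_S (unshift 0 PS1) n) as E. unfold PSD at 1 in E. rewrite E.
  unfold conv. rewrite psum_first.
  rewrite (psum_ext _ (fun _ => 0%C)).
  - rewrite psum_0. unfold PSD, unshift, PS1. rewrite Nat.sub_0_r. simpl. ring.
  - intros i Hi. unfold PSD, unshift, PS1, unshift, PS0. ring.
Qed.

Lemma exp_coef_bound n : Cmod (exps (unshift 0 PS1) n) <= 1.
Proof.
  induction n.
  - rewrite exps_0. simpl. rewrite Cexp_0, Cmod_1. lra.
  - rewrite <- exp_coef_rec, Cmod_mult, Cmod_R, Rabs_pos_eq in IHn by apply pos_INR.
    rewrite S_INR in IHn. pose proof (pos_INR n).
    pose proof (Cmod_ge_0 (exps (unshift 0 PS1) (S n))). nra.
Qed.

Lemma Cexp_cubic u : Cmod u <= 1 / 4 ->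
  exists rho, Cexp u = (1 + u + u * u / 2 + u * u * u * rho)%C /\ Cmod rho <= 2.
Proof.
  intros Hu. set (e := exps (unshift 0 PS1)).
  assert (Hl : disc (unshift 0 PS1)) by apply disc_unshift, disc_1.
  assert (He : disc e) by apply disc_exps, Hl.
  assert (Hu1 : Cmod u < 1) by lra.
  assert (He1 : disc (fun n => e (S n))) by apply disc_shift, He.
  assert (He2 : disc (fun n => e (S (S n)))) by apply (disc_shift _ He1).
  assert (E : PS e u = Cexp u).
  { unfold e. rewrite PS_exps by auto. rewrite PS_unshift, PS_PS1 by auto using disc_1.
    f_equal. ring. }
  exists (PS (fun n => e (S (S (S n)))) u). split.
  - rewrite <- E, (PS_shift e), (PS_shift (fun n => e (S n))), (PS_shift (fun n => e (S (S n))))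
      by auto.
    pose proof (exp_coef_rec 0) as E0. pose proof (exp_coef_rec 1) as E1. fold e in E0, E1.
    assert (Ee : e O = 1%C) by (unfold e; rewrite exps_0; apply Cexp_0).
    simpl INR in E0, E1. rewrite Ee in *. rewrite Cmult_1_l in E0. rewrite E0 in *.
    assert (E2 : e 2%nat = (/ 2)%C).
    { replace (e 2%nat) with (/ 2 * ((1 + 1)%R * e 2%nat))%C.
      - rewrite E1. ring.
      - rewrite RtoC_plus. field. }
    rewrite E2. field.
  - apply PS_bound with (1 / 4); [auto|lra|apply (disc_shift _ He2)|].
    intros n. apply Rle_trans with (rsum (fun i => (1 / 4) ^ i) n).
    + apply rsum_le. intros i _. pose proof (exp_coef_bound (S (S (S i)))).
      pose proof (pow_le (1 / 4) i ltac:(lra)). fold e in H. nra.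
    + eapply Rle_trans; [apply rsum_geom; lra|]. lra.
Qed.

Lemma exp_odd2_near v : Cmod v <= 1 / 4 ->
  Cmod (2 * v - exp_odd2 v) <= 4 * (Cmod v * Cmod v * Cmod v).
Proof.
  intros Hv. destruct (Cexp_cubic v Hv) as [r1 [E1 B1]].
  destruct (Cexp_cubic (- v)%C) as [r2 [E2 B2]]; [rewrite Cmod_opp; auto|].
  unfold exp_odd2. rewrite E1, E2.
  match goal with |- Cmod ?x <= _ => replace x with (- (v * v * v * (r1 + r2)))%C by field end.
  rewrite Cmod_opp, !Cmod_mult.
  pose proof (Cmod_triangle r1 r2). pose proof (Cmod_ge_0 v).
  assert (0 <= Cmod v * Cmod v * Cmod v) by (repeat apply Rmult_le_pos; auto). nra.
Qed.

(** The strip is |Re z| <= 1/2 for v = pi i z. Either |Re v| >= 1/8 and one exponential dominates,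
    or |Im v| >= 1/8 and the sine in the imaginary part is bounded below. *)
Lemma exp_odd2_far : exists c, 0 < c /\ forall v, 1 / 4 <= Cmod v -> Rabs (Im v) <= PI / 2 ->
  c <= Cmod (exp_odd2 v).
Proof.
  assert (Hs : 0 < sin (1 / 8)).
  { apply sin_gt_0; [lra|]. pose proof PI2_3_2. lra. }
  exists (Rmin (1 / 8) (sin (1 / 8))). split; [apply Rmin_glb_lt; lra|].
  intros v Hv Ha.
  assert (Hp : forall w, 1 / 8 <= Re w -> 1 / 8 <= Cmod (exp_odd2 w)).
  { intros w Hw. unfold exp_odd2. pose proof (Cmod_sub_ge (Cexp w) (Cexp (- w))) as H.
    rewrite !Cmod_Cexp in H. replace (Re (- w)%C) with (- Re w) in H by (destruct w; reflexivity).
    pose proof (exp_ineq1_le (Re w)). assert (exp (- Re w) <= 1); [|lra].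
    rewrite <- exp_0. apply Rlt_le, exp_increasing. lra. }
  destruct (Rle_lt_dec (1 / 8) (Rabs (Re v))) as [h|h].
  - eapply Rle_trans; [apply Rmin_l|].
    destruct (Rle_lt_dec 0 (Re v)) as [h2|h2].
    + apply Hp. rewrite Rabs_pos_eq in h; auto.
    + replace (exp_odd2 v) with (- exp_odd2 (- v))%C.
      * rewrite Cmod_opp. apply Hp. rewrite Rabs_left in h by auto. destruct v; simpl in *; lra.
      * unfold exp_odd2. replace (- - v)%C with v by ring. ring.
  - eapply Rle_trans; [apply Rmin_r|].
    assert (h3 : 1 / 8 <= Rabs (Im v)) by (pose proof (Cmod_le_Re_Im v); lra).
    eapply Rle_trans; [|apply Cmod_Im_le].
    destruct v as [p a]. simpl in Ha, h, h3.
    assert (E : Im (exp_odd2 (p, a)) = (exp p + exp (- p)) * sin a).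
    { unfold exp_odd2, Cexp, Cmult, Cminus, Cplus, Copp, RtoC. simpl. rewrite cos_neg, sin_neg. ring. }
    rewrite E, Rabs_mult.
    assert (1 <= Rabs (exp p + exp (- p))).
    { pose proof (exp_pos p). pose proof (exp_pos (- p)). rewrite Rabs_pos_eq by lra.
      pose proof (exp_ineq1_le p). pose proof (exp_ineq1_le (- p)). lra. }
    assert (sin (1 / 8) <= Rabs (sin a)).
    { assert (K : forall b, 1 / 8 <= b <= PI / 2 -> sin (1 / 8) <= sin b).
      { intros b Hb. pose proof PI2_3_2. apply sin_incr_1; lra. }
      unfold Rabs in Ha, h3. destruct (Rcase_abs a).
      - specialize (K (- a) ltac:(lra)). rewrite sin_neg in K.
        pose proof (Rle_abs (- sin a)). rewrite Rabs_Ropp in H0. lra.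
      - specialize (K a ltac:(lra)). pose proof (Rle_abs (sin a)). lra. }
    nra.
Qed.

(** With v = pi i z and D = [exp_odd2 v] the difference is (2v - D)(2v + D) / (z^2 D^2). Near 0 the
    cubic smallness of 2v - D absorbs the double pole; away from 0 both terms are bounded. *)
Lemma csc2_near_bound : exists K, forall z, sep z -> Rabs (Re z) <= / 2 ->
  Cmod (csc2 z - / (z * z)) <= K.
Proof.
  destruct exp_odd2_far as [c [Hc Hfar]]. pose proof PI_RGT_0 as Hpi.
  exists (7 * PI * PI + (4 * PI * PI / (c * c) + 16 * PI * PI)). intros z Hz Hre.
  destruct (csc2_exp_odd2 z Hz) as [ND E]. set (v := (PI * Ci * z)%C) in *.
  assert (z0 : z <> 0%C).
  { replace z with (z + IZR 0)%C by ring. apply sep_neq0; auto. }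
  assert (Hzm : 0 < Cmod z) by (apply Cmod_gt_0; auto).
  assert (Hv : Cmod v = PI * Cmod z).
  { unfold v. rewrite !Cmod_mult, Cmod_R, Cmod_Ci, Rabs_pos_eq by lra. ring. }
  set (D := exp_odd2 v) in *.
  assert (HD : 0 < Cmod D) by (apply Cmod_gt_0; auto).
  assert (P1 : 0 <= 4 * PI * PI / (c * c)) by (apply Rlt_le, Rdiv_lt_0_compat; nra).
  assert (P2 : 0 < PI * PI) by nra.
  destruct (Rle_lt_dec (Cmod v) (1 / 4)) as [h|h].
  - pose proof (exp_odd2_near v h) as B. fold D in B.
    set (a := Cmod v) in *. assert (Ha0 : 0 < a) by (rewrite Hv; nra).
    assert (Ha3 : a * a * a <= a / 16) by nra.
    assert (B1 : a * (7 / 4) <= Cmod D).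
    { pose proof (Cmod_sub_ge (2 * v) D) as H. rewrite Cmod_mult, Cmod_R, Rabs_pos_eq in H by lra.
      fold a in H. lra. }
    assert (B2 : Cmod (2 * v + D) <= 5 * a).
    { replace (2 * v + D)%C with (4 * v - (2 * v - D))%C by ring.
      unfold Cminus at 1. eapply Rle_trans; [apply Cmod_triangle|].
      rewrite Cmod_opp, Cmod_mult, Cmod_R, Rabs_pos_eq by lra. fold a. lra. }
    replace (csc2 z - / (z * z))%C with (/ (z * z) * ((2 * v - D) * (2 * v + D)) * / (D * D))%C.
    2:{ rewrite E. unfold v.
        replace ((2 * (PI * Ci * z) - D) * (2 * (PI * Ci * z) + D))%C
          with (4 * PI * PI * (Ci * Ci) * (z * z) - D * D)%C by ring.
        replace (Ci * Ci)%C with (- RtoC 1)%C by (unfold Ci, Cmult, Copp, RtoC; simpl; f_equal; ring).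
        field. auto. }
    rewrite !Cmod_mult, !Cmod_inv, !Cmod_mult by (apply Cmult_neq_0; auto).
    apply Rle_trans with (7 * PI * PI); [|lra].
    replace (7 * PI * PI) with (/ (Cmod z * Cmod z) * (7 * (a * a))) by (rewrite Hv; field; lra).
    rewrite Rmult_assoc. apply Rmult_le_compat_l; [apply Rlt_le, Rinv_0_lt_compat; nra|].
    apply Rmult_le_reg_r with (Cmod D * Cmod D); [nra|].
    replace (Cmod (2 * v - D) * Cmod (2 * v + D) * / (Cmod D * Cmod D) * (Cmod D * Cmod D))
      with (Cmod (2 * v - D) * Cmod (2 * v + D)) by (field; lra).
    (* The constant 7 is chosen so that 4 * 5 <= 7 * (7/4)^2. *)
    apply Rle_trans with (4 * (a * a * a) * (5 * a)).
    + apply Rmult_le_compat; auto; apply Cmod_ge_0.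
    + apply Rle_trans with (7 * (a * a) * (a * (7 / 4) * (a * (7 / 4)))).
      * assert (0 <= a * a * (a * a)) by nra. nra.
      * apply Rmult_le_compat_l; [nra|]. apply Rmult_le_compat; nra.
  - assert (B : c <= Cmod D).
    { apply Hfar; [lra|]. unfold v.
      replace (Im (PI * Ci * z)%C) with (PI * Re z)
        by (destruct z; unfold Cmult, RtoC, Ci; simpl; ring).
      rewrite Rabs_mult, Rabs_pos_eq by lra. nra. }
    unfold Cminus. eapply Rle_trans; [apply Cmod_triangle|]. rewrite Cmod_opp.
    assert (B1 : Cmod (csc2 z) <= 4 * PI * PI / (c * c)).
    { rewrite E, Cmod_div by (apply Cmult_neq_0; auto).
      rewrite Cmod_opp, !Cmod_mult, !Cmod_R, !Rabs_pos_eq by lra.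
      apply Rmult_le_compat_l; [nra|]. apply Rinv_le_contravar; nra. }
    assert (B2 : Cmod (/ (z * z)) <= 16 * PI * PI).
    { rewrite Cmod_inv, Cmod_mult by (apply Cmult_neq_0; auto).
      replace (16 * PI * PI) with (/ (/ (4 * PI) * / (4 * PI))) by (field; lra).
      assert (/ (4 * PI) <= Cmod z).
      { apply Rmult_le_reg_l with PI; auto. rewrite <- Hv.
        replace (PI * / (4 * PI)) with (1 / 4) by (field; lra). lra. }
      assert (0 < / (4 * PI)) by (apply Rinv_0_lt_compat; lra).
      apply Rinv_le_contravar; nra. }
    nra.
Qed.

(** In this strip |z + n| and |z - n| are at least n/2 for every n >= 1, so a pair of terms is at
    most 8/n^2. *)
Lemma sqsum_near_bound z : sep z -> Rabs (Re z) <= / 2 -> Cmod (sqsum z - / (z * z)) <= 16.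
Proof.
  intros Hz Hre. apply (Clim_Cmod_le (fun n => zsum (sqterm z) n - / (z * z))%C).
  - apply Clim_minus; [apply sqsum_lim, Hz|apply Clim_const].
  - intros n. rewrite zsum_psum.
    replace (sqterm z 0) with (/ (z * z))%C by (unfold sqterm; f_equal; ring).
    match goal with |- Cmod (?a + ?b - ?a) <= _ => replace (a + b - a)%C with b by ring end.
    eapply Rle_trans; [apply psum_Cmod|].
    apply Rle_trans with (rsum (fun i => 8 * / (INR (S i) * INR (S i))) n).
    + apply rsum_le. intros i _.
      assert (H1 : 1 <= INR (S i)) by (rewrite S_INR; pose proof (pos_INR i); lra).
      assert (Q : forall k : Z, INR (S i) / 2 <= Cmod (z + IZR k) ->
         Cmod (sqterm z k) <= 4 * / (INR (S i) * INR (S i))).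
      { intros k Hk. unfold sqterm. pose proof (sep_neq0 z k Hz).
        rewrite Cmod_inv, Cmod_mult by (apply Cmult_neq_0; auto).
        replace (4 * / (INR (S i) * INR (S i))) with (/ (INR (S i) / 2 * (INR (S i) / 2))) by (field; lra).
        apply Rinv_le_contravar; [nra|]. apply Rmult_le_compat; lra. }
      eapply Rle_trans; [apply Cmod_triangle|].
      assert (A1 : INR (S i) / 2 <= Cmod (z + IZR (Z.of_nat (S i)))).
      { eapply Rle_trans; [|apply re_le_Cmod]. rewrite IZR_of_nat.
        replace (Re (z + INR (S i))%C) with (Re z + INR (S i)) by (destruct z; reflexivity).
        apply Rabs_le_between in Hre. rewrite Rabs_pos_eq; lra. }
      assert (A2 : INR (S i) / 2 <= Cmod (z + IZR (- Z.of_nat (S i)))).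
      { eapply Rle_trans; [|apply re_le_Cmod]. rewrite opp_IZR, IZR_of_nat.
        replace (Re (z + RtoC (- INR (S i)))%C) with (Re z - INR (S i)) by (destruct z; reflexivity).
        apply Rabs_le_between in Hre. rewrite Rabs_left1; lra. }
      pose proof (Q _ A1). pose proof (Q _ A2). lra.
    + rewrite rsum_scal. pose proof (rsum_inv_sq n). lra.
Qed.

Lemma sqsum_minus_csc2_periodic z (n : nat) : sep z ->
  (sqsum (z + INR n) - csc2 (z + INR n) = sqsum z - csc2 z)%C.
Proof.
  intros Hz. induction n.
  - simpl INR. replace (z + 0)%C with z by ring. reflexivity.
  - rewrite S_INR, RtoC_plus. replace (z + (INR n + 1))%C with (z + INR n + 1)%C by ring.
    rewrite sqsum_periodic, csc2_periodic; auto.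
    rewrite <- IZR_of_nat. apply sep_shift; auto.
Qed.

(** Both functions have period 1 and the same principal part at 0, so the bounds on the strip |Re z|
    <= 1/2 suffice. *)
Lemma sqsum_minus_csc2_bounded : exists K, forall z, sep z -> Cmod (sqsum z - csc2 z) <= K.
Proof.
  destruct csc2_near_bound as [K HK]. exists (16 + K).
  assert (Near : forall z, sep z -> Rabs (Re z) <= / 2 -> Cmod (sqsum z - csc2 z) <= 16 + K).
  { intros z Hz Hre. eapply Rle_trans; [apply (Cmod_triangle3 _ (/ (z * z)))|].
    pose proof (sqsum_near_bound z Hz Hre). specialize (HK z Hz Hre).
    rewrite (Cmod_sub_sym _ (csc2 z)). lra. }
  intros z Hz.
  set (k := Int_part (Re z + / 2)). pose proof (base_Int_part (Re z + / 2)) as [B1 B2].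
  fold k in B1, B2.
  assert (Hw : Rabs (Re (z + IZR (- k))%C) <= / 2).
  { replace (Re (z + IZR (- k))%C) with (Re z - IZR k)
      by (rewrite opp_IZR; destruct z; reflexivity).
    apply Rabs_le_between. lra. }
  pose proof (sep_shift z (- k) Hz) as Hs. specialize (Near _ Hs Hw).
  (* Periodicity is available for natural shifts, so a negative shift is read in the other
     direction. *)
  destruct (Z_le_gt_dec 0 k) as [h|h].
  - pose proof (sqsum_minus_csc2_periodic _ (Z.to_nat k) Hs) as E.
    rewrite <- IZR_of_nat, Z2Nat.id in E by lia.
    replace (z + IZR (- k) + IZR k)%C with z in E by (rewrite opp_IZR, RtoC_opp; ring).
    rewrite E. exact Near.
  - pose proof (sqsum_minus_csc2_periodic z (Z.to_nat (- k)) Hz) as E.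
    rewrite <- IZR_of_nat, Z2Nat.id in E by lia. rewrite <- E. exact Near.
Qed.

(* The difference h satisfies 4 h(z) = h(z/2) + h((z+1)/2), so a bound K on |h| improves to K/2. *)
Lemma sqsum_eq z : sep z -> sqsum z = csc2 z.
Proof.
  intros Hz. destruct sqsum_minus_csc2_bounded as [K HK].
  assert (H : forall n z, sep z -> Cmod (sqsum z - csc2 z) <= K * (/ 2) ^ n).
  { clear z Hz. induction n; intros z Hz; [simpl; rewrite Rmult_1_r; auto|].
    pose proof (sep_half z Hz) as H1. pose proof (sep_half _ (sep_shift z 1 Hz)) as H2.
    pose proof (IHn _ H1) as I1. pose proof (IHn _ H2) as I2.
    replace (sqsum z - csc2 z)%C with (/ 4 * ((sqsum (z / 2) - csc2 (z / 2))
       + (sqsum ((z + 1) / 2) - csc2 ((z + 1) / 2))))%C.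
    2:{ pose proof (sqsum_duplication z Hz) as E1. pose proof (csc2_duplication z Hz) as E2.
        set (a := sqsum (z / 2)) in *. set (b := sqsum ((z + 1) / 2)) in *.
        set (c := csc2 (z / 2)) in *. set (d := csc2 ((z + 1) / 2)) in *.
        replace (a - c + (b - d))%C with ((a + b) - (c + d))%C by ring.
        rewrite E1, E2. field. }
    rewrite Cmod_mult, <- RtoC_inv, Cmod_R, Rabs_pos_eq by lra.
    eapply Rle_trans; [apply Rmult_le_compat_l; [lra|apply Cmod_triangle]|].
    simpl pow. lra. }
  cut (sqsum z - csc2 z = 0)%C.
  { intros E. replace (sqsum z) with (sqsum z - csc2 z + csc2 z)%C by ring. rewrite E. ring. }
  apply Cmod_small_0. intros eps He.
  assert (HK0 : 0 <= K) by (eapply Rle_trans; [apply Cmod_ge_0|apply (HK z Hz)]).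
  destruct (pow_lt_1_zero (/ 2) ltac:(rewrite Rabs_pos_eq; lra) (eps / (K + 1))) as [N HN].
  { apply Rdiv_lt_0_compat; lra. }
  specialize (HN N (le_n N)). rewrite Rabs_pos_eq in HN by (apply pow_le; lra).
  eapply Rle_trans; [apply (H N z Hz)|].
  apply Rle_trans with ((K + 1) * (eps / (K + 1))).
  - apply Rmult_le_compat; try lra. apply pow_le; lra.
  - right. field. lra.
Qed.

(** * The value of zeta(2) *)

Definition zeta2 : C := Csum (fun n => / (INR (S n) * INR (S n)))%C.

Lemma zeta2_ser : Cser (fun n => / (INR (S n) * INR (S n)))%C zeta2.
Proof.
  apply Csum_ser. exists 2. intros n. eapply Rle_trans; [|apply (rsum_inv_sq n)].
  apply rsum_le. intros i _. assert (0 < INR (S i)) by (apply lt_0_INR; lia).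
  rewrite <- RtoC_mult, <- RtoC_inv by nra. rewrite Cmod_R, Rabs_pos_eq; [lra|].
  apply Rlt_le, Rinv_0_lt_compat. nra.
Qed.

Lemma RtoC_neq0 x : x <> 0 -> RtoC x <> 0%C.
Proof. intros H E. apply RtoC_inj in E. auto. Qed.

(* At z = 1/2 the partial fraction expansion evaluates the sum over the odd integers. *)
Lemma zeta2_eq : zeta2 = (PI * PI / 6)%C.
Proof.
  assert (Hz : sep (/ 2)%C) by (apply sep_Re_half; rewrite <- RtoC_inv by lra; reflexivity).
  pose proof (sqsum_lim _ Hz) as HL. rewrite (sqsum_eq _ Hz) in HL.
  assert (E0 : csc2 (/ 2) = (PI * PI)%C).
  { unfold csc2. rewrite e1_half. field. }
  rewrite E0 in HL.
  set (v := fun n => (/ (INR (S n) * INR (S n)))%C).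
  set (w := fun n : nat => (/ ((2 * INR n + 1) * (2 * INR n + 1)))%C).
  assert (Hnz : forall n : nat, (2 * INR n + 1)%C <> 0%C).
  { intros n. pose proof (pos_INR n). rewrite <- RtoC_mult, <- RtoC_plus. apply RtoC_neq0. lra. }
  assert (HS : forall n : nat, RtoC (INR (S n)) <> 0%C).
  { intros n. apply RtoC_neq0, not_0_INR. lia. }
  assert (EW : forall n, zsum (sqterm (/ 2)) n = (4 * (psum w (S n) + psum w n))%C).
  { induction n.
    - simpl. unfold sqterm, w. simpl INR. field.
    - cbn [zsum]. rewrite IHn. cbn [psum].
      assert (T1 : sqterm (/ 2) (Z.of_nat (S n)) = (4 * w (S n))%C).
      { unfold sqterm, w. rewrite IZR_of_nat.
        replace (/ 2 + INR (S n))%C with ((2 * INR (S n) + 1) / 2)%C by field.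
        field. apply Hnz. }
      assert (T2 : sqterm (/ 2) (- Z.of_nat (S n)) = (4 * w n)%C).
      { unfold sqterm, w. rewrite opp_IZR, IZR_of_nat, S_INR, RtoC_opp, RtoC_plus.
        replace (/ 2 + - (INR n + 1))%C with (- (2 * INR n + 1) / 2)%C by field.
        field. apply Hnz. }
      rewrite T1, T2. ring. }
  assert (EV : forall n, psum v (2 * n) = (/ 4 * psum v n + psum w n)%C).
  { induction n; [simpl; ring|]. replace (2 * S n)%nat with (S (S (2 * n))) by lia.
    cbn [psum]. rewrite IHn. unfold v, w.
    replace (INR (S (2 * n))) with (2 * INR n + 1) by (rewrite S_INR, mult_INR; simpl; ring).
    replace (INR (S (S (2 * n)))) with (2 * INR (S n)) by (rewrite !S_INR, mult_INR; simpl; ring).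
    rewrite !RtoC_plus, !RtoC_mult. field. auto. }
  pose proof zeta2_ser as Hv. fold v in Hv.
  assert (L1 : Clim (psum w) (zeta2 - / 4 * zeta2)%C).
  { eapply Clim_ext; [|apply Clim_minus;
      [apply (Clim_subseq (psum v) zeta2 (fun n => (2 * n)%nat)); [intros; lia|exact Hv]|
       apply (Clim_scal (/ 4)%C), Hv]].
    intros n. cbv beta. rewrite EV. ring. }
  assert (L2 : Clim (fun n => psum w (S n)) (zeta2 - / 4 * zeta2)%C).
  { apply (Clim_subseq (psum w) _ S); auto. }
  pose proof (Clim_scal 4%C _ _ (Clim_plus _ _ _ _ L2 L1)) as L3. cbv beta in L3.
  apply (Clim_ext _ _ _ EW) in HL. pose proof (Clim_unique _ _ _ HL L3) as E.
  rewrite E at 1. replace zeta2 with (4 * (zeta2 - / 4 * zeta2 + (zeta2 - / 4 * zeta2)) / 6)%C at 1 by field.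
  reflexivity.
Qed.

(** * The cotangent series *)

Definition invterm (z : C) (d : Z) : C := (/ (z + IZR d))%C.
Definition cotsum (z : C) : C := zval (invterm z).

Lemma cotsum_lim z : sep z -> Clim (zsum (invterm z)) (cotsum z).
Proof.
  intros Hz. apply zsum_lim. destruct (INR_large (2 * Cmod z)) as [N HN].
  apply summable_eventually with (fun i => (8 * Cmod z) * / (INR (S i) * INR (S i))) N.
  - intros n. assert (0 < INR (S n)) by (apply lt_0_INR; lia). pose proof (Cmod_ge_0 z).
    apply Rmult_le_pos; [lra|]. apply Rlt_le, Rinv_0_lt_compat. nra.
  - intros n Hn. specialize (HN (S n) ltac:(lia)).
    assert (H0 : 0 < INR (S n)) by (apply lt_0_INR; lia).
    pose proof (sep_neq0 z (Z.of_nat (S n)) Hz) as N1.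
    pose proof (sep_neq0 z (- Z.of_nat (S n)) Hz) as N2.
    pose proof (Cmod_add_nat_ge z (S n)). pose proof (Cmod_add_neg_nat_ge z (S n)).
    unfold invterm.
    replace (/ (z + IZR (Z.of_nat (S n))) + / (z + IZR (- Z.of_nat (S n))))%C
      with (2 * z * / ((z + IZR (Z.of_nat (S n))) * (z + IZR (- Z.of_nat (S n)))))%C.
    2:{ rewrite opp_IZR, RtoC_opp in *. field. auto. }
    rewrite !Cmod_mult, Cmod_inv, Cmod_mult, Cmod_R, Rabs_pos_eq by (try apply Cmult_neq_0; auto; lra).
    replace (8 * Cmod z * / (INR (S n) * INR (S n)))
      with (2 * Cmod z * / (INR (S n) / 2 * (INR (S n) / 2))) by (field; lra).
    apply Rmult_le_compat_l; [pose proof (Cmod_ge_0 z); lra|].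
    apply Rinv_le_contravar; [nra|]. apply Rmult_le_compat; lra.
  - pose proof (Cmod_ge_0 z). apply summable_inv_sq. lra.
Qed.

Lemma zsum_sq_bounded z : sep z -> exists K, forall n,
  Cmod (sqterm z 0) + rsum (fun i => Cmod (sqterm z (Z.of_nat (S i))) + Cmod (sqterm z (- Z.of_nat (S i)))) n <= K.
Proof.
  intros Hz. destruct (sq_summable z Hz) as [B HB]. exists (Cmod (sqterm z 0) + B).
  intros n. specialize (HB n). unfold sqterm. lra.
Qed.

(** Termwise the remainder is (w - z)^2 / ((w + d)(z + d)^2). Close to z the factor 1/(w + d) is
    bounded uniformly in d, and the rest is summable. *)
Lemma cotsum_der z : sep z -> Cder cotsum z (- sqsum z)%C.
Proof.
  intros Hz. destruct (zsum_sq_bounded z Hz) as [K HK]. pose proof Hz as [e [He Hs]].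
  assert (Hw : forall w, Cmod (w - z) < e / 2 -> forall d : Z, e / 2 <= Cmod (w + IZR d)).
  { intros w Hw d. specialize (Hs d).
    pose proof (Cmod_sub_ge (z + IZR d) (z - w)) as H.
    replace (z + IZR d - (z - w))%C with (w + IZR d)%C in H by ring.
    rewrite Cmod_sub_sym in Hw. lra. }
  apply Cder_quad with (2 / e * K) (e / 2); [lra|]. intros w Hwz.
  assert (Sw : sep w) by (exists (e / 2); split; [lra|auto]).
  apply (Clim_Cmod_le (fun n => zsum (invterm w) n - zsum (invterm z) n - (w - z) * (- zsum (sqterm z) n))%C).
  - apply Clim_minus; [apply Clim_minus; apply cotsum_lim; auto|].
    apply Clim_scal, Clim_opp, sqsum_lim, Hz.
  - intros n. set (d2 := Cmod (w - z) * Cmod (w - z)).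
    assert (Hd2 : 0 <= d2) by (pose proof (Cmod_ge_0 (w - z)); unfold d2; nra).
    replace (zsum (invterm w) n - zsum (invterm z) n - (w - z) * (- zsum (sqterm z) n))%C
      with (zsum (fun d => (w - z) * (w - z) * (invterm w d * sqterm z d))%C n).
    2:{ rewrite (zsum_ext _ (fun d => invterm w d + ((-1) * invterm z d + (w - z) * sqterm z d))%C).
        - rewrite zsum_plus, zsum_plus, !zsum_scal. ring.
        - intros d. unfold invterm, sqterm.
          pose proof (sep_neq0 w d Sw). pose proof (sep_neq0 z d Hz). field. auto. }
    rewrite (zsum_scal ((w - z) * (w - z))%C), !Cmod_mult. fold d2. rewrite Rmult_comm.
    apply Rmult_le_compat_r; auto.
    assert (Hi : forall d, Cmod (invterm w d * sqterm z d) <= 2 / e * Cmod (sqterm z d)).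
    { intros d. rewrite Cmod_mult. apply Rmult_le_compat_r; [apply Cmod_ge_0|].
      unfold invterm. rewrite Cmod_inv by (apply sep_neq0; auto).
      replace (2 / e) with (/ (e / 2)) by (field; lra). apply Rinv_le_contravar; [lra|auto]. }
    eapply Rle_trans; [apply zsum_Cmod|].
    eapply Rle_trans; [|apply Rmult_le_compat_l; [apply Rlt_le, Rdiv_lt_0_compat; lra|apply (HK n)]].
    rewrite Rmult_plus_distr_l, <- rsum_scal. apply Rplus_le_compat; [apply Hi|].
    apply rsum_le. intros i _. rewrite Rmult_plus_distr_l. apply Rplus_le_compat; apply Hi.
Qed.

Definition cotpi (z : C) : C := (PI * Ci * ((e1 z + 1) / (e1 z - 1)))%C.

Lemma cotpi_der z : sep z -> Cder cotpi z (- csc2 z)%C.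
Proof.
  intros Hz. pose proof (one_minus_e1 z Hz) as N.
  assert (N2 : (e1 z - 1)%C <> 0%C).
  { intros E. apply N. replace (1 - e1 z)%C with (- (e1 z - 1))%C by ring. rewrite E. ring. }
  assert (D : Cder e1 z (2 * PI * Ci * e1 z)%C).
  { eapply Cder_eq; [|apply (Cder_comp Cexp (fun w => 2 * PI * Ci * w)%C);
      [apply Cder_scal, Cder_id|apply Cder_Cexp]]. unfold e1. ring. }
  eapply Cder_ext; [|eapply Cder_eq; [|apply (Cder_scal (PI * Ci)%C);
     apply (Cder_mult (fun w => e1 w + 1)%C (fun w => / (e1 w - 1))%C);
     [apply Cder_plus; [apply D|apply Cder_const]|
      apply (Cder_comp (fun u => / u)%C (fun w => e1 w - 1)%C);
       [apply Cder_plus; [apply D|apply Cder_const]|apply Cder_inv; exact N2]]]].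
  - intros w. unfold cotpi, Cdiv. reflexivity.
  - unfold csc2. replace (Ci * Ci)%C with (- RtoC 1)%C by (unfold Ci, Cmult, Copp, RtoC; simpl; f_equal; ring).
    match goal with |- ?l = _ => replace l with
      (- (4 * PI * PI * (Ci * Ci)) * e1 z / ((e1 z - 1) * (e1 z - 1)))%C by (field; auto) end.
    replace (Ci * Ci)%C with (- RtoC 1)%C by (unfold Ci, Cmult, Copp, RtoC; simpl; f_equal; ring).
    field. auto.
Qed.

(** At 1/2 the symmetric partial sums collapse to 1/(n + 1/2). *)
Lemma cotsum_half : cotsum (/ 2) = 0%C.
Proof.
  assert (Hz : sep (/ 2)%C) by (apply sep_Re_half; rewrite <- RtoC_inv by lra; reflexivity).
  assert (Hp : forall n : nat, (/ 2 + INR n)%C <> 0%C).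
  { intros n. pose proof (pos_INR n). rewrite <- RtoC_inv, <- RtoC_plus by lra. apply RtoC_neq0. lra. }
  assert (E : forall n, zsum (invterm (/ 2)) n = (/ (/ 2 + IZR (Z.of_nat n)))%C).
  { induction n; [reflexivity|]. cbn [zsum]. rewrite IHn. unfold invterm.
    rewrite opp_IZR, !IZR_of_nat, RtoC_opp.
    replace (/ 2 + - INR (S n))%C with (- (/ 2 + INR n))%C
      by (rewrite S_INR, RtoC_plus; field).
    pose proof (Hp n). pose proof (Hp (S n)).
    set (x := (/ 2 + INR n)%C) in *. set (y := (/ 2 + INR (S n))%C) in *. field. auto. }
  apply (Clim_unique (zsum (invterm (/ 2)))); [apply cotsum_lim, Hz|].
  eapply Clim_ext; [intros n; symmetry; apply E|].
  apply (Cinv_far_lim (/ 2) Z.of_nat Hz). intros n. apply Cmod_add_nat_ge.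
Qed.

(** Both sides have derivative [- csc2] and vanish at 1/2. The path from 1/2 to z first goes
    straight down to 1/2 - i and then stays in the lower half plane, so it avoids the poles. *)
Lemma cotsum_eq z : Im z < 0 -> cotsum z = cotpi z.
Proof.
  intros Hz. set (g := fun w => (cotpi w - cotsum w)%C).
  assert (Dg : forall w, sep w -> Cder g w 0%C).
  { intros w Hw. unfold g. eapply Cder_ext; [|eapply Cder_eq; [|
      apply (Cder_plus _ _ _ _ _ (cotpi_der w Hw) (Cder_scal (-1)%C _ _ _ (cotsum_der w Hw)))]].
    - intros u. simpl. ring.
    - rewrite sqsum_eq by auto. ring. }
  assert (Re2 : Re (/ 2)%C = / 2 /\ Im (/ 2)%C = 0)
    by (rewrite <- RtoC_inv by lra; split; reflexivity).
  destruct Re2 as [R2 I2].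
  assert (E1 : g (/ 2)%C = g (/ 2 - Ci)%C).
  { apply Cder_zero_const. intros t Ht. apply Dg, sep_Re_half.
    rewrite <- R2. generalize (/ 2)%C. intros [x y].
    unfold Cplus, Cminus, Copp, Cmult, RtoC, Ci. simpl. ring. }
  assert (E2 : g (/ 2 - Ci)%C = g z).
  { apply Cder_zero_const. intros t Ht. apply Dg, sep_Im.
    replace (Im (/ 2 - Ci + t * (z - (/ 2 - Ci)))%C) with (- (1 - t) + t * Im z); [nra|].
    revert I2. generalize (/ 2)%C. intros [x y]. simpl. intros ->. destruct z as [a b].
    unfold Cplus, Cminus, Copp, Cmult, RtoC, Ci. simpl. ring. }
  assert (E3 : g (/ 2)%C = 0%C).
  { unfold g. rewrite cotsum_half. unfold cotpi. rewrite e1_half. field. }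
  rewrite E1, E2 in E3. unfold g in E3.
  replace (cotsum z) with (cotpi z - (cotpi z - cotsum z))%C by ring. rewrite E3. ring.
Qed.

(** * The transformation of eta *)

Lemma Ci_sqr : (Ci * Ci)%C = (- RtoC 1)%C.
Proof. unfold Ci, Cmult, Copp, RtoC. simpl. f_equal; ring. Qed.

Lemma qh1_e1 tau : qh 1 tau = e1 tau.
Proof. unfold qh, e1. f_equal. simpl INR. field. Qed.

Lemma upper_neq0 tau : upper tau -> tau <> 0%C.
Proof. unfold upper. intros H E. rewrite E in H. simpl in H. lra. Qed.

Lemma upper_inv tau : upper tau -> upper (- / tau)%C.
Proof.
  unfold upper. intros H. destruct tau as [x y]. simpl in *.
  replace (- (- y / (x * (x * 1) + y * (y * 1)))) with (y / (x * x + y * y)) by (field; nra).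
  apply Rdiv_lt_0_compat; nra.
Qed.

Lemma upper_scal (r : R) tau : 0 < r -> upper tau -> upper (r * tau)%C.
Proof.
  unfold upper. intros Hr H. destruct tau as [x y]. simpl in *. nra.
Qed.

Lemma upper_sep tau : upper tau -> sep tau.
Proof. intros H. apply sep_Im. unfold upper in H. lra. Qed.

(** The imaginary part controls c, then the triangle inequality controls d. The bound is linear in
    |c| + |d|, which makes the tail estimates uniform in c. *)
Lemma lattice_lower tau : upper tau -> exists kappa, 0 < kappa /\
  forall (c : R) (d : Z), kappa * (Rabs c + Rabs (IZR d)) <= Cmod (c * tau + IZR d).
Proof.
  unfold upper. intros H. set (y := Im tau) in *. set (A := Cmod tau).
  assert (HA : 0 <= A) by apply Cmod_ge_0.
  assert (HK : 0 < 1 + (1 + A) / y).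
  { assert (0 < (1 + A) / y) by (apply Rdiv_lt_0_compat; lra). lra. }
  exists (/ (1 + (1 + A) / y)). split; [apply Rinv_0_lt_compat; auto|].
  intros c d. set (m := Cmod (c * tau + IZR d)).
  assert (H1 : Rabs c * y <= m).
  { unfold m. eapply Rle_trans; [|apply Cmod_Im_le].
    replace (Im (c * tau + IZR d)%C) with (c * y)
      by (unfold y; destruct tau; unfold Cplus, Cmult, RtoC; simpl; ring).
    rewrite Rabs_mult, (Rabs_pos_eq y); lra. }
  assert (H2 : Rabs (IZR d) <= m + Rabs c * A).
  { unfold m, A. rewrite <- !Cmod_R, <- Cmod_mult.
    replace (RtoC (IZR d)) with ((c * tau + IZR d) - c * tau)%C at 1 by ring.
    unfold Cminus. eapply Rle_trans; [apply Cmod_triangle|]. rewrite Cmod_opp. lra. }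
  assert (H3 : Rabs c <= m / y).
  { apply Rmult_le_reg_r with y; auto. replace (m / y * y) with m by (field; lra). auto. }
  apply Rmult_le_reg_l with (1 + (1 + A) / y); auto.
  rewrite <- Rmult_assoc, Rinv_r, Rmult_1_l by lra.
  replace ((1 + (1 + A) / y) * m) with (m / y + (m + m / y * A)) by (field; lra).
  assert (Rabs c * A <= m / y * A) by (apply Rmult_le_compat_r; auto). lra.
Qed.

(** What the part |d| > n of [sqsum z] becomes when each square 1/(z+d)^2 is replaced by a product
    of neighbours, which telescopes. *)
Definition telterm (z : C) (n : nat) : C := (/ (z + INR n) - / (z - INR n))%C.

(** Replacing a square by a product of neighbours costs only cubic terms. Their sum beyond N is of
    order (c + N)^(-2), still summable over c with a total of O(1/N). *)
Lemma sqsum_tail z kappa c N : sep z -> 0 < kappa -> 1 <= c -> (1 <= N)%nat ->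
  (forall d : Z, kappa * (c + Rabs (IZR d)) <= Cmod (z + IZR d)) ->
  Cmod (sqsum z - zsum (sqterm z) N - telterm z N)
    <= 4 / (kappa * kappa * kappa) * / ((c + INR N) * (c + INR N)).
Proof.
  intros Hz Hk Hc HN Hd.
  assert (HN1 : 1 <= INR N) by (apply (le_INR 1); auto).
  assert (K3 : 0 < kappa * kappa * kappa) by (repeat apply Rmult_lt_0_compat; auto).
  set (K := 4 / (kappa * kappa * kappa)).
  assert (HK : 0 < K) by (apply Rdiv_lt_0_compat; lra).
  assert (Hp : forall n : nat, (z + INR n)%C <> 0%C).
  { intros n. rewrite <- IZR_of_nat. apply sep_neq0; auto. }
  assert (Hm : forall n : nat, (z - INR n)%C <> 0%C).
  { intros n. replace (z - INR n)%C with (z + IZR (- Z.of_nat n))%C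
      by (rewrite opp_IZR, IZR_of_nat, RtoC_opp; ring). apply sep_neq0; auto. }
  assert (Bp : forall n : nat, kappa * (c + INR n) <= Cmod (z + INR n)).
  { intros n. specialize (Hd (Z.of_nat n)). rewrite IZR_of_nat, Rabs_pos_eq in Hd by apply pos_INR. auto. }
  assert (Bm : forall n : nat, kappa * (c + INR n) <= Cmod (z - INR n)).
  { intros n. specialize (Hd (- Z.of_nat n)%Z).
    rewrite opp_IZR, IZR_of_nat, Rabs_Ropp, Rabs_pos_eq, RtoC_opp in Hd by apply pos_INR. auto. }
  assert (cube : forall (a u v : C) (m : R), 0 < m -> kappa * m <= Cmod u -> kappa * (m / 2) <= Cmod v ->
     u <> 0%C -> v <> 0%C -> Cmod (/ (u * u * v)) <= K / 2 * / (m * m * m)).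
  { intros _ u v m Hm0 Hu Hv u0 v0.
    rewrite Cmod_inv, !Cmod_mult by (repeat apply Cmult_neq_0; auto).
    replace (K / 2 * / (m * m * m)) with (/ (kappa * m * (kappa * m) * (kappa * (m / 2))))
      by (unfold K; field; lra).
    assert (0 < kappa * m) by nra. assert (0 < kappa * (m / 2)) by nra.
    set (A := kappa * m) in *. set (B := kappa * (m / 2)) in *. clearbody A B.
    assert (0 < A * A) by nra. assert (A * A <= Cmod u * Cmod u) by nra.
    apply Rinv_le_contravar; [nra|]. apply Rmult_le_compat; lra. }
  (* The bound telescopes too, because 1/(a+1)^3 <= 1/a^2 - 1/(a+1)^2. *)
  assert (Hfin : forall M, Cmod (zsum (sqterm z) (N + M) - zsum (sqterm z) N - telterm z N + telterm z (N + M))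
     <= K * (/ ((c + INR N) * (c + INR N)) - / ((c + INR (N + M)) * (c + INR (N + M))))).
  { induction M.
    - rewrite Nat.add_0_r.
      replace (zsum (sqterm z) N - zsum (sqterm z) N - telterm z N + telterm z N)%C with (RtoC 0) by ring.
      rewrite Cmod_0. lra.
    - rewrite Nat.add_succ_r. cbn [zsum]. set (n := (N + M)%nat) in *.
      assert (En : INR (S n) = INR n + 1) by apply S_INR.
      assert (Hn1 : 1 <= INR n) by (eapply Rle_trans; [apply HN1|apply le_INR; lia]).
      set (a := c + INR n) in *. assert (Ea : c + INR (S n) = a + 1) by (unfold a; lra).
      assert (Ha : 2 <= a) by (unfold a; lra).
      pose proof (Hp n) as p0. pose proof (Hp (S n)) as p1. pose proof (Hm n) as m0. pose proof (Hm (S n)) as m1.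
      assert (I1 : Cmod (/ ((z + INR (S n)) * (z + INR (S n)) * (z + INR n))) <= K / 2 * / ((a + 1) * (a + 1) * (a + 1))).
      { apply (cube z); auto; [lra|rewrite <- Ea; apply Bp|].
        eapply Rle_trans; [|apply Bp]. fold a. apply Rmult_le_compat_l; lra. }
      assert (I2 : Cmod (/ ((z - INR (S n)) * (z - INR (S n)) * (z - INR n))) <= K / 2 * / ((a + 1) * (a + 1) * (a + 1))).
      { apply (cube z); auto; [lra|rewrite <- Ea; apply Bm|].
        eapply Rle_trans; [|apply Bm]. fold a. apply Rmult_le_compat_l; lra. }
      replace (zsum (sqterm z) n + (sqterm z (Z.of_nat (S n)) + sqterm z (- Z.of_nat (S n)))
         - zsum (sqterm z) N - telterm z N + telterm z (S n))%C
        with ((zsum (sqterm z) n - zsum (sqterm z) N - telterm z N + telterm z n)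
          + (/ ((z - INR (S n)) * (z - INR (S n)) * (z - INR n))
            - / ((z + INR (S n)) * (z + INR (S n)) * (z + INR n))))%C.
      2:{ unfold sqterm, telterm. rewrite opp_IZR, IZR_of_nat, RtoC_opp, En, RtoC_plus in *.
          replace (z + - (INR n + 1))%C with (z - (INR n + 1))%C by ring. field. repeat split; auto. }
      eapply Rle_trans; [apply Cmod_triangle|].
      eapply Rle_trans; [apply Rplus_le_compat; [apply IHM|unfold Cminus at 1; apply Cmod_triangle]|].
      rewrite Cmod_opp, Ea.
      assert (Hq : / ((a + 1) * (a + 1) * (a + 1)) <= / (a * a) - / ((a + 1) * (a + 1))).
      { replace (/ (a * a) - / ((a + 1) * (a + 1))) with ((2 * a + 1) / (a * a * ((a + 1) * (a + 1)))) by (field; lra).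
        apply Rmult_le_reg_r with (a * a * ((a + 1) * (a + 1) * (a + 1))); [repeat apply Rmult_lt_0_compat; lra|].
        replace (/ ((a + 1) * (a + 1) * (a + 1)) * (a * a * ((a + 1) * (a + 1) * (a + 1)))) with (a * a) by (field; lra).
        replace ((2 * a + 1) / (a * a * ((a + 1) * (a + 1))) * (a * a * ((a + 1) * (a + 1) * (a + 1))))
          with ((2 * a + 1) * (a + 1)) by (field; lra). nra. }
      assert (K * / ((a + 1) * (a + 1) * (a + 1)) <= K * (/ (a * a) - / ((a + 1) * (a + 1))))
        by (apply Rmult_le_compat_l; lra).
      lra. }
  apply (Clim_Cmod_le (fun M => zsum (sqterm z) (N + M) - zsum (sqterm z) N - telterm z N + telterm z (N + M))%C).
  - replace (sqsum z - zsum (sqterm z) N - telterm z N)%C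
      with (sqsum z - zsum (sqterm z) N - telterm z N + (0 - 0))%C by ring.
    apply Clim_plus; [apply Clim_minus; [apply Clim_minus|]|]; try apply Clim_const.
    + apply (Clim_subseq (zsum (sqterm z)) _ (fun M => (N + M)%nat)); [intros; lia|apply sqsum_lim, Hz].
    + unfold telterm. apply (Clim_subseq (fun n => / (z + INR n) - / (z - INR n))%C _ (fun M => (N + M)%nat)); [intros; lia|].
      apply Clim_minus.
      * eapply Clim_ext; [|apply (Cinv_far_lim z Z.of_nat Hz); intros n; apply Cmod_add_nat_ge].
        intros n. cbv beta. rewrite IZR_of_nat. reflexivity.
      * eapply Clim_ext; [|apply (Cinv_far_lim z (fun n => (- Z.of_nat n)%Z) Hz); intros n; apply Cmod_add_neg_nat_ge].
        intros n. cbv beta. rewrite opp_IZR, IZR_of_nat, RtoC_opp. reflexivity.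
  - intros M. eapply Rle_trans; [apply Hfin|]. apply Rmult_le_compat_l; [lra|].
    assert (0 < / ((c + INR (N + M)) * (c + INR (N + M)))); [|lra].
    apply Rinv_0_lt_compat. pose proof (pos_INR (N + M)). nra.
Qed.

Lemma rsum_shifted_inv_sq N n : (1 <= N)%nat ->
  rsum (fun i => / ((INR (S i) + INR N) * (INR (S i) + INR N))) n <= / INR N.
Proof.
  intros HN. assert (H1 : 1 <= INR N) by (apply (le_INR 1); auto).
  assert (H : rsum (fun i => / ((INR (S i) + INR N) * (INR (S i) + INR N))) n <= / INR N - / (INR n + INR N)).
  { induction n; [simpl rsum; simpl INR; rewrite Rplus_0_l; lra|].
    cbn [rsum]. rewrite S_INR. pose proof (pos_INR n). set (a := INR n + INR N) in *.
    replace (INR n + 1 + INR N) with (a + 1) by (unfold a; ring).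
    assert (Ha : 1 <= a) by (unfold a; lra).
    assert (/ ((a + 1) * (a + 1)) <= / a - / (a + 1)).
    { replace (/ a - / (a + 1)) with (/ (a * (a + 1))) by (field; lra).
      apply Rinv_le_contravar; nra. }
    lra. }
  assert (0 < / (INR n + INR N)) by (apply Rinv_0_lt_compat; pose proof (pos_INR n); lra). lra.
Qed.

(** Rows c >= 1 of the Eisenstein series of weight 2, summed over d first; [zeta2 + G2] is half of
    the full series. *)
Definition G2 (tau : C) : C := Csum (fun c => sqsum (INR (S c) * tau)%C).

Lemma G2_ser tau : upper tau -> Cser (fun c => sqsum (INR (S c) * tau)%C) (G2 tau)
  /\ G2 tau = (4 * PI * PI * (e1 tau * PS (PSD etalog) (e1 tau)))%C.
Proof.
  intros Ht. assert (Hq : Cmod (e1 tau) < 1).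
  { rewrite <- qh1_e1. apply Cmod_qh; auto. }
  assert (H : Cser (fun c => sqsum (INR (S c) * tau)%C)
     (4 * PI * PI * (e1 tau * PS (PSD etalog) (e1 tau)))%C).
  { replace (4 * PI * PI * (e1 tau * PS (PSD etalog) (e1 tau)))%C
      with (- (4 * PI * PI) * - (e1 tau * PS (PSD etalog) (e1 tau)))%C by ring.
    eapply Cser_ext; [|apply Cser_scal, etalog_der, Hq].
    intros n. cbv beta zeta.
    assert (Hs : sep (INR (S n) * tau)%C).
    { apply upper_sep, upper_scal; auto. apply lt_0_INR. lia. }
    rewrite sqsum_eq by auto. unfold csc2.
    replace (e1 (INR (S n) * tau)) with (e1 tau ^ S n)%C.
    - unfold Cdiv. ring.
    - unfold e1. rewrite Cexp_pow. f_equal. ring. }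
  pose proof (Csum_eq _ _ H) as E. unfold G2. rewrite E. auto.
Qed.

(** After division by tau the sum over c is the cotangent series at N / tau without its central
    term, which accounts for the 1/N. *)
Lemma telterm_ser tau N : upper tau -> (1 <= N)%nat ->
  Cser (fun c => telterm (INR (S c) * tau) N) (cotpi (INR N / tau) / tau - / INR N)%C.
Proof.
  intros Ht HN. assert (HN0 : 0 < INR N) by (apply lt_0_INR; lia).
  assert (t0 : tau <> 0%C) by (apply upper_neq0; auto).
  assert (N0 : RtoC (INR N) <> 0%C) by (apply RtoC_neq0; lra).
  assert (HI : Im (INR N / tau)%C < 0).
  { unfold Cdiv. pose proof (upper_scal (INR N) _ HN0 (upper_inv tau Ht)) as U. unfold upper in U.
    replace (INR N * / tau)%C with (- (INR N * - / tau))%C by ring. simpl in *. lra. }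
  assert (Hs : sep (INR N / tau)%C) by (apply sep_Im; lra).
  pose proof (cotsum_lim _ Hs) as HL. rewrite cotsum_eq in HL by auto.
  replace (cotpi (INR N / tau) / tau)%C with (/ tau * cotpi (INR N / tau))%C by (unfold Cdiv; ring).
  unfold Cser. eapply Clim_ext; [|apply Clim_minus; [apply (Clim_scal (/ tau)%C), HL|apply (Clim_const (/ INR N)%C)]].
  - intros n. cbv beta. rewrite zsum_psum, Cmult_plus_distr_l, <- psum_scal.
    replace (/ tau * invterm (INR N / tau) 0)%C with (/ INR N)%C.
    2:{ unfold invterm. replace (INR N / tau + 0)%C with (INR N / tau)%C by ring. field. auto. }
    match goal with |- (?a + ?b - ?a)%C = _ => replace (a + b - a)%C with b by ring end.
    apply psum_ext. intros i _. unfold invterm, telterm.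
    pose proof (sep_neq0 _ (Z.of_nat (S i)) Hs) as S1. pose proof (sep_neq0 _ (- Z.of_nat (S i)) Hs) as S2.
    rewrite opp_IZR, IZR_of_nat, RtoC_opp in *.
    assert (F1 : (INR (S i) * tau + INR N)%C <> 0%C).
    { intros E. apply S1. replace (INR N / tau + INR (S i))%C with (/ tau * (INR (S i) * tau + INR N))%C by (field; auto).
      rewrite E. ring. }
    assert (F2 : (INR (S i) * tau - INR N)%C <> 0%C).
    { intros E. apply S2. replace (INR N / tau + - INR (S i))%C with (- / tau * (INR (S i) * tau - INR N))%C by (field; auto).
      rewrite E. ring. }
    replace (INR N / tau + INR (S i))%C with ((INR (S i) * tau + INR N) / tau)%C by (field; auto).
    replace (INR N / tau + - INR (S i))%C with (- (INR (S i) * tau - INR N) / tau)%C by (field; auto).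
    field. auto.
Qed.

Lemma Clim_bound_inv (u : nat -> C) l K : (forall n, Cmod (u n - l) <= K * / INR (S n)) -> Clim u l.
Proof.
  intros H. apply (Clim_le_0 u (fun n => K * / INR (S n))); auto.
  intros eps He. destruct (INR_large ((Rabs K + 1) / eps)) as [N HN]. exists N. intros n Hn.
  specialize (HN (S n) ltac:(lia)). assert (H0 : 0 < INR (S n)) by (apply lt_0_INR; lia).
  pose proof (Rle_abs K). pose proof (Rabs_pos K).
  apply Rmult_lt_reg_r with (INR (S n)); auto.
  rewrite Rmult_assoc, Rinv_l, Rmult_1_r by lra.
  apply Rlt_le_trans with ((Rabs K + 1) / eps * eps); [|rewrite Rmult_comm; apply Rmult_le_compat_l; lra].
  replace ((Rabs K + 1) / eps * eps) with (Rabs K + 1) by (field; lra). lra.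
Qed.

(** [e1 (N / tau)] grows exponentially, so the cotangent tends to pi i. This nonzero limit is the
    anomaly in [G2_transform]. *)
Lemma cotpi_lim tau : upper tau ->
  Clim (fun N => cotpi (INR (S N) / tau) / tau - / INR (S N))%C (PI * Ci / tau)%C.
Proof.
  intros Ht. pose proof (upper_inv tau Ht) as HU. unfold upper in HU.
  assert (t0 : tau <> 0%C) by (apply upper_neq0; auto).
  set (b := 2 * PI * Im (- / tau)%C). pose proof PI_RGT_0.
  assert (Hb : 0 < b) by (unfold b; nra).
  assert (Htm : 0 < Cmod tau) by (apply Cmod_gt_0; auto).
  apply (Clim_bound_inv _ _ (2 * PI / (b * Cmod tau) + 1)). intros n.
  assert (HS : 0 < INR (S n)) by (apply lt_0_INR; lia).
  set (x := e1 (INR (S n) / tau)).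
  assert (Hx : 1 + b * INR (S n) <= Cmod x).
  { unfold x. rewrite Cmod_e1.
    replace (- (2 * PI * Im (INR (S n) / tau)%C)) with (b * INR (S n)).
    - apply exp_ineq1_le.
    - unfold b, Cdiv. generalize (/ tau)%C (INR (S n)). intros [u v] a. unfold Cmult, Copp, RtoC. simpl. ring. }
  assert (Hx1 : b * INR (S n) <= Cmod (x - 1)).
  { pose proof (Cmod_sub_ge x 1). rewrite Cmod_1 in H0. lra. }
  assert (Hbn : 0 < b * INR (S n)) by nra.
  assert (x1 : (x - 1)%C <> 0%C) by (apply Cmod_gt_0; lra).
  replace (cotpi (INR (S n) / tau) / tau - / INR (S n) - PI * Ci / tau)%C
    with (2 * PI * Ci * / ((x - 1) * tau) - / INR (S n))%C.
  2:{ unfold cotpi. fold x. field. repeat split; auto. apply RtoC_neq0; lra. }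
  unfold Cminus at 1. eapply Rle_trans; [apply Cmod_triangle|].
  rewrite Cmod_opp, !Cmod_mult, <- RtoC_inv, !Cmod_R, Cmod_Ci, Cmod_inv, Cmod_mult by (try apply Cmult_neq_0; auto; lra).
  rewrite !Rabs_pos_eq by (try lra; apply Rlt_le, Rinv_0_lt_compat; auto).
  rewrite Rmult_plus_distr_r, Rmult_1_l. apply Rplus_le_compat_r.
  replace (2 * PI / (b * Cmod tau) * / INR (S n)) with (2 * PI * 1 * / (b * INR (S n) * Cmod tau)) by (field; lra).
  apply Rmult_le_compat_l; [lra|]. apply Rinv_le_contravar.
  - apply Rmult_lt_0_compat; auto.
  - apply Rmult_le_compat_r; lra.
Qed.

(** For fixed d the roles of c and d are exchanged: factoring tau out of the terms leaves [sqsum] at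
    d times -1/tau, without its central term c = 0. *)
Lemma row_ser tau d : upper tau ->
  Cser (fun c => sqterm (INR (S c) * tau) (Z.of_nat (S d)) + sqterm (INR (S c) * tau) (- Z.of_nat (S d)))%C
    (sqsum (INR (S d) * - / tau) / (tau * tau) - / (INR (S d) * INR (S d)))%C.
Proof.
  intros Ht. assert (t0 : tau <> 0%C) by (apply upper_neq0; auto).
  assert (d0 : RtoC (INR (S d)) <> 0%C) by (apply RtoC_neq0, not_0_INR; lia).
  assert (Hs : sep (INR (S d) * - / tau)%C).
  { apply upper_sep, upper_scal; [apply lt_0_INR; lia|apply upper_inv; auto]. }
  assert (Hr : forall c, sep (INR (S c) * tau)%C).
  { intros c. apply upper_sep, upper_scal; auto. apply lt_0_INR; lia. }
  replace (sqsum (INR (S d) * - / tau) / (tau * tau) - / (INR (S d) * INR (S d)))%C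
    with (/ (tau * tau) * (sqsum (INR (S d) * - / tau) - sqterm (INR (S d) * - / tau) 0))%C.
  2:{ unfold sqterm. replace (INR (S d) * - / tau + 0)%C with (- INR (S d) / tau)%C by (field; auto).
      field. auto. }
  unfold Cser. eapply Clim_ext; [|apply Clim_scal, Clim_minus; [apply sqsum_lim, Hs|apply Clim_const]].
  intros n. cbv beta. rewrite zsum_psum.
  match goal with |- (_ * (?a + ?b - ?a))%C = _ => replace (a + b - a)%C with b by ring end.
  rewrite <- psum_scal. apply psum_ext. intros c _.
  pose proof (sep_neq0 _ (Z.of_nat (S d)) (Hr c)) as N1.
  pose proof (sep_neq0 _ (- Z.of_nat (S d)) (Hr c)) as N2.
  unfold sqterm. rewrite !opp_IZR, !IZR_of_nat, !RtoC_opp in *.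
  replace (INR (S d) * - / tau + INR (S c))%C with ((INR (S c) * tau + - INR (S d)) / tau)%C by (field; auto).
  replace (INR (S d) * - / tau + - INR (S c))%C with (- (INR (S c) * tau + INR (S d)) / tau)%C by (field; auto).
  field. repeat split; auto.
Qed.

Lemma rows_ser tau N : upper tau ->
  Cser (fun c => zsum (sqterm (INR (S c) * tau)) N)
    (zeta2 / (tau * tau) + (psum (fun d => sqsum (INR (S d) * - / tau) / (tau * tau)) N
       - psum (fun d => / (INR (S d) * INR (S d))) N))%C.
Proof.
  intros Ht. assert (t0 : tau <> 0%C) by (apply upper_neq0; auto). induction N.
  - simpl psum. replace (zeta2 / (tau * tau) + (0 - 0))%C with (/ (tau * tau) * zeta2)%C by (field; auto).
    eapply Cser_ext; [|apply Cser_scal, zeta2_ser]. intros c. cbn [zsum]. unfold sqterm.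
    replace (INR (S c) * tau + 0)%C with (INR (S c) * tau)%C by ring. field.
    split; auto. apply RtoC_neq0, not_0_INR; lia.
  - cbn [psum]. pose proof (Cser_plus _ _ _ _ IHN (row_ser tau N Ht)) as H.
    match type of H with Cser _ ?l => match goal with |- Cser _ ?r => replace r with l by ring end end.
    exact H.
Qed.

(** For |d| <= N the finite sum over d commutes with the sum over c and gives [R N], which tends to
    the transformed series. The rest of [G2 tau] is the sum of the tails, compared with [telterm]
    and evaluated by the cotangent. *)
Lemma G2_transform tau : upper tau ->
  ((zeta2 + G2 (- / tau)) / (tau * tau) = zeta2 + G2 tau - PI * Ci / tau)%C.
Proof.
  intros Ht. assert (t0 : tau <> 0%C) by (apply upper_neq0; auto).
  set (R N := (zeta2 / (tau * tau) + (psum (fun d => sqsum (INR (S d) * - / tau) / (tau * tau)) N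
       - psum (fun d => / (INR (S d) * INR (S d))) N))%C).
  assert (L1 : Clim R (zeta2 / (tau * tau) + (G2 (- / tau) / (tau * tau) - zeta2))%C).
  { apply Clim_plus; [apply Clim_const|]. apply Clim_minus; [|exact zeta2_ser].
    destruct (G2_ser (- / tau)%C (upper_inv tau Ht)) as [H _].
    replace (G2 (- / tau) / (tau * tau))%C with (/ (tau * tau) * G2 (- / tau))%C by (field; auto).
    eapply Clim_ext; [|apply (Clim_scal (/ (tau * tau))%C _ _ H)].
    intros n. cbv beta. rewrite <- psum_scal. apply psum_ext. intros i _. field. auto. }
  assert (L2 : Clim (fun N => R (S N)) (G2 tau - PI * Ci / tau)%C).
  { destruct (lattice_lower tau Ht) as [k [Hk Hl]].
    assert (L3 : Clim (fun N => G2 tau - R (S N) - (cotpi (INR (S N) / tau) / tau - / INR (S N)))%C 0%C).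
    { apply (Clim_bound_inv _ _ (4 / (k * k * k))). intros N.
      replace (G2 tau - R (S N) - (cotpi (INR (S N) / tau) / tau - / INR (S N)) - 0)%C
        with (G2 tau - R (S N) - (cotpi (INR (S N) / tau) / tau - / INR (S N)))%C by ring.
      eapply Cser_bound.
      - apply Cser_minus; [apply Cser_minus; [apply (G2_ser tau Ht)|apply rows_ser, Ht]|].
        apply telterm_ser; auto. lia.
      - intros n. cbv beta. assert (K0 : 0 < 4 / (k * k * k)).
        { apply Rdiv_lt_0_compat; [lra|]. repeat apply Rmult_lt_0_compat; auto. }
        eapply Rle_trans; [|apply Rmult_le_compat_l; [lra|apply (rsum_shifted_inv_sq (S N) n); lia]].
        rewrite <- rsum_scal. apply rsum_le. intros c _.
        assert (Hc : 1 <= INR (S c)) by (apply (le_INR 1); lia).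
        apply (sqsum_tail (INR (S c) * tau)%C k (INR (S c)) (S N)); auto; [|lia|].
        + apply upper_sep, upper_scal; auto. lra.
        + intros d. specialize (Hl (INR (S c)) d). rewrite (Rabs_pos_eq (INR (S c))) in Hl by lra. exact Hl. }
    replace (G2 tau - PI * Ci / tau)%C with (G2 tau - 0 - PI * Ci / tau)%C by ring.
    eapply Clim_ext; [|apply Clim_minus; [apply Clim_minus; [apply (Clim_const (G2 tau))|apply L3]|apply (cotpi_lim tau Ht)]].
    intros N. cbv beta. ring. }
  pose proof (Clim_unique _ _ _ (Clim_subseq R _ S ltac:(auto) L1) L2) as E.
  replace ((zeta2 + G2 (- / tau)) / (tau * tau))%C
    with ((zeta2 / (tau * tau) + (G2 (- / tau) / (tau * tau) - zeta2)) + zeta2)%C by (field; auto).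
  rewrite E. ring.
Qed.

(** * A branch of the logarithm of eta *)

Definition eta_log (tau : C) : C := (2 * PI * Ci * tau / 24 + PS etalog (e1 tau))%C.

Lemma eta_eta_log tau : upper tau -> eta tau = Cexp (eta_log tau).
Proof.
  intros Ht. rewrite eta_exp, qh1_e1 by auto. unfold eta_log. rewrite Cexp_add. f_equal.
  unfold qh. f_equal. f_equal. f_equal. simpl. ring.
Qed.

Lemma Cder_e1 z : Cder e1 z (2 * PI * Ci * e1 z)%C.
Proof.
  eapply Cder_eq; [|apply (Cder_comp Cexp (fun w => 2 * PI * Ci * w)%C);
      [apply Cder_scal, Cder_id|apply Cder_Cexp]]. unfold e1. ring.
Qed.

(** The factor q^(1/24) contributes pi i / 12, which is i / (2 pi) times pi^2 / 6: this is where the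
    value of zeta(2) enters. *)
Lemma eta_log_der tau : upper tau -> Cder eta_log tau (Ci / (2 * PI) * (zeta2 + G2 tau))%C.
Proof.
  intros Ht. pose proof PI_RGT_0.
  assert (Hq : Cmod (e1 tau) < 1).
  { rewrite <- qh1_e1. apply Cmod_qh; auto. }
  destruct (G2_ser tau Ht) as [_ E].
  eapply Cder_eq; [|apply Cder_plus; [|apply (Cder_comp (PS etalog) e1); [apply Cder_e1|
     apply PS_der; [apply disc_etalog|exact Hq]]]].
  2:{ apply Cder_ext with (fun w => 2 * PI * Ci / 24 * w)%C; [intros; field|].
      apply Cder_scal, Cder_id. }
  rewrite E, zeta2_eq. field. apply RtoC_neq0. lra.
Qed.

Lemma upper_nbhd tau : upper tau -> exists d, 0 < d /\ forall w, Cmod (w - tau) < d -> upper w.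
Proof.
  intros H. unfold upper in *. exists (Im tau). split; auto. intros w Hw.
  pose proof (Cmod_Im_le (w - tau)) as B.
  replace (Im (w - tau)%C) with (Im w - Im tau) in B by (destruct w, tau; reflexivity).
  pose proof (Rle_abs (- (Im w - Im tau))) as B2. rewrite Rabs_Ropp in B2. lra.
Qed.

(** The square avoids a root of -i tau. By [G2_transform] the quotient [Psi] has derivative zero,
    and its constant value is read off at the fixed point i. *)
Lemma eta_S tau : upper tau -> (eta (- / tau) * eta (- / tau) = - Ci * tau * (eta tau * eta tau))%C.
Proof.
  intros Ht. set (Psi := fun w => (Cexp (2 * (eta_log (- / w) + (-1) * eta_log w)) * / w)%C).
  assert (E : Psi Ci = Psi tau).
  { apply Cder_zero_const. intros t Hr. set (w := (Ci + t * (tau - Ci))%C).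
    assert (Hw : upper w).
    { unfold upper, w in *. destruct tau as [x y]. simpl in *.
      replace (1 + (t * (y + - (1)) + 0 * (x + - 0))) with (1 - t + t * y) by ring.
      destruct (Req_dec t 0) as [->|h]; [lra|]. assert (0 < t * y) by nra. lra. }
    assert (w0 : w <> 0%C) by (apply upper_neq0; auto).
    assert (Dm : Cder (fun u => - / u)%C w (/ (w * w))%C).
    { eapply Cder_ext; [|eapply Cder_eq; [|apply (Cder_scal (-1)%C _ _ _ (Cder_inv w w0))]].
      - intros u. simpl. ring.
      - ring. }
    pose proof (Cder_comp eta_log (fun u => - / u)%C w _ _ Dm (eta_log_der _ (upper_inv w Hw))) as D1.
    pose proof (Cder_scal (-1)%C _ _ _ (eta_log_der w Hw)) as D2.
    pose proof (Cder_comp Cexp _ w _ _ (Cder_scal 2%C _ _ _ (Cder_plus _ _ _ _ _ D1 D2)) (Cder_Cexp _)) as D3.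
    pose proof (Cder_mult _ _ _ _ _ D3 (Cder_inv w w0)) as D4.
    eapply Cder_eq; [|exact D4]. cbv beta.
    pose proof (G2_transform w Hw) as T. pose proof PI_RGT_0.
    assert (P0 : RtoC PI <> 0%C) by (apply RtoC_neq0; lra).
    replace (/ (w * w) * (Ci / (2 * PI) * (zeta2 + G2 (- / w))))%C
      with (Ci / (2 * PI) * ((zeta2 + G2 (- / w)) / (w * w)))%C by (field; auto).
    rewrite T. set (X := Cexp _).
    replace (2 * (Ci / (2 * PI) * (zeta2 + G2 w - PI * Ci / w) + -1 * (Ci / (2 * PI) * (zeta2 + G2 w))))%C
      with (- (Ci * Ci) / w)%C by (field; auto).
    rewrite Ci_sqr. field. auto. }
  assert (Hi : (- / Ci)%C = Ci) by (rewrite Ci_inv; ring).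
  assert (t0 : tau <> 0%C) by (apply upper_neq0; auto).
  unfold Psi in E. rewrite Hi in E.
  replace (2 * (eta_log Ci + -1 * eta_log Ci))%C with (RtoC 0) in E by ring.
  rewrite Cexp_0, Ci_inv in E.
  rewrite !eta_eta_log by (auto; apply upper_inv; auto). rewrite <- !Cexp_add.
  replace (eta_log (- / tau) + eta_log (- / tau))%C
    with (2 * (eta_log (- / tau) + -1 * eta_log tau) + (eta_log tau + eta_log tau))%C by ring.
  rewrite Cexp_add. f_equal.
  replace (Cexp (2 * (eta_log (- / tau) + -1 * eta_log tau)))
    with (Cexp (2 * (eta_log (- / tau) + -1 * eta_log tau)) * / tau * tau)%C by (field; auto).
  rewrite <- E. ring.
Qed.

(** * Fourier expansions *)

Lemma sum_n_psum (u : nat -> C) n : sum_n (G := C_AbelianMonoid) u n = psum u (S n).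
Proof.
  induction n.
  - rewrite sum_O. simpl. ring.
  - rewrite sum_Sn, IHn. reflexivity.
Qed.

Lemma pow_n_Cpow (q : C) n : pow_n (K := C_Ring) q n = (q ^ n)%C.
Proof. induction n; simpl; [reflexivity|]. rewrite IHn. reflexivity. Qed.

Lemma is_pseries_Cser (a : nat -> C) q l :
  is_pseries (K := C_AbsRing) (V := C_NormedModule) a q l <-> Cser (fun n => a n * q ^ n)%C l.
Proof.
  unfold is_pseries, is_series, Cser.
  set (u := fun n => (a n * q ^ n)%C).
  assert (E : forall n, sum_n (fun k => scal (K := C_AbsRing) (V := C_NormedModule)
      (pow_n (K := C_AbsRing) q k) (a k)) n = psum u (S n)).
  { intros n. rewrite <- sum_n_psum. apply sum_n_ext. intros k. unfold u.
    rewrite Cmult_comm. change (pow_n (K := C_AbsRing) q k) with (pow_n (K := C_Ring) q k).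
    rewrite pow_n_Cpow. reflexivity. }
  split.
  - intros H. apply Clim_shift. intros eps He.
    assert (He2 : 0 < eps / 2) by lra.
    destruct (H (fun y => Cmod (y - l) < eps)) as [N HN].
    + exists (mkposreal _ He2). intros y Hy. apply C_NormedModule_mixin_compat2 in Hy. simpl in Hy.
      assert (sqrt 2 < 2).
      { rewrite <- (sqrt_square 2) at 2 by lra. apply sqrt_lt_1; lra. }
      change (minus y l) with (y - l)%C in Hy. pose proof (sqrt_pos 2). nra.
    + exists N. intros n Hn. rewrite <- E. apply HN. auto.
  - intros H P [eps HP]. destruct (H eps (cond_pos eps)) as [N HN]. exists N.
    intros n Hn. apply HP. rewrite E. apply C_NormedModule_mixin_compat1.
    apply HN. lia.
Qed.

Lemma unit_circle x y : x * x + y * y = 1 -> exists t, x = cos t /\ y = sin t.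
Proof.
  intros H. assert (Hx : -1 <= x <= 1) by nra.
  assert (Hs : sin (acos x) * sin (acos x) = y * y).
  { pose proof (sin2_cos2 (acos x)) as E. rewrite cos_acos in E by auto. unfold Rsqr in E. lra. }
  assert (F : sin (acos x) = y \/ sin (acos x) = - y).
  { assert (E : (sin (acos x) - y) * (sin (acos x) + y) = 0) by lra.
    apply Rmult_integral in E. lra. }
  destruct F as [F|F].
  - exists (acos x). rewrite cos_acos; auto.
  - exists (- acos x). rewrite cos_neg, sin_neg, cos_acos by auto. split; lra.
Qed.

(** This carries identities and bounds from the upper half plane to 0 < |q| < 1, which is why the
    uniqueness and Cauchy lemmas ask only for nonzero q. *)
Lemma qh_surj h (q : C) : (0 < h)%nat -> q <> 0%C -> Cmod q < 1 ->
  exists tau, upper tau /\ qh h tau = q.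
Proof.
  intros Hh Hq0 Hq. assert (Hm : 0 < Cmod q) by (apply Cmod_gt_0; auto).
  assert (HN : 0 < INR h) by (apply lt_0_INR; auto). pose proof PI_RGT_0 as Hpi.
  destruct (unit_circle (Re q / Cmod q) (Im q / Cmod q)) as [t [E1 E2]].
  { pose proof (Cmod2_alt q) as E. field_simplify; [|lra]. rewrite <- E. field. lra. }
  exists (INR h * t / (2 * PI), - (INR h * ln (Cmod q) / (2 * PI)))%R. split.
  - unfold upper. simpl. assert (ln (Cmod q) < 0) by (rewrite <- ln_1; apply ln_increasing; auto).
    replace (- (INR h * ln (Cmod q) / (2 * PI))) with (INR h * - ln (Cmod q) / (2 * PI)) by (field; lra).
    apply Rdiv_lt_0_compat; [|lra]. apply Rmult_lt_0_compat; lra.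
  - unfold qh.
    replace (2 * PI * Ci * (INR h * t / (2 * PI), - (INR h * ln (Cmod q) / (2 * PI)))%R / INR h)%C
      with (ln (Cmod q), t).
    + unfold Cexp. simpl. rewrite exp_ln, <- E1, <- E2 by auto.
      destruct q as [x y]. unfold Cmult, RtoC. simpl. f_equal; field; simpl in *; lra.
    + unfold Cdiv. rewrite <- RtoC_inv by lra. unfold Cmult, RtoC, Ci. simpl. f_equal; field; lra.
Qed.

(** By [qh_surj] the expansion converges at every real radius in (0, 1), and this already forces
    [disc]. *)
Lemma has_qexp_PS h f a : (0 < h)%nat ->
  (has_qexp h f a <-> disc a /\ forall tau, upper tau -> f tau = PS a (qh h tau)).
Proof.
  intros Hh. split.
  - intros H. assert (Ha : disc a).
    { apply disc_of_Cser. intros r Hr.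
      destruct (qh_surj h (RtoC r) Hh) as [tau [Ht E]].
      - apply RtoC_neq0. lra.
      - rewrite Cmod_R, Rabs_pos_eq; lra.
      - exists (f tau). specialize (H tau Ht). rewrite E in H. apply is_pseries_Cser, H. }
    split; auto. intros tau Ht. symmetry. apply PS_eq. apply is_pseries_Cser, H, Ht.
  - intros [Ha H] tau Ht. apply is_pseries_Cser. rewrite H by auto.
    apply PS_ser; auto. apply Cmod_qh; auto.
Qed.

Lemma PS_inj (a b : nat -> C) : disc a -> disc b ->
  (forall q : C, q <> 0%C -> Cmod q < 1 -> PS a q = PS b q) -> forall n, a n = b n.
Proof.
  intros Ha Hb H n.
  assert (E : (a n + (-1) * b n)%C = 0%C).
  { apply (PS_unique (fun n => a n + (-1) * b n)%C).
    - apply disc_plus, disc_scal; auto.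
    - intros q Hq0 Hq. rewrite (PS_plus a (fun n => (-1) * b n)%C), PS_scal, H by (auto using disc_scal). ring. }
  replace (a n) with (a n + (-1) * b n + b n)%C by ring. rewrite E. ring.
Qed.

Lemma PS_inj_qh h (a b : nat -> C) : (0 < h)%nat -> disc a -> disc b ->
  (forall tau, upper tau -> PS a (qh h tau) = PS b (qh h tau)) -> forall n, a n = b n.
Proof.
  intros Hh Ha Hb H. apply PS_inj; auto. intros q Hq0 Hq.
  destruct (qh_surj h q Hh Hq0 Hq) as [tau [Ht <-]]. auto.
Qed.

Lemma qexp_unique h f a b : (0 < h)%nat -> has_qexp h f a -> has_qexp h f b -> forall n, a n = b n.
Proof.
  intros Hh Ha Hb. apply has_qexp_PS in Ha; auto. apply has_qexp_PS in Hb; auto.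
  destruct Ha as [Da Ha], Hb as [Db Hb].
  apply (PS_inj_qh h); auto. intros tau Ht. rewrite <- Ha, <- Hb; auto.
Qed.

Lemma qh_add h z w : qh h (z + w) = (qh h z * qh h w)%C.
Proof. unfold qh. rewrite <- Cexp_add. f_equal. unfold Cdiv. ring. Qed.

Lemma qh_pow h tau : (0 < h)%nat -> (qh h tau ^ h)%C = e1 tau.
Proof.
  intros Hh. unfold qh, e1. rewrite Cexp_pow. f_equal. field.
  apply RtoC_neq0, not_0_INR. lia.
Qed.

Lemma qh3_mul3 tau : qh 3 (3 * tau) = e1 tau.
Proof. unfold qh, e1. f_equal. simpl INR. rewrite !RtoC_plus. field.
Qed.

Lemma Cmod_e1_lt1 tau : upper tau -> Cmod (e1 tau) < 1.
Proof. intros H. rewrite <- qh1_e1. apply Cmod_qh; auto. Qed.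

Lemma disc_decimate d (a : nat -> C) : (0 < d)%nat -> disc a -> disc (fun n => a (d * n)%nat).
Proof.
  intros Hd Ha. apply disc_of_bounded. intros r Hr.
  assert (HN : 0 < INR d) by (apply lt_0_INR; auto).
  (* The d-th root of r. *)
  set (s := exp (ln r / INR d)).
  assert (Hs : s ^ d = r).
  { unfold s. rewrite <- Rpower_pow by apply exp_pos. unfold Rpower. rewrite ln_exp.
    replace (INR d * (ln r / INR d)) with (ln r) by (field; lra). apply exp_ln; lra. }
  assert (Hs1 : 0 <= s < 1).
  { split; [apply Rlt_le, exp_pos|]. unfold s. rewrite <- exp_0. apply exp_increasing.
    assert (ln r < 0) by (rewrite <- ln_1; apply ln_increasing; lra).
    apply Rmult_lt_reg_r with (INR d); auto. replace (ln r / INR d * INR d) with (ln r) by (field; lra). lra. }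
  destruct (disc_bounded a s Ha Hs1) as [B [HB0 HB]]. exists B. intros n.
  specialize (HB (d * n)%nat). rewrite pow_mult, Hs in HB. exact HB.
Qed.

(** * The group Gamma_0(3) *)

Definition mmul (g h : mat2) : mat2 :=
  Mat2 (ma g * ma h + mb g * mc h) (ma g * mb h + mb g * md h)
       (mc g * ma h + md g * mc h) (mc g * mb h + md g * md h).

Lemma SL2Z_mmul g h : SL2Z g -> SL2Z h -> SL2Z (mmul g h).
Proof.
  unfold SL2Z, mmul. simpl. intros Hg Hh.
  transitivity ((ma g * md g - mb g * mc g) * (ma h * md h - mb h * mc h))%Z; [ring|].
  rewrite Hg, Hh. reflexivity.
Qed.

Lemma autj_neq0 g tau : SL2Z g -> upper tau -> autj g tau <> 0%C.
Proof.
  unfold SL2Z, upper, autj. intros Hg Ht E. destruct tau as [x y]. simpl in Ht.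
  assert (E2 : IZR (mc g) * y = 0).
  { apply (f_equal Im) in E. simpl in E. lra. }
  apply Rmult_integral in E2. destruct E2 as [E2|E2]; [|lra].
  apply (f_equal Re) in E. simpl in E. rewrite E2 in E.
  assert (E3 : IZR (md g) = 0) by lra.
  apply eq_IZR in E2, E3. rewrite E2, E3 in Hg. lia.
Qed.

Lemma upper_moebius g tau : SL2Z g -> upper tau -> upper (moebius g tau).
Proof.
  intros Hg Ht. pose proof (autj_neq0 g tau Hg Ht) as N. unfold SL2Z in Hg.
  apply (f_equal IZR) in Hg. rewrite minus_IZR, !mult_IZR in Hg.
  unfold upper, moebius, autj in *. destruct tau as [x y].
  set (a := IZR (ma g)) in *. set (b := IZR (mb g)) in *.
  set (c := IZR (mc g)) in *. set (d := IZR (md g)) in *. simpl in Ht.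
  assert (P : 0 < (c * x + d) * (c * x + d) + (c * y) * (c * y)).
  { destruct (Req_dec (c * y) 0) as [h|h].
    - apply Rmult_integral in h. destruct h as [h|h]; [|lra]. rewrite h in *.
      assert (d <> 0) by (intros Z; rewrite Z in Hg; lra). nra.
    - pose proof (Rsqr_pos_lt _ h) as p1. pose proof (Rle_0_sqr (c * x + d)) as p2.
      unfold Rsqr in p1, p2. lra. }
  replace (Im ((a * (x, y) + b) / (c * (x, y) + d))%C)
    with (y / ((c * x + d) * (c * x + d) + (c * y) * (c * y))).
  - apply Rdiv_lt_0_compat; auto.
  - unfold Cdiv, Cinv, Cmult, Cplus, RtoC. simpl.
    replace y with ((a * d - b * c) * y) at 1 by (rewrite Hg; ring). simpl. field. lra.
Qed.

Lemma autj_mmul g h tau : SL2Z h -> upper tau ->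
  autj (mmul g h) tau = (autj g (moebius h tau) * autj h tau)%C.
Proof.
  intros Hh Ht. pose proof (autj_neq0 h tau Hh Ht) as N.
  unfold autj at 1 2. unfold moebius. simpl.
  rewrite !plus_IZR, !mult_IZR, !RtoC_plus, !RtoC_mult.
  set (j := autj h tau) in *.
  replace ((IZR (mc g) * ((IZR (ma h) * tau + IZR (mb h)) / j) + IZR (md g)) * j)%C
    with (IZR (mc g) * (IZR (ma h) * tau + IZR (mb h)) + IZR (md g) * j)%C by (field; auto).
  unfold j, autj. ring.
Qed.

Lemma moebius_mmul g h tau : SL2Z g -> SL2Z h -> upper tau ->
  moebius (mmul g h) tau = moebius g (moebius h tau).
Proof.
  intros Hg Hh Ht. pose proof (autj_neq0 h tau Hh Ht) as N.
  pose proof (autj_neq0 g _ Hg (upper_moebius h tau Hh Ht)) as N2.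
  unfold moebius at 1 2. rewrite autj_mmul by auto.
  set (J := autj g (moebius h tau)) in *. unfold moebius. simpl.
  rewrite !plus_IZR, !mult_IZR, !RtoC_plus, !RtoC_mult.
  set (j := autj h tau) in *.
  replace (IZR (ma g) * ((IZR (ma h) * tau + IZR (mb h)) / j) + IZR (mb g))%C
    with ((IZR (ma g) * (IZR (ma h) * tau + IZR (mb h)) + IZR (mb g) * j) / j)%C by (field; auto).
  replace ((IZR (ma g) * IZR (ma h) + IZR (mb g) * IZR (mc h)) * tau + (IZR (ma g) * IZR (mb h) + IZR (mb g) * IZR (md h)))%C
    with (IZR (ma g) * (IZR (ma h) * tau + IZR (mb h)) + IZR (mb g) * j)%C by (unfold j, autj; ring).
  field. auto.
Qed.

Definition invariant (w : nat) (f : C -> C) (g : mat2) : Prop :=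
  forall tau, upper tau -> slash w f g tau = f tau.

Lemma slash_mmul w f g h tau : SL2Z g -> SL2Z h -> upper tau ->
  slash w f (mmul g h) tau = (slash w f g (moebius h tau) / autj h tau ^ w)%C.
Proof.
  intros Hg Hh Ht. pose proof (autj_neq0 h tau Hh Ht) as N.
  pose proof (autj_neq0 g _ Hg (upper_moebius h tau Hh Ht)) as N2.
  unfold slash. rewrite moebius_mmul, autj_mmul, Cpow_mult_l by auto.
  pose proof (Cpow_nz _ w N). pose proof (Cpow_nz _ w N2). field. auto.
Qed.

Lemma slash_invariant_mmul w f g h tau : SL2Z g -> SL2Z h -> invariant w f g -> upper tau ->
  slash w f (mmul g h) tau = slash w f h tau.
Proof.
  intros Hg Hh Hi Ht. rewrite slash_mmul by auto. rewrite Hi by (apply upper_moebius; auto).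
  reflexivity.
Qed.

Lemma invariant_mmul w f g h : SL2Z g -> SL2Z h ->
  invariant w f g -> invariant w f h -> invariant w f (mmul g h).
Proof.
  intros Hg Hh Ig Ih tau Ht. rewrite slash_invariant_mmul by auto. auto.
Qed.

Lemma centered_remainder (x y : Z) : y <> 0%Z -> exists n, (2 * Z.abs (x + n * y) <= Z.abs y)%Z.
Proof.
  intros Hy. pose proof (Z.div_mod x y Hy) as E.
  assert (H : (0 <= x mod y < y \/ y < x mod y <= 0)%Z).
  { destruct (Z_lt_le_dec 0 y); [left; apply Z.mod_pos_bound; lia|right; apply Z.mod_neg_bound; lia]. }
  set (r := (x mod y)%Z) in *. set (k := (x / y)%Z) in *.
  destruct (Z_le_gt_dec (2 * Z.abs r) (Z.abs y)).
  - exists (- k)%Z. replace (x + - k * y)%Z with r by lia. lia.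
  - exists (- k - 1)%Z. replace (x + (- k - 1) * y)%Z with (r - y)%Z by lia. lia.
Qed.

Definition Tmat (n : Z) : mat2 := Mat2 1 n 0 1.
Definition Umat (m : Z) : mat2 := Mat2 1 0 (3 * m) 1.

Lemma SL2Z_Tmat n : SL2Z (Tmat n).
Proof. unfold SL2Z, Tmat; cbn [ma mb mc md]. ring. Qed.

Lemma SL2Z_Umat m : SL2Z (Umat m).
Proof. unfold SL2Z, Umat; cbn [ma mb mc md]. ring. Qed.

(* Euclid's algorithm on the bottom row: T-powers make |d| <= |c|/2, then U-powers make |c| <= 3|d|/2. *)
Lemma Gamma0_3_generated w f :
  (forall n, invariant w f (Tmat n)) -> (forall m, invariant w f (Umat m)) ->
  (forall g, SL2Z g -> mc g = 0%Z -> invariant w f g) ->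
  forall g, Gamma0 3 g -> invariant w f g.
Proof.
  intros HT HU H0.
  assert (H : forall k : nat, forall g, (Z.abs (mc g) <= Z.of_nat k)%Z -> Gamma0 3 g -> invariant w f g).
  { induction k; intros g Hk [Hg H3].
    - apply H0; auto. lia.
    - destruct (Z.eq_dec (mc g) 0) as [c0|c0]; [apply H0; auto|].
      destruct (centered_remainder (md g) (mc g) c0) as [n Hn].
      set (g1 := mmul g (Tmat n)).
      assert (S1 : SL2Z g1) by (apply SL2Z_mmul; auto using SL2Z_Tmat).
      assert (E1 : mc g1 = mc g /\ md g1 = (md g + n * mc g)%Z)
        by (unfold g1, mmul, Tmat; cbn [ma mb mc md]; split; ring).
      destruct E1 as [Ec1 Ed1].
      (* Otherwise the determinant 1 would be a multiple of the lower left entry, hence of 3. *)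
      assert (d0 : md g1 <> 0%Z).
      { intros Z0. unfold SL2Z in S1. rewrite Z0, Ec1 in S1. destruct H3 as [e He].
        rewrite He in S1. simpl Z.of_nat in S1.
        assert ((3 * (- (mb g1 * e)) = 1)%Z) by (rewrite <- S1; ring). lia. }
      (* The new entry satisfies 2|c'| <= 3|d| <= 3|c|/2, so |c'| <= 3|c|/4 and the induction on |c|
         proceeds. *)
      destruct (centered_remainder (mc g1) (3 * md g1)) as [m Hm]; [lia|].
      set (g2 := mmul g1 (Umat m)).
      assert (S2 : SL2Z g2) by (apply SL2Z_mmul; auto using SL2Z_Umat).
      assert (Ec2 : mc g2 = (mc g1 + m * (3 * md g1))%Z)
        by (unfold g2, mmul, Umat; cbn [ma mb mc md]; ring).
      assert (I2 : invariant w f g2).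
      { apply IHk; [rewrite Ec2; lia|]. split; auto. rewrite Ec2, Ec1.
        destruct H3 as [e He]. exists (e + m * md g1)%Z. simpl Z.of_nat in *. lia. }
      assert (Eg : g = mmul (mmul g2 (Umat (- m))) (Tmat (- n))).
      { destruct g as [a b c d]. unfold g2, g1, mmul, Umat, Tmat; cbn [ma mb mc md]. f_equal; ring. }
      rewrite Eg. clearbody g2. apply invariant_mmul; auto using SL2Z_mmul, SL2Z_Tmat, SL2Z_Umat.
      apply invariant_mmul; auto using SL2Z_Umat. }
  intros g Hg. apply (H (Z.to_nat (Z.abs (mc g)))); auto. lia.
Qed.

(* [a] is the expansion at oo, in q; [b] the one at 0, in e^(2 i pi tau / 3). *)
Definition expansions (w : nat) (f : C -> C) (a b : nat -> C) : Prop :=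
  disc a /\ disc b /\ forall tau, upper tau ->
    f tau = PS a (e1 tau) /\ f (- / tau)%C = (tau ^ w * PS b (qh 3 tau))%C.

Lemma e1_shift tau (n : Z) : e1 (tau + IZR n) = e1 tau.
Proof. rewrite e1_add, e1_IZR. ring. Qed.

Lemma qh3_shift tau (m : Z) : qh 3 (tau + IZR (3 * m)) = qh 3 tau.
Proof.
  rewrite qh_add. replace (qh 3 (IZR (3 * m))) with (e1 (IZR m)).
  - rewrite e1_IZR. ring.
  - rewrite <- qh3_mul3, mult_IZR, RtoC_mult. reflexivity.
Qed.

Lemma upper_shift tau (n : Z) : upper tau -> upper (tau + IZR n)%C.
Proof. unfold upper. destruct tau; simpl. lra. Qed.

Lemma Cpow_even_sign (x : C) w : Nat.Even w -> (x * x)%C = 1%C -> (x ^ w)%C = 1%C.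
Proof.
  intros [k ->] H. rewrite Cpow_mult_r. simpl. rewrite Cmult_1_r, H. apply Cpow_1_l.
Qed.

Lemma expansions_T w f a b n : expansions w f a b -> invariant w f (Tmat n).
Proof.
  intros (_ & _ & H) tau Ht. unfold slash, moebius, autj. simpl.
  replace (0 * tau + 1)%C with (RtoC 1) by ring. rewrite Cpow_1_l.
  replace ((1 * tau + IZR n) / 1)%C with (tau + IZR n)%C by field.
  destruct (H _ (upper_shift tau n Ht)) as [E _]. destruct (H _ Ht) as [E' _].
  rewrite E, e1_shift, E'. field.
Qed.

(** Conjugation by tau -> -1/tau turns [Umat m] into the translation by -3m, which fixes the
    parameter [qh 3] of the expansion at 0. *)
Lemma expansions_U w f a b m : expansions w f a b -> invariant w f (Umat m).
Proof.
  intros (_ & _ & H) tau Ht. assert (t0 : tau <> 0%C) by (apply upper_neq0; auto).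
  assert (j0 : (IZR (3 * m) * tau + 1)%C <> 0%C)
    by (apply (autj_neq0 (Umat m) tau (SL2Z_Umat m) Ht)).
  set (s := (- / tau)%C). assert (Hs : upper s) by (apply upper_inv; auto).
  assert (s0 : s <> 0%C) by (apply upper_neq0; auto).
  destruct (H _ Hs) as [_ E1]. destruct (H _ (upper_shift s (3 * (- m)) Hs)) as [_ E2].
  rewrite qh3_shift in E2.
  assert (F : (s + IZR (3 * - m))%C = (s * (IZR (3 * m) * tau + 1))%C).
  { unfold s. replace (3 * - m)%Z with (- (3 * m))%Z by lia. rewrite opp_IZR, RtoC_opp. field. auto. }
  rewrite F in E2.
  replace (- / s)%C with tau in E1 by (unfold s; field; auto).
  unfold slash, moebius, autj, Umat, ma, mb, mc, md.
  replace ((1 * tau + 0) / (IZR (3 * m) * tau + 1))%C with (- / (s * (IZR (3 * m) * tau + 1)))%C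
    by (unfold s; field; auto).
  rewrite E2, E1, Cpow_mult_l. pose proof (Cpow_nz _ w j0). field. auto.
Qed.

(** Such a matrix is plus or minus a translation, and even weight removes the sign. *)
Lemma expansions_c0 w f a b g : Nat.Even w -> expansions w f a b -> SL2Z g -> mc g = 0%Z -> invariant w f g.
Proof.
  intros Hw (_ & _ & H) Hg Hc tau Ht. unfold SL2Z in Hg. rewrite Hc in Hg.
  assert (Had : (ma g = 1 /\ md g = 1 \/ ma g = -1 /\ md g = -1)%Z).
  { assert (E : (ma g * md g = 1)%Z) by lia.
    destruct (Z.eq_mul_1 _ _ E) as [h|h]; rewrite h in E; lia. }
  assert (Em : moebius g tau = (tau + IZR (mb g * md g))%C).
  { unfold moebius, autj. rewrite Hc. destruct Had as [[-> ->]|[-> ->]];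
    rewrite mult_IZR, RtoC_mult; field; auto.
  }
  assert (Ej : (autj g tau ^ w)%C = 1%C).
  { apply Cpow_even_sign; auto. unfold autj. rewrite Hc.
    destruct Had as [[_ ->]|[_ ->]]; [ring|].
    replace (RtoC (-1)) with (- RtoC 1)%C by (rewrite <- RtoC_opp; reflexivity). ring. }
  unfold slash. rewrite Em, Ej.
  destruct (H _ (upper_shift tau (mb g * md g) Ht)) as [E _]. destruct (H _ Ht) as [E' _].
  rewrite E, e1_shift, E'. field.
Qed.

Lemma expansions_Gamma0 w f a b g : Nat.Even w -> expansions w f a b -> Gamma0 3 g -> invariant w f g.
Proof.
  intros Hw H. apply Gamma0_3_generated.
  - intros n. eapply expansions_T; eauto.
  - intros m. eapply expansions_U; eauto.
  - intros h. eapply expansions_c0; eauto.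
Qed.

Definition STmat (j : Z) : mat2 := Mat2 0 (-1) 1 j.

Lemma expansions_ST w f a b j tau : expansions w f a b -> upper tau ->
  slash w f (STmat j) tau = PS b (qh 3 (tau + IZR j)).
Proof.
  intros (_ & _ & H) Ht. pose proof (upper_shift tau j Ht) as Hs.
  assert (s0 : (tau + IZR j)%C <> 0%C) by (apply upper_neq0; auto).
  destruct (H _ Hs) as [_ E]. unfold slash, moebius, autj. simpl.
  replace (1 * tau + IZR j)%C with (tau + IZR j)%C by ring.
  replace ((0 * tau + -1) / (tau + IZR j))%C with (- / (tau + IZR j))%C by (field; auto).
  rewrite E. pose proof (Cpow_nz _ w s0). field. auto.
Qed.

(** Gamma_0(3) has two cusps: modulo its left action, g is the identity or S T^j. The latter only
    multiplies b_n by a root of unity to the power n, so the constant term is that of [a] or of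
    [b]. *)
Lemma expansions_cusps w f a b g : Nat.Even w -> expansions w f a b -> SL2Z g ->
  exists c, has_qexp 3 (slash w f g) c /\ (c O = a O \/ c O = b O).
Proof.
  intros Hw H Hg. pose proof H as (Da & Db & Hf).
  destruct (Z.eq_dec (mc g mod 3) 0) as [h|h].
  - exists (dilate 3 a). split; [|left; reflexivity].
    apply has_qexp_PS; [lia|]. split; [apply disc_dilate; auto; lia|]. intros tau Ht.
    rewrite PS_dilate by (auto; try lia; apply Cmod_qh; auto; lia).
    rewrite qh_pow by lia. destruct (Hf tau Ht) as [<- _].
    apply (expansions_Gamma0 w f a b g); auto. split; auto.
    apply Z.mod_divide; auto. lia.
  (* As c^2 = 1 modulo 3, the lower left entry d (c^2 - 1) of [k] is divisible by 3. *)
  - set (j := (mc g * md g)%Z).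
    set (k := mmul g (Mat2 j 1 (-1) 0)).
    assert (Sk : SL2Z k) by (apply SL2Z_mmul; auto; unfold SL2Z; simpl; lia).
    assert (Gk : Gamma0 3 k).
    { split; auto. simpl. unfold j.
      assert (E : (exists e, mc g = 3 * e + 1 \/ mc g = 3 * e - 1)%Z).
      { pose proof (Z.div_mod (mc g) 3 ltac:(lia)). pose proof (Z.mod_pos_bound (mc g) 3 ltac:(lia)).
        assert (C3 : (mc g mod 3 = 1 \/ mc g mod 3 = 2)%Z) by lia. destruct C3.
        - exists (mc g / 3)%Z. lia.
        - exists (mc g / 3 + 1)%Z. lia. }
      destruct E as [e [-> | ->]].
      - exists (md g * (3 * e * e + 2 * e))%Z. ring.
      - exists (md g * (3 * e * e - 2 * e))%Z. ring. }
    assert (Eg : g = mmul k (STmat j)).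
    { destruct g as [a' b' c' d']. unfold k, mmul, STmat; cbn [ma mb mc md]. f_equal; ring. }
    assert (SS : SL2Z (STmat j)) by (unfold SL2Z; simpl; lia).
    set (z := qh 3 (IZR j)).
    assert (Hz : Cmod z = 1).
    { unfold z, qh. rewrite Cmod_Cexp, <- exp_0. f_equal. unfold Cdiv.
      rewrite <- RtoC_inv by (simpl; lra). unfold Cmult, RtoC, Ci. simpl. ring. }
    exists (fun n => (b n * z ^ n)%C). split; [|right; simpl; ring].
    assert (Dz : disc (fun n => (b n * z ^ n)%C)).
    { intros r Hr. eapply summable_le; [|apply (Db r Hr)]. intros n.
      rewrite Cmod_mult, Cmod_pow, Hz, pow1. lra. }
    apply has_qexp_PS; [lia|]. split; auto. intros tau Ht.
    rewrite Eg, slash_invariant_mmul; auto; [|apply (expansions_Gamma0 w f a b); auto].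
    rewrite (expansions_ST w f a b) by auto. rewrite qh_add. fold z.
    assert (Hq : Cmod (qh 3 tau * z) < 1).
    { rewrite Cmod_mult, Hz, Rmult_1_r. apply Cmod_qh; auto; lia. }
    apply PS_eq. eapply Cser_ext; [|apply PS_ser; [exact Dz|apply Cmod_qh; auto; lia]].
    intros n. simpl. rewrite Cpow_mult_l. ring.
Qed.

Lemma expansions_modular w f a b : Nat.Even w -> expansions w f a b -> modular_form 3 w f.
Proof.
  intros Hw H. split.
  - intros tau Ht. pose proof H as (Da & _ & Hf).
    exists (2 * PI * Ci * e1 tau * PS (PSD a) (e1 tau))%C. apply Cder_is_derive.
    destruct (upper_nbhd tau Ht) as [d [Hd Hn]].
    apply Cder_ext_loc with (fun u => PS a (e1 u)) d; auto.
    + intros u Hu. destruct (Hf u (Hn u Hu)) as [E _]. auto.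
    + apply (Cder_comp (PS a) e1); [apply Cder_e1|]. apply PS_der; auto. apply Cmod_e1_lt1; auto.
  - intros g Hg. apply (expansions_Gamma0 w f a b g); auto.
  - intros g Hg. destruct (expansions_cusps w f a b g Hw H Hg) as [c [Hc _]]. eauto.
Qed.

Lemma expansions_cusp_form w f a b : Nat.Even w -> expansions w f a b ->
  a O = 0%C -> b O = 0%C -> cusp_form 3 w f.
Proof.
  intros Hw H Ha Hb. split; [eapply expansions_modular; eauto|].
  intros g Hg. destruct (expansions_cusps w f a b g Hw H Hg) as [c [Hc Ec]].
  exists c. split; auto. destruct Ec; congruence.
Qed.

Lemma slash_id w f tau : slash w f (Tmat 0) tau = f tau.
Proof.
  unfold slash, moebius, autj. simpl.
  replace (0 * tau + 1)%C with (RtoC 1) by ring. rewrite Cpow_1_l.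
  replace ((1 * tau + 0) / 1)%C with tau by field. field.
Qed.

Lemma slash_S w f tau : upper tau -> slash w f (STmat 0) tau = (f (- / tau) / tau ^ w)%C.
Proof.
  intros Ht. assert (t0 : tau <> 0%C) by (apply upper_neq0; auto).
  unfold slash, moebius, autj. simpl.
  replace (1 * tau + 0)%C with tau by ring.
  replace ((0 * tau + -1) / tau)%C with (- / tau)%C by (field; auto). reflexivity.
Qed.

Lemma SL2Z_ST j : SL2Z (STmat j).
Proof. unfold SL2Z, STmat; cbn [ma mb mc md]. ring. Qed.

(** Translation by 1 multiplies c_n by z^n for a primitive cube root of unity z, so c_n = 0 unless 3
    divides n. *)
Lemma qexp3_decimate f c : has_qexp 3 f c -> (forall tau, upper tau -> f (tau + 1)%C = f tau) ->
  disc (fun n => c (3 * n)%nat) /\ forall tau, upper tau -> f tau = PS (fun n => c (3 * n)%nat) (e1 tau).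
Proof.
  intros H HT. apply has_qexp_PS in H; [|lia]. destruct H as [Dc Hc].
  assert (D3 : disc (fun n => c (3 * n)%nat)) by (apply disc_decimate; auto; lia).
  split; auto. set (z := Cexp (2 * PI * Ci * / INR 3)).
  assert (Ez : qh 3 1 = z).
  { unfold qh, z. f_equal. unfold Cdiv. ring. }
  assert (Hz : Cmod z = 1).
  { unfold z. rewrite Cmod_Cexp, <- exp_0. f_equal.
    rewrite <- RtoC_inv by (simpl; lra). unfold Cmult, RtoC, Ci. simpl. ring. }
  assert (Hz3 : (z ^ 3)%C = 1%C).
  { rewrite <- Ez, qh_pow by lia. apply (e1_IZR 1). }
  assert (Dz : disc (fun n => (c n * z ^ n)%C)).
  { intros r Hr. eapply summable_le; [|apply (Dc r Hr)]. intros n.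
    rewrite Cmod_mult, Cmod_pow, Hz, pow1. lra. }
  assert (E : forall n, (c n * z ^ n)%C = c n).
  { apply (PS_inj_qh 3); auto; try lia. intros tau Ht. rewrite <- (Hc tau Ht), <- (HT tau Ht).
    pose proof (upper_shift tau 1 Ht) as Hs. rewrite (Hc _ Hs), qh_add, Ez.
    apply PS_eq. eapply Cser_ext; [|apply PS_ser; [exact Dc|]].
    - intros n. simpl. rewrite Cpow_mult_l. ring.
    - rewrite Cmod_mult, Hz, Rmult_1_r. apply Cmod_qh; auto; lia. }
  assert (Ec : forall n, dilate 3 (fun n => c (3 * n)%nat) n = c n).
  { intros n. unfold dilate. pose proof (Nat.div_mod_eq n 3) as En.
    destruct (Nat.eqb_spec (n mod 3) 0) as [h|h].
    - f_equal. lia.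
    - specialize (E n).
      assert (Nz : (z ^ n)%C <> 1%C).
      { rewrite En, Cpow_add_r, Cpow_mult_r, Hz3, Cpow_1_l, Cmult_1_l.
        pose proof (Nat.mod_upper_bound n 3). apply root_pow_neq1; lia. }
      destruct (classic (c n = 0%C)) as [z0|z0]; [auto|].
      exfalso. apply Nz. replace (z ^ n)%C with (/ c n * (c n * z ^ n))%C by (field; auto).
      rewrite E. field. auto. }
  intros tau Ht. rewrite (Hc tau Ht), <- (PS_ext _ _ _ Ec), PS_dilate by
    (auto; try lia; apply Cmod_qh; auto; lia).
  rewrite qh_pow by lia. reflexivity.
Qed.

(** With [expansions_modular] this makes modularity in even weight a matter of two power series. *)
Lemma modular_expansions w f : modular_form 3 w f -> exists a b, expansions w f a b.
Proof.
  intros [_ HI HC].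
  destruct (HC (Tmat 0) (SL2Z_Tmat 0)) as [c Hc].
  destruct (HC (STmat 0) (SL2Z_ST 0)) as [b Hb].
  assert (Hc' : has_qexp 3 f c).
  { intros tau Ht. specialize (Hc tau Ht). rewrite slash_id in Hc. exact Hc. }
  destruct (qexp3_decimate f c Hc') as [Da Ha].
  { intros tau Ht. assert (G : Gamma0 3 (Tmat 1)) by (split; [apply SL2Z_Tmat|exists 0%Z; reflexivity]).
    specialize (HI _ G tau Ht). unfold slash, moebius, autj in HI. simpl in HI.
    replace (0 * tau + 1)%C with (RtoC 1) in HI by ring. rewrite Cpow_1_l in HI.
    replace ((1 * tau + 1) / 1)%C with (tau + 1)%C in HI by field. rewrite <- HI. field. }
  apply has_qexp_PS in Hb; [|lia]. destruct Hb as [Db Hb].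
  exists (fun n => c (3 * n)%nat), b. repeat split; auto.
  specialize (Hb tau H). rewrite slash_S in Hb by auto. rewrite <- Hb.
  assert (t0 : tau <> 0%C) by (apply upper_neq0; auto).
  pose proof (Cpow_nz _ w t0). field. auto.
Qed.

Lemma expansions_qexp w f a b : expansions w f a b -> has_qexp 1 f a.
Proof.
  intros (Da & _ & H). apply has_qexp_PS; [lia|]. split; auto. intros tau Ht.
  rewrite qh1_e1. apply H; auto.
Qed.

Lemma expansions_qexp_S w f a b : expansions w f a b -> has_qexp 3 (slash w f (STmat 0)) b.
Proof.
  intros (_ & Db & H). apply has_qexp_PS; [lia|]. split; auto. intros tau Ht.
  rewrite slash_S by auto. destruct (H tau Ht) as [_ ->].
  assert (t0 : tau <> 0%C) by (apply upper_neq0; auto).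
  pose proof (Cpow_nz _ w t0). field. auto.
Qed.

Lemma cusp_form_expansions w f : cusp_form 3 w f ->
  exists a b, expansions w f a b /\ a O = 0%C /\ b O = 0%C.
Proof.
  intros [Hm Hc]. destruct (modular_expansions w f Hm) as [a [b H]]. exists a, b.
  split; auto. pose proof H as (Da & Db & Hf). split.
  - destruct (Hc (Tmat 0) (SL2Z_Tmat 0)) as [c [Hc1 Hc0]].
    rewrite <- Hc0. transitivity (dilate 3 a O); [reflexivity|].
    apply (qexp_unique 3 (slash w f (Tmat 0))); auto; try lia.
    apply has_qexp_PS; [lia|]. split; [apply disc_dilate; auto; lia|]. intros tau Ht.
    rewrite PS_dilate by (auto; try lia; apply Cmod_qh; auto; lia).
    rewrite qh_pow, slash_id by lia. apply Hf; auto.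
  - destruct (Hc (STmat 0) (SL2Z_ST 0)) as [c [Hc1 Hc0]].
    rewrite <- Hc0. apply (qexp_unique 3 (slash w f (STmat 0))); auto; try lia.
    eapply expansions_qexp_S; eauto.
Qed.

(** * Eta quotients and the valence bound *)

Lemma expansions_lincomb w f g a b c d x y : expansions w f a b -> expansions w g c d ->
  expansions w (fun tau => x * f tau + y * g tau)%C
    (fun n => x * a n + y * c n)%C (fun n => x * b n + y * d n)%C.
Proof.
  intros (Da & Db & Hf) (Dc & Dd & Hg).
  split; [apply disc_plus; apply disc_scal; auto|].
  split; [apply disc_plus; apply disc_scal; auto|].
  intros tau Ht. destruct (Hf tau Ht) as [E1 E2]. destruct (Hg tau Ht) as [E3 E4].
  pose proof (Cmod_e1_lt1 tau Ht) as Hq.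
  assert (Hq3 : Cmod (qh 3 tau) < 1) by (apply Cmod_qh; auto).
  rewrite (PS_plus (fun n => x * a n)%C (fun n => y * c n)%C), !PS_scal by (auto using disc_scal).
  rewrite (PS_plus (fun n => x * b n)%C (fun n => y * d n)%C), !PS_scal by (auto using disc_scal).
  rewrite E1, E2, E3, E4. split; ring.
Qed.

Lemma expansions_ext w f g a b : (forall tau, upper tau -> f tau = g tau) ->
  expansions w f a b -> expansions w g a b.
Proof.
  intros E (Da & Db & H). split; auto. split; auto. intros tau Ht.
  rewrite <- !E by (auto using upper_inv). auto.
Qed.

(** The logarithm of prod (1 - q^n)^x (1 - q^(3n))^y. *)
Definition etalog2 (x y : C) (n : nat) : C := (x * etalog n + y * dilate 3 etalog n)%C.

Lemma disc_etalog2 x y : disc (etalog2 x y).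
Proof. apply disc_plus; apply disc_scal; [|apply disc_dilate; [lia|]]; apply disc_etalog. Qed.

Lemma PS_etalog2 x y q : Cmod q < 1 ->
  PS (etalog2 x y) q = (x * PS etalog q + y * PS etalog (q ^ 3))%C.
Proof.
  intros Hq. assert (D3 : disc (dilate 3 etalog)) by (apply disc_dilate; [lia|apply disc_etalog]).
  pose proof disc_etalog as D. unfold etalog2.
  rewrite (PS_plus (fun n => x * etalog n)%C (fun n => y * dilate 3 etalog n)%C) by (auto using disc_scal).
  rewrite !PS_scal, PS_dilate by (auto; lia). reflexivity.
Qed.

Lemma e1_mul3 tau : e1 (3 * tau) = (e1 tau ^ 3)%C.
Proof. unfold e1. rewrite Cexp_pow. f_equal. simpl INR. rewrite !RtoC_plus. ring. Qed.

(** The leading power of q is (x + 3y)/24: it is 1 for (6, 6), 2 for (-6, 18) and 0 for (18, -6),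
    the orders at the cusps needed below. *)
Lemma eta_quotient_exp x y tau : upper tau ->
  Cexp (x * eta_log tau + y * eta_log (3 * tau))
  = (Cexp (2 * PI * Ci * tau * ((x + 3 * y) / 24)) * PS (exps (etalog2 x y)) (e1 tau))%C.
Proof.
  intros Ht. pose proof (Cmod_e1_lt1 tau Ht) as Hq.
  rewrite PS_exps by (auto using disc_etalog2). rewrite PS_etalog2 by auto.
  rewrite <- Cexp_add. f_equal. unfold eta_log. rewrite e1_mul3. field.
Qed.

Lemma upper_mul3 tau : upper tau -> upper (3 * tau)%C.
Proof. apply upper_scal. lra. Qed.

Lemma upper_div3 tau : upper tau -> upper (tau / 3)%C.
Proof.
  intros H. replace (tau / 3)%C with (RtoC (/ 3) * tau)%C by (rewrite RtoC_inv by lra; field).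
  apply upper_scal; auto. lra.
Qed.

Lemma eta_pow_log tau n : upper tau -> (eta tau ^ n)%C = Cexp (INR n * eta_log tau).
Proof. intros Ht. rewrite eta_eta_log, Cexp_pow by auto. reflexivity. Qed.

Lemma eta_S_pow tau n : upper tau ->
  (eta (- / tau) ^ (2 * n) = (- Ci * tau) ^ n * eta tau ^ (2 * n))%C.
Proof.
  intros Ht. rewrite !Cpow_mult_r, <- Cpow_mult_l. f_equal.
  simpl. rewrite !Cmult_1_r. apply eta_S; auto.
Qed.

Lemma e1_div3 tau : e1 (tau / 3) = qh 3 tau.
Proof. rewrite <- qh3_mul3. f_equal. field. Qed.

Lemma neg_inv_mul3 (tau : C) : tau <> 0%C -> (3 * - / tau)%C = (- / (tau / 3))%C.
Proof. intros H. field. auto. Qed.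

(** * Expansions of H and of Delta_3 at both cusps *)

Definition H6 (tau : C) : C := (eta tau ^ 6 * eta (3 * tau) ^ 6)%C.
Definition h6 : nat -> C := exps (etalog2 6 6).

Lemma disc_h6 : disc h6.
Proof. apply disc_exps, disc_etalog2. Qed.

Lemma INR_6 : RtoC (INR 6) = 6%C.
Proof. f_equal. simpl. ring. Qed.

Lemma INR_18 : RtoC (INR 18) = 18%C.
Proof. f_equal. simpl. ring. Qed.

Lemma H6_PS tau : upper tau -> H6 tau = (e1 tau * PS h6 (e1 tau))%C.
Proof.
  intros Ht. unfold H6. rewrite !eta_pow_log, <- Cexp_add, INR_6 by (auto using upper_mul3).
  rewrite eta_quotient_exp by auto. f_equal. unfold e1. f_equal. field.
Qed.

(** Each sixth power contributes a cube: the sign is (-i)^6, and 27 is the cube of the 3 in tau /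
    3. *)
Lemma H6_S tau : upper tau -> H6 (- / tau) = (- (tau ^ 6 / 27) * H6 (tau / 3))%C.
Proof.
  intros Ht. pose proof (upper_neq0 tau Ht) as t0. unfold H6.
  rewrite neg_inv_mul3 by auto.
  pose proof (eta_S_pow tau 3 Ht) as E1. pose proof (eta_S_pow (tau / 3) 3 (upper_div3 tau Ht)) as E2.
  change (2 * 3)%nat with 6%nat in E1, E2. rewrite E1, E2.
  replace (3 * (tau / 3))%C with tau by field.
  set (X := (eta tau ^ 6)%C). set (Y := (eta (tau / 3) ^ 6)%C).
  replace ((- Ci * tau) ^ 3 * X * ((- Ci * (tau / 3)) ^ 3 * Y))%C
    with ((Ci * Ci) * (Ci * Ci) * (Ci * Ci) * (tau ^ 6 / 27) * (Y * X))%C by field.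
  rewrite Ci_sqr. field.
Qed.

Lemma H6_expansions : expansions 6 H6 (unshift 0 h6) (fun n => - / 27 * unshift 0 h6 n)%C.
Proof.
  assert (D : disc (unshift 0 h6)) by apply disc_unshift, disc_h6.
  assert (E : forall tau, upper tau -> H6 tau = PS (unshift 0 h6) (e1 tau)).
  { intros tau Ht. rewrite H6_PS, PS_unshift by (auto using disc_h6, Cmod_e1_lt1). ring. }
  split; auto. split; [apply disc_scal; auto|]. intros tau Ht. split; auto.
  rewrite H6_S, E, e1_div3, PS_scal by (auto using upper_div3; apply Cmod_qh; auto). field.
Qed.

Lemma H6_neq0 tau : upper tau -> H6 tau <> 0%C.
Proof.
  intros Ht. unfold H6. rewrite !eta_pow_log by (auto using upper_mul3).
  apply Cmult_neq_0; apply Cexp_neq0.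
Qed.

Definition d3 : nat -> C := exps (etalog2 (-6) 18).
Definition d3S : nat -> C := exps (etalog2 18 (-6)).

Lemma eta_neq0 tau : upper tau -> eta tau <> 0%C.
Proof. intros Ht. rewrite eta_eta_log by auto. apply Cexp_neq0. Qed.

(** At 0 the two eta factors change places, which gives [d3S] in the parameter [qh 3] with no
    leading power of it. The constant comes from (-i/3)^9 / (-i)^3, and 19683 = 3^9. *)
Lemma Delta3_expansions : expansions 6 Delta3 (unshift 0 (unshift 0 d3)) (fun n => - / 19683 * d3S n)%C.
Proof.
  assert (D1 : disc d3) by apply disc_exps, disc_etalog2.
  assert (D2 : disc d3S) by apply disc_exps, disc_etalog2.
  split; [auto using disc_unshift|]. split; [apply disc_scal; auto|]. intros tau Ht. split.
  - rewrite !PS_unshift by (auto using disc_unshift, Cmod_e1_lt1).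
    unfold Delta3, Cdiv. rewrite !eta_pow_log, <- Cexp_opp, <- Cexp_add, INR_6, INR_18 by (auto using upper_mul3).
    replace (18 * eta_log (3 * tau) + - (6 * eta_log tau))%C
      with (-6 * eta_log tau + 18 * eta_log (3 * tau))%C
      by (replace (RtoC (-6)) with (- RtoC 6)%C by (rewrite <- RtoC_opp; reflexivity); ring).
    rewrite eta_quotient_exp by auto.
    replace (Cexp (2 * PI * Ci * tau * ((-6 + 3 * 18) / 24))) with (e1 tau * e1 tau)%C.
    + unfold d3. ring.
    + rewrite <- e1_add. unfold e1. f_equal.
      replace (RtoC (-6)) with (- RtoC 6)%C by (rewrite <- RtoC_opp; reflexivity). field.
  - pose proof (upper_neq0 tau Ht) as t0. pose proof (upper_div3 tau Ht) as H3.
    assert (Hq : Cmod (qh 3 tau) < 1) by (apply Cmod_qh; auto).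
    rewrite PS_scal by auto. unfold Delta3. rewrite neg_inv_mul3 by auto.
    pose proof (eta_S_pow tau 3 Ht) as E1. pose proof (eta_S_pow (tau / 3) 9 H3) as E2.
    change (2 * 3)%nat with 6%nat in E1. change (2 * 9)%nat with 18%nat in E2. rewrite E1, E2.
    assert (E : (eta (tau / 3) ^ 18)%C = (eta tau ^ 6 * PS d3S (qh 3 tau))%C).
    { pose proof (eta_quotient_exp 18 (-6) (tau / 3) H3) as E.
      replace (3 * (tau / 3))%C with tau in E by field.
      replace (RtoC (-6)) with (- RtoC 6)%C in E by (rewrite <- RtoC_opp; reflexivity).
      replace (2 * PI * Ci * (tau / 3) * ((18 + 3 * - (6)) / 24))%C with (RtoC 0) in E by field.
      rewrite Cexp_0, e1_div3 in E.
      replace (RtoC (-6)) with (- RtoC 6)%C in * by (rewrite <- RtoC_opp; reflexivity).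
      unfold d3S. replace (RtoC (-6)) with (- RtoC 6)%C by (rewrite <- RtoC_opp; reflexivity).
      rewrite !eta_pow_log, INR_6, INR_18 by auto. rewrite <- (Cmult_1_l (PS _ _)), <- E, <- Cexp_add.
      f_equal. ring. }
    rewrite E. set (X := (eta tau ^ 6)%C). set (Y := PS d3S (qh 3 tau)).
    assert (X0 : X <> 0%C) by (apply Cpow_nz, eta_neq0; auto).
    assert (C0 : Ci <> 0%C) by (intros Z; apply (f_equal Im) in Z; simpl in Z; lra).
    replace ((- Ci * (tau / 3)) ^ 9 * (X * Y) / ((- Ci * tau) ^ 3 * X))%C
      with ((Ci * Ci) * (Ci * Ci) * (Ci * Ci) * (tau ^ 6 / 19683) * Y)%C by (field; auto).
    rewrite Ci_sqr. field.
Qed.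

(** * Reduction by the Fricke involution *)

Lemma exp_half_PI : exp (- (2 * PI * (1 / 4))) <= 1 / 3.
Proof.
  (* exp (3/4) >= 7/4 and (7/4)^2 > 3, while 3/2 < pi/2. *)
  assert (H : 3 <= exp (3 / 4) * exp (3 / 4)).
  { pose proof (exp_ineq1_le (3 / 4)). nra. }
  rewrite <- exp_plus in H. rewrite exp_Ropp.
  replace (1 / 3) with (/ 3) by field. apply Rinv_le_contravar; [lra|].
  eapply Rle_trans; [apply H|]. pose proof PI2_3_2.
  destruct (Req_dec (3 / 4 + 3 / 4) (2 * PI * (1 / 4))) as [->|]; [lra|].
  apply Rlt_le, exp_increasing. lra.
Qed.

Lemma e1_small tau : 1 / 4 <= Im tau -> Cmod (e1 tau) <= 1 / 3.
Proof.
  intros H. rewrite Cmod_e1. eapply Rle_trans; [|apply exp_half_PI].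
  pose proof PI_RGT_0.
  destruct (Req_dec (Im tau) (1 / 4)) as [->|]; [lra|].
  apply Rlt_le, exp_increasing. nra.
Qed.

(** After a translation |Re| <= 1/2. If also Im < 1/4, then 3 |tau|^2 <= 3 (1/4 + 1/16) = 15/16, so
    the involution multiplies Im by at least 16/15; finitely many rounds reach 1/4. *)
Lemma Fricke_reduction (phi : C -> C) :
  (forall tau n, upper tau -> phi (tau + IZR n)%C = phi tau) ->
  (forall tau, upper tau -> phi (- / (3 * tau))%C = phi tau) ->
  forall tau, upper tau -> exists tau', upper tau' /\ 1 / 4 <= Im tau' /\ phi tau' = phi tau.
Proof.
  intros HT HW.
  assert (H : forall k tau, upper tau -> (15 / 16) ^ k * (1 / 4) <= Im tau ->
    exists tau', upper tau' /\ 1 / 4 <= Im tau' /\ phi tau' = phi tau).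
  { induction k; intros tau Ht Hk.
    - exists tau. simpl in Hk. repeat split; auto. lra.
    - destruct (Rle_lt_dec (1 / 4) (Im tau)) as [h|h]; [exists tau; auto|].
      set (n := Int_part (Re tau + / 2)). pose proof (base_Int_part (Re tau + / 2)) as [B1 B2].
      fold n in B1, B2. pose proof (upper_shift tau (- n) Ht) as Hs.
      set (s := (tau + IZR (- n))%C) in *.
      assert (Es : Re s = Re tau - IZR n /\ Im s = Im tau).
      { unfold s. rewrite opp_IZR. destruct tau; simpl. split; ring. }
      destruct Es as [Es1 Es2].
      assert (Hw : upper (- / (3 * s))%C) by (apply upper_inv, upper_mul3; auto).
      destruct (IHk _ Hw) as [t [Ht1 [Ht2 Ht3]]].
      { unfold upper in Ht. destruct s as [x y]. simpl in Es1, Es2.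
        assert (Hy : 0 < y) by lra.
        replace (Im (- / (3 * (x, y)))%C) with (y / (3 * (x * x + y * y)))
          by (unfold Cinv, Copp, Cmult, RtoC; simpl; field; nra).
        assert (Hx : x * x <= 1 / 4) by nra. assert (Hy2 : y * y <= 1 / 16) by nra.
        simpl pow in Hk.
        apply Rmult_le_reg_r with (3 * (x * x + y * y)); [nra|].
        replace (y / (3 * (x * x + y * y)) * (3 * (x * x + y * y))) with y by (field; nra).
        pose proof (pow_lt (15 / 16) k ltac:(lra)).
        apply Rle_trans with ((15 / 16) ^ k * (1 / 4) * (15 / 16)); [|lra].
        apply Rmult_le_compat_l; lra. }
      exists t. repeat split; auto. rewrite Ht3, HW by auto. unfold s. apply HT; auto. }
  intros tau Ht. unfold upper in Ht.
  destruct (pow_lt_1_zero (15 / 16) ltac:(rewrite Rabs_pos_eq; lra) (Im tau) Ht) as [N HN].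
  apply (H N); auto. specialize (HN N (le_n N)).
  rewrite Rabs_pos_eq in HN by (apply pow_le; lra).
  pose proof (pow_le (15 / 16) N ltac:(lra)). lra.
Qed.

(* By the reduction every value is taken where |q| <= 1/3; as the constant coefficient vanishes,
   the Cauchy estimates then improve a bound M to the bound M/3 + M/9 + ... = M/2. *)
Lemma Fricke_invariant_zero (a : nat -> C) : disc a -> a O = 0%C ->
  (forall tau, upper tau -> PS a (e1 (- / (3 * tau))) = PS a (e1 tau)) ->
  forall tau, upper tau -> PS a (e1 tau) = 0%C.
Proof.
  intros Da a0 HW.
  assert (Red := Fricke_reduction (fun tau => PS a (e1 tau))
    (fun tau n _ => f_equal (PS a) (e1_shift tau n)) HW). cbv beta in Red.
  destruct (PS_bounded a (1 / 3) ltac:(lra) Da) as [B HB].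
  assert (H : forall n tau, upper tau -> Cmod (PS a (e1 tau)) <= B * (/ 2) ^ n).
  { induction n; intros tau Ht; destruct (Red tau Ht) as [t [Ht1 [Ht2 <-]]]; pose proof (e1_small t Ht2) as Hs.
    - simpl. rewrite Rmult_1_r. auto.
    - set (M := B * (/ 2) ^ n) in *.
      assert (Ha : forall m, Cmod (a m) <= M).
      { apply Cauchy_estimate; auto. intros q Hq0 Hq.
        destruct (qh_surj 1 q ltac:(lia) Hq0 Hq) as [s [Hs1 Hs2]]. rewrite qh1_e1 in Hs2.
        rewrite <- Hs2. auto. }
      assert (HM : 0 <= M) by (eapply Rle_trans; [apply Cmod_ge_0|apply (Ha O)]).
      replace (B * (/ 2) ^ S n) with (M / 2) by (unfold M; simpl; field).
      apply PS_bound with (1 / 3); auto; [lra|]. intros m. apply rsum_shift_le.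
      + rewrite a0, Cmod_0. ring.
      + intros i. apply Rmult_le_pos; [apply Cmod_ge_0|apply pow_le; lra].
      + intros l. apply Rle_trans with (M / 3 * rsum (fun i => (1 / 3) ^ i) l).
        * rewrite <- rsum_scal. apply rsum_le. intros i _. simpl pow.
          pose proof (pow_le (1 / 3) i ltac:(lra)). specialize (Ha (S i)).
          pose proof (Cmod_ge_0 (a (S i))). nra.
        * pose proof (rsum_geom (1 / 3) l ltac:(lra)).
          replace (/ (1 - 1 / 3)) with (3 / 2) in H by field. nra. }
  intros tau Ht. apply Cmod_small_0. intros eps He.
  assert (HB0 : 0 <= B).
  { specialize (H O tau Ht). simpl in H. pose proof (Cmod_ge_0 (PS a (e1 tau))). lra. }
  destruct (pow_lt_1_zero (/ 2) ltac:(rewrite Rabs_pos_eq; lra) (eps / (B + 1))) as [N HN].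
  { apply Rdiv_lt_0_compat; lra. }
  specialize (HN N (le_n N)). rewrite Rabs_pos_eq in HN by (apply pow_le; lra).
  eapply Rle_trans; [apply (H N tau Ht)|].
  apply Rle_trans with ((B + 1) * (eps / (B + 1))).
  - apply Rmult_le_compat; try lra. apply pow_le; lra.
  - right. field. lra.
Qed.

(** * The valence bound *)

Fixpoint raise (m : nat) (a : nat -> C) : nat -> C :=
  match m with O => a | S k => unshift 0 (raise k a) end.

Lemma disc_raise m a : disc a -> disc (raise m a).
Proof. intros H. induction m; simpl; auto using disc_unshift. Qed.

Lemma PS_raise m a q : disc a -> Cmod q < 1 -> PS (raise m a) q = (q ^ m * PS a q)%C.
Proof.
  intros Ha Hq. induction m; [simpl; ring|]. cbn [raise].
  rewrite PS_unshift, IHm, Cpow_S by (auto using disc_raise). ring.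
Qed.

Lemma raise_eq m (a : nat -> C) : (forall n, (n < m)%nat -> a n = 0%C) ->
  forall n, raise m (fun i => a (m + i)%nat) n = a n.
Proof.
  revert a. induction m; intros a H n; [reflexivity|].
  destruct n; [symmetry; apply H; lia|]. simpl.
  apply (IHm (fun i => a (S i))). intros i Hi. apply H. lia.
Qed.

Lemma disc_drop m (a : nat -> C) : disc a -> disc (fun i => a (m + i)%nat).
Proof.
  induction m; intros Ha; [exact Ha|].
  specialize (IHm Ha). apply disc_shift in IHm.
  eapply disc_ext; [|exact IHm]. intros n. cbv beta. f_equal. lia.
Qed.

Lemma conv_leading (a b : nat -> C) i j : (forall n, (n < i)%nat -> a n = 0%C) ->
  (forall n, (n < j)%nat -> b n = 0%C) -> conv a b (i + j) = (a i * b j)%C.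
Proof.
  intros Ha Hb. unfold conv. replace (S (i + j)) with (i + S j)%nat by lia.
  rewrite psum_add, psum_first.
  rewrite (psum_ext _ (fun _ => 0%C)), psum_0.
  2:{ intros n Hn. rewrite Ha by auto. ring. }
  rewrite (psum_ext (fun l => a (i + S l)%nat * b (i + j - (i + S l))%nat)%C (fun _ => 0%C)), psum_0.
  2:{ intros n Hn. rewrite (Hb (i + j - (i + S n))%nat) by lia. ring. }
  replace (i + j - (i + 0))%nat with j by lia. rewrite Nat.add_0_r. ring.
Qed.

Lemma first_nonzero (a : nat -> C) : ~ (forall n, a n = 0%C) ->
  exists i, a i <> 0%C /\ forall n, (n < i)%nat -> a n = 0%C.
Proof.
  intros H. apply not_all_ex_not in H. destruct H as [n Hn].
  revert Hn. induction n as [n IH] using lt_wf_ind. intros Hn.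
  destruct (classic (exists m, (m < n)%nat /\ a m <> 0%C)) as [[m [Hm Hm0]]|h]; [eauto|].
  exists n. split; auto. intros m Hm. apply NNPP. intros Z. apply h. eauto.
Qed.

(** Otherwise the product of the two lowest coefficients would be a nonzero coefficient of the
    product. *)
Lemma PS_domain (a b : nat -> C) : disc a -> disc b ->
  (forall q : C, q <> 0%C -> Cmod q < 1 -> (PS a q * PS b q)%C = 0%C) ->
  (forall n, a n = 0%C) \/ (forall n, b n = 0%C).
Proof.
  intros Da Db H. apply NNPP. intros Z. apply not_or_and in Z. destruct Z as [Za Zb].
  destruct (first_nonzero a Za) as [i [Hi Hi']]. destruct (first_nonzero b Zb) as [j [Hj Hj']].
  pose proof (PS_unique (conv a b) (disc_conv _ _ Da Db)) as U.
  specialize (U ltac:(intros q Hq0 Hq; rewrite PS_conv; auto) (i + j)%nat).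
  rewrite conv_leading in U by auto. revert U. apply Cmult_neq_0; auto.
Qed.

(* The product of f with its Fricke conjugate, cubed, has the same weight as H6^(2k),
   which vanishes only at the cusps, to order 2k. *)
Lemma valence k f a b m m' : expansions (2 * k) f a b ->
  (forall n, (n < m)%nat -> a n = 0%C) -> (forall n, (n < m')%nat -> b n = 0%C) ->
  (2 * k < 3 * (m + m'))%nat -> forall tau, upper tau -> f tau = 0%C.
Proof.
  intros (Da & Db & Hf) Ha Hb Hk.
  set (a' := fun i => a (m + i)%nat). set (b' := fun i => b (m' + i)%nat).
  assert (Da' : disc a') by apply disc_drop, Da. assert (Db' : disc b') by apply disc_drop, Db.
  set (t := conv a' b'). assert (Dt : disc t) by (apply disc_conv; auto).
  (* [exps l] is H^(-2k) with its power of q removed. *)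
  set (l := fun n => (- INR (2 * k) * etalog2 6 6 n)%C).
  assert (Dl : disc l) by apply disc_scal, disc_etalog2.
  set (v := conv (conv t (conv t t)) (exps l)).
  assert (Dv : disc v) by (repeat apply disc_conv; auto using disc_exps).
  (* The power of q left over is 3(m + m') - 2k, positive by [Hk]. Written as a successor, it makes
     the constant coefficient of [N] reduce to 0. *)
  set (p := (3 * (m + m') - 2 * k - 1)%nat).
  set (N := raise (S p) v). assert (DN : disc N) by (apply disc_raise; auto).
  (* [PS b] at [e1 tau] is the expansion at 0 taken at 3 tau, so this is f times its Fricke
     conjugate. *)
  set (g := fun q => (PS a q * PS b q)%C).
  assert (E : forall tau, upper tau -> (PS N (e1 tau) * H6 tau ^ (2 * k))%C = (g (e1 tau) ^ 3)%C).
  { intros tau Ht. pose proof (Cmod_e1_lt1 tau Ht) as Hq. set (q := e1 tau) in *.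
    unfold N. rewrite PS_raise by auto. unfold v. rewrite !PS_conv, PS_exps by (auto using disc_conv, disc_exps).
    unfold g.
    rewrite <- (PS_ext _ _ q (raise_eq m a Ha)), <- (PS_ext _ _ q (raise_eq m' b Hb)), !PS_raise by auto.
    fold a' b'. unfold t. rewrite PS_conv by auto.
    rewrite H6_PS by auto. fold q. unfold h6. rewrite PS_exps by (auto using disc_etalog2).
    unfold l. rewrite PS_scal by (auto using disc_etalog2).
    set (L := PS (etalog2 6 6) q). set (A := PS a' q). set (B := PS b' q).
    rewrite Cpow_mult_l, Cexp_pow.
    replace (q ^ S p * (A * B * (A * B * (A * B)) * Cexp (- INR (2 * k) * L)) * (q ^ (2 * k) * Cexp (INR (2 * k) * L)))%C
      with (q ^ S p * q ^ (2 * k) * (A * B * (A * B * (A * B))) * (Cexp (- INR (2 * k) * L) * Cexp (INR (2 * k) * L)))%C by ring.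
    rewrite <- Cexp_add, <- Cpow_add_r.
    replace (- INR (2 * k) * L + INR (2 * k) * L)%C with (RtoC 0) by ring. rewrite Cexp_0.
    replace (S p + 2 * k)%nat with ((m + m') * 3)%nat by lia.
    rewrite Cpow_mult_r, Cpow_add_r. simpl. ring. }
  assert (EW : forall tau, upper tau -> PS N (e1 (- / (3 * tau))) = PS N (e1 tau)).
  { intros tau Ht. pose proof (upper_neq0 tau Ht) as t0.
    pose proof (upper_mul3 tau Ht) as H3. pose proof (upper_inv _ H3) as HW.
    pose proof (E tau Ht) as E1. pose proof (E _ HW) as E2.
    pose proof (H6_S _ H3) as E3. replace (3 * tau / 3)%C with tau in E3 by field.
    replace (- ((3 * tau) ^ 6 / 27))%C with (- (27) * tau ^ 6)%C in E3 by field.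
    assert (Ga : PS a (e1 (- / (3 * tau))) = ((3 * tau) ^ (2 * k) * PS b (e1 tau))%C).
    { destruct (Hf _ HW) as [<- _]. destruct (Hf _ H3) as [_ F]. rewrite F, qh3_mul3. reflexivity. }
    assert (Gb : PS b (e1 (- / (3 * tau))) = (tau ^ (2 * k) * PS a (e1 tau))%C).
    { pose proof (upper_inv _ Ht) as Hi. destruct (Hf _ Hi) as [_ F].
      replace (- / - / tau)%C with tau in F by (field; auto).
      replace (- / tau)%C with (3 * - / (3 * tau))%C in F by (field; auto). rewrite qh3_mul3 in F.
      destruct (Hf _ Ht) as [<- _]. rewrite F.
      rewrite Cmult_assoc, <- Cpow_mult_l.
      replace (tau * (3 * - / (3 * tau)))%C with (- RtoC 1)%C by (field; auto).
      rewrite Cpow_even_sign; [ring|exists k; auto|ring]. }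
    unfold g in E1, E2. rewrite Ga, Gb, E3 in E2.
    pose proof (H6_neq0 tau Ht) as h0.
    set (X := PS N (e1 tau)) in *. set (Y := PS N (e1 (- / (3 * tau)))) in *.
    set (h := H6 tau) in *. set (u := PS a (e1 tau)) in *. set (w := PS b (e1 tau)) in *.
    replace ((3 * tau) ^ (2 * k) * w * (tau ^ (2 * k) * u))%C with ((3 * tau * tau) ^ (2 * k) * (u * w))%C in E2
      by (rewrite !Cpow_mult_l; ring).
    rewrite (Cpow_mult_l _ (u * w)), <- E1, <- Cpow_mult_r, (Cpow_mult_l _ h) in E2.
    (* The automorphy factors of the cube of g and of H^(2k) agree: 27 tau^6 is the cube of 3 tau^2,
       and the exponent 2k is even. *)
    replace ((- (27) * tau ^ 6) ^ (2 * k))%C with ((3 * tau * tau) ^ (2 * k * 3))%C in E2.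
    2:{ rewrite (Nat.mul_comm (2 * k) 3), !Cpow_mult_r.
        replace (((3 * tau * tau) ^ 3) ^ 2)%C with ((- (27) * tau ^ 6) ^ 2)%C by ring.
        reflexivity. }
    set (Z := ((3 * tau * tau) ^ (2 * k * 3))%C) in *.
    assert (Z0 : Z <> 0%C).
    { apply Cpow_nz. repeat apply Cmult_neq_0; auto. apply RtoC_neq0; lra. }
    assert (P0 : (h ^ (2 * k))%C <> 0%C) by (apply Cpow_nz; auto).
    replace Y with (Y * (Z * h ^ (2 * k)) / (Z * h ^ (2 * k)))%C by (field; auto).
    rewrite E2. field. auto. }
  pose proof (Fricke_invariant_zero N DN eq_refl EW) as Z.
  assert (G0 : forall q : C, q <> 0%C -> Cmod q < 1 -> (PS a q * PS b q)%C = 0%C).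
  { intros q Hq0 Hq. destruct (qh_surj 1 q ltac:(lia) Hq0 Hq) as [tau [Ht Et]].
    rewrite qh1_e1 in Et. specialize (E tau Ht). rewrite (Z tau Ht), Et in E.
    apply NNPP. intros G. apply (Cpow_nz _ 3) in G. apply G. fold (g q). rewrite <- E. ring. }
  assert (P0 : forall (c : nat -> C) q, (forall n, c n = 0%C) -> PS c q = 0%C).
  { intros c q Hc. rewrite (PS_ext c PS0 q); [apply PS_PS0|]. intros n. rewrite Hc. reflexivity. }
  destruct (PS_domain a b Da Db G0) as [a0|b0]; intros tau Ht.
  - destruct (Hf tau Ht) as [-> _]. auto.
  - pose proof (upper_neq0 tau Ht) as t0. destruct (Hf _ (upper_inv tau Ht)) as [_ F].
    replace (- / - / tau)%C with tau in F by (field; auto). rewrite F, P0 by auto. ring.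
Qed.

(** * Cusp forms *)

Lemma conv_below (a b : nat -> C) i j n : (forall n, (n < i)%nat -> a n = 0%C) ->
  (forall n, (n < j)%nat -> b n = 0%C) -> (n < i + j)%nat -> conv a b n = 0%C.
Proof.
  intros Ha Hb Hn. unfold conv. rewrite (psum_ext _ (fun _ => 0%C)); [apply psum_0|].
  intros l Hl. destruct (Nat.lt_ge_cases l i) as [h|h].
  - rewrite Ha by auto. ring.
  - rewrite (Hb (n - l)%nat) by lia. ring.
Qed.

Lemma etalog2_0 x y : etalog2 x y 0 = 0%C.
Proof. unfold etalog2, dilate, etalog, lambert. simpl. ring. Qed.

Lemma etalog2_1 x y : etalog2 x y 1 = (- x)%C.
Proof.
  unfold etalog2, etalog, lambert. simpl psum. unfold dilate at 1 2. simpl. field.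
Qed.

Lemma exps_etalog2_0 x y : exps (etalog2 x y) 0 = 1%C.
Proof. rewrite exps_0, etalog2_0. apply Cexp_0. Qed.

Lemma h6_1 : h6 1 = (- (6))%C.
Proof.
  pose proof (exps_S (etalog2 6 6) 0) as E. unfold PSD, conv in E. simpl psum in E.
  simpl INR in E. rewrite exps_etalog2_0, etalog2_1 in E. unfold h6.
  transitivity (1 * exps (etalog2 6 6) 1)%C; [ring|]. rewrite E. ring.
Qed.

(** The expansions agree up to q^2, because 21 - 27 = -6 is the second coefficient of H. The
    difference has order at least 3 at infinity, and 6 < 3 * 3 in [valence]. *)
Lemma F63_1_eq_H6 E : is_E63_1 E -> forall tau, upper tau -> F63_1 E tau = H6 tau.
Proof.
  intros [HM [a0 [Ha0 [A0 [A1 A2]]]]] tau Ht.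
  destruct (modular_expansions 6 E HM) as [a [b HE]].
  pose proof (qexp_unique 1 E a a0 ltac:(lia) (expansions_qexp _ _ _ _ HE) Ha0) as Ea.
  pose proof (expansions_lincomb _ _ _ _ _ _ _ 1%C (- (27))%C HE Delta3_expansions) as H1.
  pose proof (expansions_lincomb _ _ _ _ _ _ _ 1%C (- (1))%C H1 H6_expansions) as H2.
  assert (Z : forall tau, upper tau -> (1 * (1 * E tau + - (27) * Delta3 tau) + - (1) * H6 tau)%C = 0%C).
  { apply (valence 3 _ _ _ 3 0 H2); [|intros; lia|lia].
    intros n Hn. rewrite Ea. destruct n as [|[|[|n]]]; [| | |lia]; cbn [unshift].
    - rewrite A0. ring.
    - rewrite A1. unfold h6. rewrite exps_etalog2_0. ring.
    - rewrite A2. unfold d3. rewrite exps_etalog2_0, h6_1. ring. }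
  specialize (Z tau Ht). unfold F63_1, E63_2.
  replace (E tau - 27 * Delta3 tau)%C
    with ((1 * (1 * E tau + - (27) * Delta3 tau) + - (1) * H6 tau) + H6 tau)%C by ring.
  rewrite Z. ring.
Qed.

Lemma expansions_mult w w' f g a b c d : expansions w f a b -> expansions w' g c d ->
  expansions (w + w') (fun tau => f tau * g tau)%C (conv a c) (conv b d).
Proof.
  intros (Da & Db & Hf) (Dc & Dd & Hg).
  split; [apply disc_conv; auto|]. split; [apply disc_conv; auto|].
  intros tau Ht. destruct (Hf tau Ht) as [E1 E2]. destruct (Hg tau Ht) as [E3 E4].
  rewrite !PS_conv by (auto using Cmod_e1_lt1; apply Cmod_qh; auto).
  rewrite E1, E2, E3, E4, Cpow_add_r. split; ring.
Qed.

Lemma H6_mult_cusp w g : Nat.Even w -> modular_form 3 w g ->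
  cusp_form 3 (6 + w) (fun tau => H6 tau * g tau)%C.
Proof.
  intros Hw Hg. destruct (modular_expansions w g Hg) as [c [d H]].
  pose proof (expansions_mult _ _ _ _ _ _ _ _ H6_expansions H) as HP.
  eapply expansions_cusp_form; [|exact HP| |].
  - destruct Hw as [k ->]. exists (3 + k)%nat. lia.
  - unfold conv. simpl. ring.
  - unfold conv. simpl. ring.
Qed.

(** The inverse of [h6] is the exponential of minus its logarithm, so it also converges on the whole
    disc. The vanishing constant terms of f cancel the simple zeros of H at both cusps, and -27
    inverts the factor -1/27 of H at 0. *)
Lemma cusp_div_H6 w f : Nat.Even w -> cusp_form 3 (6 + w) f -> modular_form 3 w (fun tau => f tau / H6 tau)%C.
Proof.
  intros Hw Hf. destruct (cusp_form_expansions _ f Hf) as [a [b [(Da & Db & H) [a0 b0]]]].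
  set (l := fun n => ((-1) * etalog2 6 6 n)%C).
  assert (Dl : disc l) by apply disc_scal, disc_etalog2.
  assert (Ei : forall q, Cmod q < 1 -> (PS (exps l) q * PS h6 q)%C = 1%C).
  { intros q Hq. unfold h6, l. rewrite !PS_exps, PS_scal, <- Cexp_add by (auto using disc_etalog2).
    rewrite <- Cexp_0. f_equal. ring. }
  assert (Eq : forall (c : nat -> C) (q : C), disc c -> c O = 0%C -> q <> 0%C -> Cmod q < 1 ->
     (PS c q / (q * PS h6 q))%C = PS (conv (fun n => c (S n)) (exps l)) q).
  { intros c q Dc c0 q0 Hq. rewrite PS_conv by (auto using disc_exps, disc_shift).
    rewrite (PS_shift c), c0 by auto. specialize (Ei q Hq).
    assert (P0 : PS h6 q <> 0%C).
    { intros Z. rewrite Z in Ei. apply (RtoC_neq0 1); [lra|]. rewrite <- Ei. ring. }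
    replace (PS (exps l) q) with (PS (exps l) q * PS h6 q / PS h6 q)%C by (field; auto).
    rewrite Ei. field. auto. }
  apply (expansions_modular w _ (conv (fun n => a (S n)) (exps l))
    (fun n => - (27) * conv (fun n => b (S n)) (exps l) n)%C Hw).
  split; [apply disc_conv; auto using disc_exps, disc_shift|].
  split; [apply disc_scal, disc_conv; auto using disc_exps, disc_shift|].
  intros tau Ht. destruct (H tau Ht) as [E1 E2].
  pose proof (upper_neq0 tau Ht) as t0. pose proof (Cmod_e1_lt1 tau Ht) as Hq.
  assert (Hq3 : Cmod (qh 3 tau) < 1) by (apply Cmod_qh; auto). split.
  - rewrite E1, H6_PS by auto. apply Eq; auto. apply e1_neq0.
  - rewrite PS_scal by (auto; apply disc_conv; auto using disc_exps, disc_shift).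
    rewrite <- Eq by (auto using qh_neq0).
    rewrite E2, H6_S, H6_PS, e1_div3, Cpow_add_r by (auto using upper_div3).
    assert (P0 : PS h6 (qh 3 tau) <> 0%C).
    { intros Z. specialize (Ei _ Hq3). rewrite Z in Ei. apply (RtoC_neq0 1); [lra|]. rewrite <- Ei. ring. }
    pose proof (qh_neq0 3 tau). pose proof (Cpow_nz tau w t0). field. auto.
Qed.

Lemma upper_Ci : upper Ci.
Proof. unfold upper. simpl. lra. Qed.

Lemma const_expansions : expansions 0 (fun _ => 1%C) PS1 PS1.
Proof.
  split; [apply disc_1|]. split; [apply disc_1|]. intros tau Ht.
  rewrite !PS_PS1 by (auto using Cmod_e1_lt1; apply Cmod_qh; auto). simpl. split; ring.
Qed.

(** The form minus its constant coefficient vanishes at infinity, which in weight 0 is already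
    beyond the valence bound. *)
Lemma weight_0_constant g : modular_form 3 0 g -> exists c : C, forall tau, upper tau -> g tau = c.
Proof.
  intros Hg. destruct (modular_expansions 0 g Hg) as [a [b H]]. exists (a O).
  intros tau Ht. pose proof (expansions_lincomb _ _ _ _ _ _ _ 1%C (- a O)%C H const_expansions) as H1.
  assert (Z := valence 0 _ _ _ 1 0 H1). cbv beta in Z.
  assert (Z' : (1 * g tau + - a O * 1)%C = 0%C).
  { apply Z; [|intros; lia|lia|auto]. intros n Hn. replace n with O by lia. simpl. ring. }
  replace (g tau) with (1 * g tau + - a O * 1 + a O)%C by ring. rewrite Z'. ring.
Qed.

Lemma lincomb_scale F B c tau : lincomb c (scale_family F B) tau = (F tau * lincomb c B tau)%C.
Proof.
  revert c. induction B; intros c; simpl; [ring|]. unfold scale_family in IHB. rewrite IHB. ring.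
Qed.

Lemma cusp_form_ext w f g : Nat.Even w -> (forall tau, upper tau -> f tau = g tau) -> cusp_form 3 w f -> cusp_form 3 w g.
Proof.
  intros Hw E Hf. destruct (cusp_form_expansions w f Hf) as [a [b [H [Ha Hb]]]].
  apply (expansions_cusp_form w g a b); auto. apply (expansions_ext w f); auto.
Qed.

(** Independence uses that H has no zero on the upper half plane; spanning is [cusp_div_H6]. *)
Lemma scale_family_basis F w B : Nat.Even w -> (forall tau, upper tau -> F tau = H6 tau) ->
  is_basis (modular_form 3 w) B -> is_basis (cusp_form 3 (6 + w)) (scale_family F B).
Proof.
  intros Hw HF [HB1 [HB2 HB3]].
  assert (Hw6 : Nat.Even (6 + w)) by (destruct Hw as [k ->]; exists (3 + k)%nat; lia).
  split; [|split].
  - intros b Hb. apply in_map_iff in Hb. destruct Hb as [g [<- Hg]].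
    apply (cusp_form_ext _ (fun tau => H6 tau * g tau)%C); auto.
    + intros tau Ht. rewrite HF by auto. reflexivity.
    + apply H6_mult_cusp; auto.
  - intros c Hc i Hi. unfold scale_family in Hi. rewrite length_map in Hi.
    apply (HB2 c); auto. intros tau Ht. specialize (Hc tau Ht). rewrite lincomb_scale, HF in Hc by auto.
    pose proof (H6_neq0 tau Ht) as h0.
    replace (lincomb c B tau) with (/ H6 tau * (H6 tau * lincomb c B tau))%C by (field; auto).
    rewrite Hc. ring.
  - intros f Hf. destruct (HB3 _ (cusp_div_H6 w f Hw Hf)) as [c Hc]. exists c.
    intros tau Ht. rewrite lincomb_scale, HF, <- Hc by auto.
    pose proof (H6_neq0 tau Ht). field. auto.
Qed.

Lemma valuation_unique f m n : valuation f m -> valuation f n -> m = n.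
Proof.
  intros [a [Ha [Ha0 Ha1]]] [b [Hb [Hb0 Hb1]]].
  pose proof (qexp_unique 1 f a b ltac:(lia) Ha Hb) as E.
  destruct (Nat.lt_trichotomy m n) as [h|[h|h]]; auto; exfalso.
  - apply Ha1. rewrite E. auto.
  - apply Hb1. rewrite <- E. auto.
Qed.

Lemma H6_qexp F : (forall tau, upper tau -> F tau = H6 tau) -> has_qexp 1 F (unshift 0 h6).
Proof.
  intros HF. apply (expansions_qexp 6 F _ (fun n => - / 27 * unshift 0 h6 n)%C).
  apply (expansions_ext 6 H6); [intros; symmetry; auto|apply H6_expansions].
Qed.

Lemma h6_leading : unshift 0 h6 1 = 1%C.
Proof. apply exps_etalog2_0. Qed.

Lemma has_qexp_mult f g a b : has_qexp 1 f a -> has_qexp 1 g b -> has_qexp 1 (fun tau => f tau * g tau)%C (conv a b).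
Proof.
  intros Hf Hg. apply has_qexp_PS in Hf; [|lia]. apply has_qexp_PS in Hg; [|lia].
  destruct Hf as [Da Hf], Hg as [Db Hg]. apply has_qexp_PS; [lia|].
  split; [apply disc_conv; auto|]. intros tau Ht. rewrite PS_conv by (auto; apply Cmod_qh; auto).
  rewrite Hf, Hg by auto. reflexivity.
Qed.

Lemma scale_qexp F b a n : (forall tau, upper tau -> F tau = H6 tau) -> has_qexp 1 b a ->
  (forall m, (m < n)%nat -> a m = 0%C) ->
  exists c, has_qexp 1 (fun tau => F tau * b tau)%C c /\
    (forall m, (m < S n)%nat -> c m = 0%C) /\ c (S n) = a n.
Proof.
  intros HF Ha H0. exists (conv (unshift 0 h6) a).
  assert (L : forall m, (m < 1)%nat -> unshift 0 h6 m = 0%C).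
  { intros m Hm. replace m with O by lia. reflexivity. }
  split; [apply has_qexp_mult; auto; apply H6_qexp; auto|]. split.
  - intros m Hm. apply (conv_below _ _ 1 n); auto.
  - change (S n) with (1 + n)%nat. rewrite conv_leading, h6_leading by auto. ring.
Qed.

Lemma scale_family_triangular F B : (forall tau, upper tau -> F tau = H6 tau) ->
  unitary_upper_triangular B -> unitary_upper_triangular (scale_family F B).
Proof.
  intros HF [HU HV]. split.
  - intros b Hb. apply in_map_iff in Hb. destruct Hb as [g [<- Hg]].
    destruct (HU g Hg) as [a [n [Ha [H0 H1]]]].
    destruct (scale_qexp F g a n HF Ha H0) as [c [Hc [Hc0 Hc1]]].
    exists c, (S n). rewrite Hc1. auto.
  - assert (V : forall i m, (i < length B)%nat ->
      valuation (nth i (scale_family F B) (fun _ => 0%C)) m ->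
      exists n, m = S n /\ valuation (nth i B (fun _ => 0%C)) n).
    { intros i m Hi Hm. set (b := nth i B (fun _ => 0%C)).
      assert (En : nth i (scale_family F B) (fun _ => 0%C) = (fun tau => F tau * b tau)%C).
      { unfold scale_family. set (s := fun (b : C -> C) (tau : C) => (F tau * b tau)%C).
        (* [map_nth] wants the image of the default; the change is harmless for an index in
           range. *)
        rewrite (nth_indep _ _ (s (fun _ => 0%C))) by (rewrite length_map; auto).
        rewrite map_nth. reflexivity. }
      rewrite En in Hm. destruct (HU b (nth_In _ _ Hi)) as [a [n [Ha [H0 H1]]]].
      assert (one0 : RtoC 1 <> 0%C) by (apply RtoC_neq0; lra).
      destruct (scale_qexp F b a n HF Ha H0) as [c [Hc [Hc0 Hc1]]].
      exists n. split.
      - apply (valuation_unique _ m (S n) Hm). exists c. rewrite Hc1, H1. auto.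
      - exists a. rewrite H1. auto. }
    intros i j m n Hij Hm Hn. unfold scale_family in Hij. rewrite length_map in Hij.
    destruct (V i m ltac:(lia) Hm) as [m' [-> Vm]]. destruct (V j n ltac:(lia) Hn) as [n' [-> Vn]].
    specialize (HV i j m' n' Hij Vm Vn). lia.
Qed.

(** * Finite bases from the filtration by the order at infinity *)

Definition order_ge (k j : nat) (f : C -> C) : Prop :=
  exists a b, expansions (2 * k) f a b /\ forall n, (n < j)%nat -> a n = 0%C.

Lemma order_ge_lincomb2 k j f g x y : order_ge k j f -> order_ge k j g ->
  order_ge k j (fun tau => x * f tau + y * g tau)%C.
Proof.
  intros [a [b [Hf Ha]]] [c [d [Hg Hc]]].
  exists (fun n => x * a n + y * c n)%C, (fun n => x * b n + y * d n)%C.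
  split; [apply expansions_lincomb; auto|]. intros n Hn. rewrite Ha, Hc by auto. ring.
Qed.

Lemma order_ge_0 k j : order_ge k j (fun _ => 0%C).
Proof.
  exists PS0, PS0. split; [|reflexivity]. split; [apply disc_0|]. split; [apply disc_0|].
  intros tau Ht. rewrite !PS_PS0. split; ring.
Qed.

Lemma order_ge_lincomb k j B : (forall b, In b B -> order_ge k j b) -> forall c, order_ge k j (lincomb c B).
Proof.
  induction B as [|b B IH]; intros HB c; [apply order_ge_0|].
  assert (H : order_ge k j (fun tau => c O * b tau + 1 * lincomb (fun i => c (S i)) B tau)%C).
  { apply order_ge_lincomb2; [apply HB; left; auto|]. apply IH. intros; apply HB; right; auto. }
  destruct H as [a [d [Hx Ha]]]. exists a, d. split; auto.
  eapply expansions_ext; [|exact Hx]. intros tau Ht. simpl. ring.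
Qed.

(* Descending induction on the order at oo; each step adds at most one basis element. *)
Lemma order_ge_basis k i : forall j, (i + j = 2 * k + 1)%nat -> exists B, is_basis (order_ge k j) B.
Proof.
  induction i; intros j Hij.
  (* Here j = 2k + 1, and 2k < 3j makes every form of this order zero. *)
  - exists nil. split; [intros b []|]. split; [intros c _ i Hi; simpl in Hi; lia|].
    intros f [a [b [Hf Ha]]]. exists (fun _ => 0%C). intros tau Ht. simpl.
    apply (valence k f a b j 0 Hf); auto; [intros; lia|lia].
  - destruct (IHi (S j) ltac:(lia)) as [B [HB1 [HB2 HB3]]].
    assert (Sub : forall f, order_ge k (S j) f -> order_ge k j f).
    { intros f [a [b [Hf Ha]]]. exists a, b. split; auto. }
    destruct (classic (forall f, order_ge k j f -> order_ge k (S j) f)) as [h|h].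
    + exists B. split; [auto|]. split; auto.
    + apply not_all_ex_not in h. destruct h as [g Hg]. apply imply_to_and in Hg. destruct Hg as [Hg Hg'].
      pose proof Hg as [a [b [Hge Ha]]].
      assert (Haj : a j <> 0%C).
      { intros Z. apply Hg'. exists a, b. split; auto. intros n Hn.
        destruct (Nat.eq_dec n j) as [->|]; auto. apply Ha. lia. }
      exists (g :: B). split; [intros f [<-|Hf]; auto|]. split.
      * intros c Hc.
        assert (c0 : c O = 0%C).
        { destruct (order_ge_lincomb k (S j) B HB1 (fun i => c (S i))) as [a' [b' [H' Ha']]].
          pose proof (expansions_lincomb _ _ _ _ _ _ _ (c O) 1%C Hge H') as HS.
          assert (Z : forall n, (c O * a n + 1 * a' n)%C = PS0 n).
          { apply (qexp_unique 1 _ _ _ ltac:(lia) (expansions_qexp _ _ _ _ HS)).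
            apply has_qexp_PS; [lia|]. split; [apply disc_0|]. intros tau Ht.
            rewrite PS_PS0, <- (Hc tau Ht). simpl. ring. }
          specialize (Z j). rewrite (Ha' j) in Z by lia. unfold PS0 in Z.
          replace (c O) with ((c O * a j + 1 * 0) / a j)%C by (field; auto). rewrite Z. field. auto. }
        intros [|n] Hn; auto. simpl in Hn. apply (HB2 (fun i => c (S i))); [|lia].
        intros tau Ht. specialize (Hc tau Ht). simpl in Hc. rewrite c0 in Hc. rewrite <- Hc. ring.
      * intros f [a' [b' [Hf Ha']]].
        (* Subtracting this multiple of [g] cancels the coefficient of q^j and raises the order. *)
        destruct (HB3 (fun tau => 1 * f tau + - (a' j / a j) * g tau)%C) as [c Hc].
        { exists (fun n => 1 * a' n + - (a' j / a j) * a n)%C, (fun n => 1 * b' n + - (a' j / a j) * b n)%C.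
          split; [apply expansions_lincomb; auto|]. intros n Hn.
          destruct (Nat.eq_dec n j) as [->|]; [field; auto|].
          rewrite (Ha n), (Ha' n) by lia. ring. }
        exists (fun i => match i with O => (a' j / a j)%C | S m => c m end).
        intros tau Ht. simpl. change (fun i => c i) with c. rewrite <- Hc by auto. ring.
Qed.

Lemma modular_form_basis k : exists B, is_basis (modular_form 3 (2 * k)) B.
Proof.
  destruct (order_ge_basis k (2 * k + 1) 0 ltac:(lia)) as [B [H1 [H2 H3]]]. exists B.
  assert (E : forall f, order_ge k 0 f <-> modular_form 3 (2 * k) f).
  { intros f. split.
    - intros [a [b [H _]]]. apply (expansions_modular _ f a b); auto. exists k; auto.
    - intros H. destruct (modular_expansions _ f H) as [a [b Hab]]. exists a, b. split; auto. intros; lia. }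
  split; [intros b Hb; apply E; auto|]. split; auto. intros f Hf. apply H3, E, Hf.
Qed.

(** Dividing a cusp form of weight 6 by H leaves weight 0, hence a constant. Independence is tested
    at the point i. *)
Lemma cusp_form_6_basis F : (forall tau, upper tau -> F tau = H6 tau) -> is_basis (cusp_form 3 6) (F :: nil).
Proof.
  intros HF. split; [|split].
  - intros b [<-|[]]. apply (cusp_form_ext 6 H6); [exists 3%nat; auto|intros; symmetry; auto|].
    eapply expansions_cusp_form; [exists 3%nat; reflexivity|apply H6_expansions| |]; simpl; ring.
  - intros c Hc i Hi. simpl in Hi. replace i with O by lia.
    specialize (Hc Ci upper_Ci). simpl in Hc. rewrite HF in Hc by apply upper_Ci.
    pose proof (H6_neq0 Ci upper_Ci).
    replace (c O) with ((c O * H6 Ci + 0) / H6 Ci)%C by (field; auto). rewrite Hc. field. auto.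
  - intros f Hf. destruct (weight_0_constant _ (cusp_div_H6 0 f ltac:(exists 0%nat; auto) Hf)) as [c Hc].
    exists (fun _ => c). intros tau Ht. simpl. rewrite <- (Hc tau Ht), HF by auto.
    pose proof (H6_neq0 tau Ht). field. auto.
Qed.

Lemma F63_1_unitary F : (forall tau, upper tau -> F tau = H6 tau) -> unitary F.
Proof.
  intros HF. exists (unshift 0 h6), 1%nat. split; [apply H6_qexp; auto|]. split; [|apply h6_leading].
  intros m Hm. replace m with O by lia. reflexivity.
Qed.

Theorem mainTheorem7 :
  forall E63_1 : C -> C, is_E63_1 E63_1 ->
  (has_dim (cusp_form 3 6) 1 /\
   is_basis (cusp_form 3 6) (F63_1 E63_1 :: nil) /\
   unitary (F63_1 E63_1)) /\
  (forall k : nat, (4 <= k <= 9)%nat ->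
   exists dS dM d6 : nat,
     has_dim (cusp_form 3 (2 * k)) dS /\
     has_dim (modular_form 3 (2 * (k - 3))) dM /\
     has_dim (cusp_form 3 6) d6 /\
     (Z.of_nat dS - Z.of_nat dM = 0)%Z /\
     (0 = Z.of_nat d6 - 1)%Z) /\
  (forall k : nat, (3 <= k)%nat ->
   forall B : list (C -> C),
     uut_basis (modular_form 3 (2 * k - 6)) B ->
     uut_basis (cusp_form 3 (2 * k)) (scale_family (F63_1 E63_1) B)).
Proof.
  intros E HE. pose proof (F63_1_eq_H6 E HE) as HF. pose proof (cusp_form_6_basis _ HF) as H6B.
  assert (D6 : has_dim (cusp_form 3 6) 1) by (exists (F63_1 E :: nil); auto).
  split; [|split].
  - split; auto. split; auto. apply F63_1_unitary, HF.
  (* Both dimensions are the length of one list: a basis [B] and its image under multiplication by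
     F. *)
  - intros k Hk. destruct (modular_form_basis (k - 3)) as [B HB].
    exists (length B), (length B), 1%nat. split; [|split; [exists B; auto|]].
    + exists (scale_family (F63_1 E) B). split; [|apply length_map].
      replace (2 * k)%nat with (6 + 2 * (k - 3))%nat by lia.
      apply scale_family_basis; auto. exists (k - 3)%nat; auto.
    + split; auto. lia.
  - intros k Hk B [HB HU]. split; [|apply scale_family_triangular; auto].
    replace (2 * k)%nat with (6 + (2 * k - 6))%nat by lia.
    apply scale_family_basis; auto. exists (k - 3)%nat. lia.
Qed.
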